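(* Suppose that $\kappa_2\equiv\kappa_1-1\pmod e$ and $n\equiv 0\pmod e$. All modules are $\mathscr H_n^\Lambda$-modules, and composition factors are given up to isomorphism. 1. $S_{((n-1),(1))}$ has the composition series $$0\subset\operatorname{im}(\phi_1)\subset\operatorname{im}(\chi_1)\subset S_{((n-1),(1))},$$ which has composition factors $S_{((n),\varnothing)}$, $\operatorname{im}(\phi_2)$ and $\ker(\gamma_2)/\operatorname{im}(\phi_2)$ from bottom to top. 2. For all $m\in\{2,\dots,n-2\}$, $S_{((n-m),(1^m))}$ has the composition series $$0\subset\operatorname{im}(\phi_m)\subset\operatorname{im}(\chi_m)\subset\ker(\gamma_m)+\operatorname{im}(\chi_m)\subset S_{((n-m),(1^m))},$$ which has composition factors $\operatorname{im}(\phi_m)$, $\operatorname{im}(\phi_{m+1})$, $\ker(\gamma_m)/\operatorname{im}(\phi_m)$ and $\ker(\gamma_{m+1})/\operatorname{im}(\phi_{m+1})$ from bottom to top. 3. $S_{((1),(1^{n-1}))}$ has the composition series $$0\subset\operatorname{im}(\phi_{n-1})\subset\operatorname{im}(\gamma_{n-2})\subset S_{((1),(1^{n-1}))},$$ which has composition factors $\operatorname{im}(\phi_{n-1})$, $\operatorname{im}(\gamma_{n-2})/\operatorname{im}(\phi_{n-1})$ and $S_{(\varnothing,(1^n))}$ from bottom to top.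
   Context: Let $\mathbb F$ be a field, $e\geqslant 3$ an integer, $I=\mathbb Z/e\mathbb Z$, $n\geqslant 1$ an integer and $\kappa=(\kappa_1,\kappa_2)\in I^2$. For $i,j\in I$ write $i\to j$ if $j=i+1$ and $i\leftarrow j$ if $j=i-1$. The symmetric group $\mathfrak S_n$, with $s_r=(r,r+1)$, acts on $I^n$ by place permutations. Algebra. $\mathscr H_n$ is the unital associative $\mathbb F$-algebra with generators $e(\mathbf i)$ ($\mathbf i\in I^n$), $y_1,\dots,y_n$, $\psi_1,\dots,\psi_{n-1}$ and relations: $e(\mathbf i)e(\mathbf j)=\delta_{\mathbf i,\mathbf j}e(\mathbf i)$; $\sum_{\mathbf i}e(\mathbf i)=1$; $y_re(\mathbf i)=e(\mathbf i)y_r$; $\psi_re(\mathbf i)=e(s_r\mathbf i)\psi_r$; $y_ry_s=y_sy_r$; $\psi_ry_s=y_s\psi_r$ if $s\ne r,r+1$; $\psi_r\psi_s=\psi_s\psi_r$ if $|r-s|>1$; $\psi_ry_{r+1}e(\mathbf i)=(y_r\psi_r+\delta_{i_r,i_{r+1}})e(\mathbf i)$; $y_{r+1}\psi_re(\mathbf i)=(\psi_ry_r+\delta_{i_r,i_{r+1}})e(\mathbf i)$; $\psi_r^2e(\mathbf i)$ equals $0$ if $i_r=i_{r+1}$, $(y_{r+1}-y_r)e(\mathbf i)$ if $i_r\to i_{r+1}$, $(y_r-y_{r+1})e(\mathbf i)$ if $i_r\leftarrow i_{r+1}$, and $e(\mathbf i)$ otherwise; $\psi_r\psi_{r+1}\psi_re(\mathbf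 i)$ equals $(\psi_{r+1}\psi_r\psi_{r+1}+1)e(\mathbf i)$ if $i_{r+2}=i_r\to i_{r+1}$, $(\psi_{r+1}\psi_r\psi_{r+1}-1)e(\mathbf i)$ if $i_{r+2}=i_r\leftarrow i_{r+1}$, and $\psi_{r+1}\psi_r\psi_{r+1}e(\mathbf i)$ otherwise. The cyclotomic algebra $\mathscr H_n^\Lambda$ (level 2) is the quotient of $\mathscr H_n$ by the relations $y_1^{c(i_1)}e(\mathbf i)=0$ for all $\mathbf i\in I^n$, where $c(i)=\#\{j\in\{1,2\}:\kappa_j=i\}$. Specht modules labelled by hook bipartitions. For $0\leqslant m\leqslant n$ put $\mathbf i_{((n-m),(1^m))}=(\kappa_2,\kappa_2-1,\dots,\kappa_2-m+1,\kappa_1,\kappa_1+1,\dots,\kappa_1+n-m-1)\in I^n$. $S_{((n-m),(1^m))}$ is the module generated by $z=z_{((n-m),(1^m))}$ subject only to $e(\mathbf i_{((n-m),(1^m))})z=z$, $y_rz=0$ for $1\leqslant r\leqslant n$, and $\psi_rz=0$ for all $r\in\{1,\dots,n-1\}\setminus\{m\}$; it is an $\mathscr H_n^\Lambda$-module. The cases $m=0$ and $m=n$ are $S_{((n),\varnothing)}$ and $S_{(\varnothing,(1^n))}$. For $1\leqslant a_1<\dots<a_m\leqslant n$ define $v(a_1,\dots,a_m)=(\psi_{a_1-1}\cdots\psi_1)(\psi_{a_2-1}\cdots\psi_2)\cdots(\psi_{a_m-1}\cdots\psi_m)z$ (indices decreasing in each factor; the factor is $1$ if $a_j=j$). These form an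 $\mathbb F$-basis (standard basis) of $S_{((n-m),(1^m))}$. The Specht module $S_{((n-m,1^m),\varnothing)}$. For $0\leqslant m\leqslant n-1$ put $\mathbf j=(\kappa_1,\kappa_1-1,\dots,\kappa_1-m,\kappa_1+1,\kappa_1+2,\dots,\kappa_1+n-m-1)\in I^n$. $S_{((n-m,1^m),\varnothing)}$ is the module generated by $z=z_{((n-m,1^m),\varnothing)}$ subject only to $e(\mathbf j)z=z$, $y_rz=0$ for $1\leqslant r\leqslant n$, $\psi_rz=0$ for $r\in\{1,\dots,n-1\}\setminus\{m+1\}$, and, if $m\leqslant n-2$, $\psi_1\psi_2\cdots\psi_{m+1}z=0$; it is an $\mathscr H_n^\Lambda$-module. Homomorphisms. Assume $\kappa_2\equiv\kappa_1-1$ and $n\equiv 0\pmod e$ (so $n\equiv\kappa_2-\kappa_1+1$). The following are well-defined $\mathscr H_n^\Lambda$-homomorphisms. For $0\leqslant m\leqslant n-1$, $\gamma_m:S_{((n-m),(1^m))}\to S_{((n-m-1),(1^{m+1}))}$ with $\gamma_m(z_{((n-m),(1^m))})=v(1,\dots,m,n)$. For $1\leqslant m\leqslant n-1$, $\chi_m:S_{((n-m,1^m),\varnothing)}\to S_{((n-m),(1^m))}$ with $\chi_m(z_{((n-m,1^m),\varnothing)})=v(2,3,\dots,m+1)$. For $1\leqslant m\leqslant n-1$, $\phi_m:S_{((n-m+1,1^{m-1}),\varnothing)}\to S_{((n-m),(1^m))}$ with $\phi_m(z_{((n-m+1,1^{m-1}),\varnothing)})=v(2,\dots,m,n)$. One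 has $\operatorname{im}(\phi_m)\subseteq\ker(\gamma_m)$. *)

(* Defs.v *)
From HB Require Import structures.
From mathcomp Require Import all_boot all_algebra.
From mathcomp Require Import boolp.

Set Implicit Arguments.
Unset Strict Implicit.
Unset Printing Implicit Defensive.

Import GRing.Theory.
Local Open Scope ring_scope.
Local Open Scope quotient_scope.

(** * Unital associative algebras given by generators and relations *)

Section Presentation.
Variables (F : fieldType) (G : Type).

Inductive term : Type :=
| TGen of G
| TZero
| TOne
| TOpp of term
| TAdd of term & term
| TMul of term & term
| TScale of F & term.

HB.instance Definition _ := gen_eqMixin term.
HB.instance Definition _ := gen_choiceMixin term.

Variable rel : term -> term -> Prop.

(* The least congruence containing rel and the axioms of unital associative
   F-algebras. *)
Inductive cong : term -> term -> Prop :=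
| cong_refl a : cong a a
| cong_sym a b : cong a b -> cong b a
| cong_trans b a c : cong a b -> cong b c -> cong a c
| cong_opp a a' : cong a a' -> cong (TOpp a) (TOpp a')
| cong_add a a' b b' : cong a a' -> cong b b' -> cong (TAdd a b) (TAdd a' b')
| cong_mul a a' b b' : cong a a' -> cong b b' -> cong (TMul a b) (TMul a' b')
| cong_scale c a a' : cong a a' -> cong (TScale c a) (TScale c a')
| cong_addA a b c : cong (TAdd a (TAdd b c)) (TAdd (TAdd a b) c)
| cong_addC a b : cong (TAdd a b) (TAdd b a)
| cong_add0 a : cong (TAdd TZero a) a
| cong_addN a : cong (TAdd (TOpp a) a) TZero
| cong_mulA a b c : cong (TMul a (TMul b c)) (TMul (TMul a b) c)
| cong_mul1l a : cong (TMul TOne a) a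
| cong_mul1r a : cong (TMul a TOne) a
| cong_mulDl a b c : cong (TMul (TAdd a b) c) (TAdd (TMul a c) (TMul b c))
| cong_mulDr a b c : cong (TMul a (TAdd b c)) (TAdd (TMul a b) (TMul a c))
| cong_scaleA c d a : cong (TScale c (TScale d a)) (TScale (c * d) a)
| cong_scale1 a : cong (TScale 1 a) a
| cong_scaleDr c a b :
    cong (TScale c (TAdd a b)) (TAdd (TScale c a) (TScale c b))
| cong_scaleDl a c d : cong (TScale (c + d) a) (TAdd (TScale c a) (TScale d a))
| cong_scaleAl c a b : cong (TScale c (TMul a b)) (TMul (TScale c a) b)
| cong_scaleAr c a b : cong (TScale c (TMul a b)) (TMul a (TScale c b))
| cong_rel a b : rel a b -> cong a b.

Definition congb (a b : term) : bool := `[< cong a b >].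

Lemma congb_equiv : equiv_class_of congb.
Proof.
split=> [a|a b|b a c]; first by apply/asboolP; exact: cong_refl.
  by apply/asboolP/asboolP; exact: cong_sym.
by move=> /asboolP ab /asboolP bc; apply/asboolP; exact: cong_trans ab bc.
Qed.

Canonical congb_equivRel := EquivRelPack congb_equiv.
Canonical congb_encModRel := defaultEncModRel congb.

Definition presalg : Type := {eq_quot congb}.

HB.instance Definition _ := EqQuotient.on presalg.
HB.instance Definition _ := Choice.on presalg.

Definition pi_presalg (a : term) : presalg := \pi_presalg a.

Lemma pi_presalgP a b : cong a b <-> pi_presalg a = pi_presalg b.
Proof.
split=> [ab|/eqmodP /asboolP//].
by apply/eqmodP/asboolP.
Qed.

Lemma cong_repr a : cong (repr (pi_presalg a)) a.
Proof. by apply/pi_presalgP; rewrite /pi_presalg reprK. Qed.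

Lemma pi_presalgK (x : presalg) : pi_presalg (repr x) = x.
Proof. exact: reprK. Qed.

Let zero : presalg := pi_presalg TZero.
Let one : presalg := pi_presalg TOne.
Let opp (x : presalg) : presalg := pi_presalg (TOpp (repr x)).
Let add (x y : presalg) : presalg := pi_presalg (TAdd (repr x) (repr y)).
Let mul (x y : presalg) : presalg := pi_presalg (TMul (repr x) (repr y)).
Let scale (c : F) (x : presalg) : presalg := pi_presalg (TScale c (repr x)).

Let piN a : opp (pi_presalg a) = pi_presalg (TOpp a).
Proof. by apply/pi_presalgP/cong_opp/cong_repr. Qed.
Let piD a b : add (pi_presalg a) (pi_presalg b) = pi_presalg (TAdd a b).
Proof. by apply/pi_presalgP/cong_add; apply/cong_repr. Qed.
Let piM a b : mul (pi_presalg a) (pi_presalg b) = pi_presalg (TMul a b).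
Proof. by apply/pi_presalgP/cong_mul; apply/cong_repr. Qed.
Let piZ c a : scale c (pi_presalg a) = pi_presalg (TScale c a).
Proof. by apply/pi_presalgP/cong_scale/cong_repr. Qed.

Let addA : associative add.
Proof.
move=> x y z; rewrite -[x]pi_presalgK -[y]pi_presalgK -[z]pi_presalgK !piD.
exact/pi_presalgP/cong_addA.
Qed.
Let addC : commutative add.
Proof.
move=> x y; rewrite -[x]pi_presalgK -[y]pi_presalgK !piD.
exact/pi_presalgP/cong_addC.
Qed.
Let add0 : left_id zero add.
Proof. by move=> x; rewrite -[x]pi_presalgK piD; exact/pi_presalgP/cong_add0. Qed.
Let addN : left_inverse zero opp add.
Proof.
by move=> x; rewrite -[x]pi_presalgK piN piD; exact/pi_presalgP/cong_addN.
Qed.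

HB.instance Definition _ := GRing.isZmodule.Build presalg addA addC add0 addN.

Let mulA : associative mul.
Proof.
move=> x y z; rewrite -[x]pi_presalgK -[y]pi_presalgK -[z]pi_presalgK !piM.
exact/pi_presalgP/cong_mulA.
Qed.
Let mul1l : left_id one mul.
Proof. by move=> x; rewrite -[x]pi_presalgK piM; exact/pi_presalgP/cong_mul1l. Qed.
Let mul1r : right_id one mul.
Proof. by move=> x; rewrite -[x]pi_presalgK piM; exact/pi_presalgP/cong_mul1r. Qed.
Let mulDl : left_distributive mul add.
Proof.
move=> x y z; rewrite -[x]pi_presalgK -[y]pi_presalgK -[z]pi_presalgK.
by rewrite !(piM, piD); exact/pi_presalgP/cong_mulDl.
Qed.
Let mulDr : right_distributive mul add.
Proof.
move=> x y z; rewrite -[x]pi_presalgK -[y]pi_presalgK -[z]pi_presalgK.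
by rewrite !(piM, piD); exact/pi_presalgP/cong_mulDr.
Qed.

(* A presented algebra may be zero, so it is not given MathComp's algType
   structure, which requires 1 != 0; the two compatibility axioms between
   scalars and products are presalg_scaleAl and presalg_scaleAr below. *)
HB.instance Definition _ :=
  GRing.Zmodule_isPzRing.Build presalg mulA mul1l mul1r mulDl mulDr.

Let scaleA c d x : scale c (scale d x) = scale (c * d) x.
Proof. by rewrite -[x]pi_presalgK !piZ; exact/pi_presalgP/cong_scaleA. Qed.
Let scale1 : left_id 1 scale.
Proof. by move=> x; rewrite -[x]pi_presalgK piZ; exact/pi_presalgP/cong_scale1. Qed.
Let scaleDr : right_distributive scale +%R.
Proof.
move=> c x y; rewrite -[x]pi_presalgK -[y]pi_presalgK.
rewrite [X in scale c X]piD !piZ [RHS]piD; exact/pi_presalgP/cong_scaleDr.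
Qed.
Let scaleDl x : {morph scale^~ x : c d / c + d}.
Proof.
move=> c d /=; rewrite -[x]pi_presalgK !piZ [RHS]piD.
exact/pi_presalgP/cong_scaleDl.
Qed.

HB.instance Definition _ :=
  GRing.Zmodule_isLmodule.Build F presalg scaleA scale1 scaleDr scaleDl.

Lemma presalg_scaleAl (c : F) (x y : presalg) : c *: (x * y) = (c *: x) * y.
Proof.
rewrite -[x]pi_presalgK -[y]pi_presalgK.
change (scale c (mul (pi_presalg (repr x)) (pi_presalg (repr y))) =
  mul (scale c (pi_presalg (repr x))) (pi_presalg (repr y))).
rewrite !(piM, piZ); exact/pi_presalgP/cong_scaleAl.
Qed.

Lemma presalg_scaleAr (c : F) (x y : presalg) : c *: (x * y) = x * (c *: y).
Proof.
rewrite -[x]pi_presalgK -[y]pi_presalgK.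
change (scale c (mul (pi_presalg (repr x)) (pi_presalg (repr y))) =
  mul (pi_presalg (repr x)) (scale c (pi_presalg (repr y)))).
rewrite !(piM, piZ); exact/pi_presalgP/cong_scaleAr.
Qed.

End Presentation.

Arguments TGen {F G}.
Arguments TZero {F G}.
Arguments TOne {F G}.

(** * Submodules, quotients and composition series of left modules *)

Section Submodules.
Variables (R : pzRingType) (V : lmodType R).

Definition zero_pred : {pred V} := fun x => x == 0.
Lemma zero_pred_closed : GRing.subsemimod_closed zero_pred.
Proof.
split; first split; rewrite ?unfold_in ?eqxx //.
  by move=> x y /eqP-> /eqP->; rewrite unfold_in addr0.
by move=> a x /eqP->; rewrite unfold_in scaler0.
Qed.
HB.instance Definition _ :=
  GRing.isSubmodClosed.Build R V zero_pred zero_pred_closed.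
Definition zero_sub : submodClosed V := zero_pred.

Definition full_pred : {pred V} := fun=> true.
Lemma full_pred_closed : GRing.subsemimod_closed full_pred.
Proof. by []. Qed.
HB.instance Definition _ :=
  GRing.isSubmodClosed.Build R V full_pred full_pred_closed.
Definition full_sub : submodClosed V := full_pred.

Definition add_pred (N K : submodClosed V) : {pred V} :=
  fun x => `[< exists2 y, y \in N & exists2 z, z \in K & x = y + z >].
Lemma add_pred_closed N K : GRing.subsemimod_closed (add_pred N K).
Proof.
split; first split.
- by apply/asboolP; exists 0; rewrite ?rpred0 //; exists 0; rewrite ?rpred0 ?addr0.
- move=> _ _ /asboolP[y Ny [z Kz ->]] /asboolP[y' Ny' [z' Kz' ->]].
  apply/asboolP; exists (y + y'); first exact: rpredD.
  by exists (z + z'); rewrite ?rpredD // addrACA.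
- move=> a _ /asboolP[y Ny [z Kz ->]]; apply/asboolP.
  exists (a *: y); first exact: rpredZ.
  by exists (a *: z); rewrite ?rpredZ // scalerDr.
Qed.
HB.instance Definition _ N K :=
  GRing.isSubmodClosed.Build R V (add_pred N K) (add_pred_closed N K).
Definition add_sub (N K : submodClosed V) : submodClosed V := add_pred N K.

Definition span_pred (P : V -> Prop) : {pred V} :=
  fun x => `[< forall N : submodClosed V, (forall y, P y -> y \in N) -> x \in N >].
Lemma span_pred_closed P : GRing.subsemimod_closed (span_pred P).
Proof.
split; first split.
- by apply/asboolP => N _; exact: rpred0.
- move=> x y /asboolP Px /asboolP Py; apply/asboolP => N PN.
  by rewrite rpredD ?Px ?Py.
- by move=> a x /asboolP Px; apply/asboolP => N PN; rewrite rpredZ ?Px.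
Qed.
HB.instance Definition _ P :=
  GRing.isSubmodClosed.Build R V (span_pred P) (span_pred_closed P).
Definition span_sub (P : V -> Prop) : submodClosed V := span_pred P.

Definition submod (N : submodClosed V) : Type := {x : V | x \in N}.
HB.instance Definition _ (N : submodClosed V) := SubChoice.on (submod N).
HB.instance Definition _ (N : submodClosed V) :=
  [SubChoice_isSubLmodule of submod N by <:].

(* MathComp's submodClosed does not carry opposites. *)
Definition zmod_of_submod (N : submodClosed V) : {pred V} := fun x => x \in N.
Lemma zmod_of_submod_closed N : zmod_closed (zmod_of_submod N).
Proof.
split=> [|x y Nx Ny]; first exact: rpred0.
by rewrite unfold_in -scaleN1r; apply: rpredD => //; apply: rpredZ.
Qed.
HB.instance Definition _ N :=
  GRing.isZmodClosed.Build V (zmod_of_submod N) (zmod_of_submod_closed N).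

Definition quotmod (N : submodClosed V) : Type := Quotient.quot (zmod_of_submod N).

Section QuotModule.
Variable N : submodClosed V.

HB.instance Definition _ := GRing.Zmodule.on (quotmod N).

Definition pi_quotmod (x : V) : quotmod N := \pi_(Quotient.quot (zmod_of_submod N)) x.

Lemma pi_quotmodP x y : pi_quotmod x = pi_quotmod y <-> x - y \in N.
Proof.
split=> [/eqP|xy]; first by rewrite /pi_quotmod -Quotient.idealrBE.
by apply/eqP; rewrite /pi_quotmod -Quotient.idealrBE.
Qed.

Lemma pi_quotmodK (u : quotmod N) : pi_quotmod (repr u) = u.
Proof. exact: reprK. Qed.

Lemma pi_quotmodD x y : pi_quotmod (x + y) = pi_quotmod x + pi_quotmod y.
Proof. by rewrite /pi_quotmod piE. Qed.

Let scale (a : R) (u : quotmod N) : quotmod N := pi_quotmod (a *: repr u).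

Let piZ a x : scale a (pi_quotmod x) = pi_quotmod (a *: x).
Proof.
apply/pi_quotmodP; rewrite -scalerBr; apply: rpredZ.
by apply/pi_quotmodP; rewrite pi_quotmodK.
Qed.
Let scaleA a b u : scale a (scale b u) = scale (a * b) u.
Proof. by rewrite -[u]pi_quotmodK !piZ scalerA. Qed.
Let scale1 : left_id 1 scale.
Proof. by move=> u; rewrite -[u]pi_quotmodK piZ scale1r. Qed.
Let scaleDr : right_distributive scale +%R.
Proof.
move=> a u w; rewrite -[u]pi_quotmodK -[w]pi_quotmodK.
by rewrite -pi_quotmodD !piZ scalerDr pi_quotmodD.
Qed.
Let scaleDl u : {morph scale^~ u : a b / a + b}.
Proof.
by move=> a b /=; rewrite -[u]pi_quotmodK !piZ scalerDl pi_quotmodD.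
Qed.

HB.instance Definition _ :=
  GRing.Zmodule_isLmodule.Build R (quotmod N) scaleA scale1 scaleDr scaleDl.

Lemma pi_quotmod_linear : linear pi_quotmod.
Proof. by move=> a x y; rewrite pi_quotmodD -piZ. Qed.
HB.instance Definition _ :=
  GRing.isLinear.Build R V (quotmod N) *:%R pi_quotmod pi_quotmod_linear.

End QuotModule.

End Submodules.

Arguments zero_sub {R} V.
Arguments full_sub {R} V.

Section KernelImage.
Variables (R : pzRingType) (U V : lmodType R) (f : {linear U -> V}).

Definition ker_pred : {pred U} := fun x => f x == 0.
Lemma ker_pred_closed : GRing.subsemimod_closed ker_pred.
Proof.
split; first split; first by rewrite unfold_in linear0.
  by move=> x y /eqP fx /eqP fy; rewrite unfold_in linearD fx fy addr0.
by move=> a x /eqP fx; rewrite unfold_in linearZ /= fx scaler0.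
Qed.
HB.instance Definition _ := GRing.isSubmodClosed.Build R U ker_pred ker_pred_closed.
Definition ker : submodClosed U := ker_pred.

Definition im_pred : {pred V} := fun y => `[< exists x, f x = y >].
Lemma im_pred_closed : GRing.subsemimod_closed im_pred.
Proof.
split; first split; first by apply/asboolP; exists 0; rewrite linear0.
  move=> _ _ /asboolP[x <-] /asboolP[y <-]; apply/asboolP; exists (x + y).
  by rewrite linearD.
by move=> a _ /asboolP[x <-]; apply/asboolP; exists (a *: x); rewrite linearZ.
Qed.
HB.instance Definition _ := GRing.isSubmodClosed.Build R V im_pred im_pred_closed.
Definition im : submodClosed V := im_pred.

End KernelImage.

Section CompositionSeries.
Variables (R : pzRingType) (V : lmodType R).
Implicit Types N K : submodClosed V.

Definition restr_pred N K : {pred submod N} := fun x => val x \in K.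
Arguments restr_pred : clear implicits.
Lemma restr_pred_closed N K : GRing.subsemimod_closed (restr_pred N K).
Proof.
split; first split; first by rewrite unfold_in linear0 rpred0.
  by move=> x y Kx Ky; rewrite unfold_in linearD; apply: rpredD.
by move=> a x Kx; rewrite unfold_in linearZ /=; apply: rpredZ.
Qed.
HB.instance Definition _ N K :=
  GRing.isSubmodClosed.Build R (submod N) (restr_pred N K) (restr_pred_closed N K).
Definition restr_sub N K : submodClosed (submod N) := restr_pred N K.

(* N / K; it is only used when K is contained in N. *)
Definition subquot N K : lmodType R := quotmod (restr_sub N K).

Definition simple_module (M : lmodType R) : Prop :=
  (exists x : M, x != 0) /\
  forall N : submodClosed M,
    (forall x, x \in N -> x = 0) \/ (forall x, x \in N).

Definition isomorphic (M M' : lmodType R) : Prop :=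
  exists f : {linear M -> M'}, bijective f.

Fixpoint simple_steps K (s : seq (submodClosed V)) : Prop :=
  if s is N :: s' then
    [/\ {subset K <= N}, simple_module (subquot N K) & simple_steps N s']
  else forall x, x \in K.

(* composition_series V [:: N_1; ...; N_k] says that 0 < N_1 < ... < N_k = V is
   a composition series; the inclusions are strict since the successive
   quotients are simple, hence nonzero. *)
Definition composition_series (s : seq (submodClosed V)) : Prop :=
  simple_steps (zero_sub V) s.

End CompositionSeries.

Arguments composition_series {R} V s.

(** * Cyclic modules given by a generator and relations *)

Section CyclicModule.
Variables (R : pzRingType) (P : R -> Prop).

(* The left R-module generated by z subject only to the relations h z = 0
   for all h satisfying P, realised as R modulo the left ideal generated by P. *)
Definition cycmod : lmodType R := quotmod (span_sub (P : R^o -> Prop)).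

Definition cycgen : cycmod := pi_quotmod (span_sub (P : R^o -> Prop)) (1 : R^o).

Lemma cycgenP (x : cycmod) : exists h : R, x = h *: cycgen.
Proof.
exists (repr x); rewrite -linearZ /= -[LHS]pi_quotmodK; congr (pi_quotmod _ _).
by rewrite /GRing.scale /= mulr1.
Qed.

Lemma cycgen_rel h : P h -> h *: cycgen = 0.
Proof.
move=> Ph; rewrite -linearZ -(linear0 (pi_quotmod (span_sub (P : R^o -> Prop)))).
apply/pi_quotmodP; rewrite subr0; apply/asboolP => N PN.
by rewrite /GRing.scale /= mulr1; apply: PN.
Qed.

Lemma cycmod_hom_unique (M : lmodType R) (f g : {linear cycmod -> M}) :
  f cycgen = g cycgen -> f =1 g.
Proof. by move=> fg x; have [h ->] := cycgenP x; rewrite !linearZ /= fg. Qed.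

(* The homomorphism sending the generator to v; the zero map if there is none. *)
Definition cychom (M : lmodType R) (v : M) : {linear cycmod -> M} :=
  if pselect (exists f : {linear cycmod -> M}, f cycgen = v) is left h
  then projT1 (cid h) else \0.

Lemma cychomE (M : lmodType R) (v : M) :
  (forall h, P h -> h *: v = 0) -> cychom v cycgen = v.
Proof.
move=> Pv; rewrite /cychom; case: pselect => [h|[]]; first by case: cid.
pose ev (h : R^o) : M := @GRing.scale R M h v.
have ev_lin : linear ev by move=> a x y; rewrite /ev scalerDl -scalerA.
pose E : {linear R^o -> M} :=
  HB.pack ev (GRing.isLinear.Build R R^o M *:%R ev ev_lin).
pose N : submodClosed R^o := ker E.
have wd (x : cycmod) (h : R) : x = h *: cycgen -> ev (repr x) = h *: v.
  move=> xh; apply/eqP; rewrite -subr_eq0 -[h *: v]/(ev h) -[ev]/(E : _ -> _).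
  rewrite -linearB.
  suff /asboolP/(_ N): (repr x - h : R^o) \in span_sub (P : R^o -> Prop).
    by apply=> y Py; rewrite unfold_in; apply/eqP/Pv.
  apply/pi_quotmodP; rewrite pi_quotmodK xh -linearZ /=; congr (pi_quotmod _ _).
  by rewrite /GRing.scale /= mulr1.
pose f (x : cycmod) : M := ev (repr x).
have flin : linear f.
  move=> a x y; have [[h xh] [k yk]] := (cycgenP x, cycgenP y).
  rewrite /f (wd x h) // (wd y k) // (wd _ (a * h + k)); last first.
    by rewrite xh yk scalerDl scalerA.
  by rewrite scalerDl scalerA.
pose F : {linear cycmod -> M} :=
  HB.pack f (GRing.isLinear.Build R cycmod M *:%R f flin).
by exists F; rewrite /= /f (wd _ 1) ?scale1r.
Qed.

End CyclicModule.

(** * The cyclotomic quiver Hecke algebra of level 2 *)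

Declare Scope palg_scope.
Delimit Scope palg_scope with palg.
Bind Scope palg_scope with term.

Notation "0" := TZero : palg_scope.
Notation "1" := TOne : palg_scope.
Notation "- a" := (TOpp a) : palg_scope.
Notation "a + b" := (TAdd a b) : palg_scope.
Notation "a - b" := (TAdd a (TOpp b)) : palg_scope.
Notation "a * b" := (TMul a b) : palg_scope.

Section QuiverHecke.
Variables (F : fieldType) (e n : nat).

(* I^n; the entries i_1, ..., i_n are numbered from 1. *)
Definition mi : Type := n.-tuple 'Z_e.

Definition ent (i : mi) (r : nat) : 'Z_e := nth 0 i r.-1.

Definition mi_of (f : nat -> 'Z_e) : mi := [tuple f r.+1 | r < n].

Definition swap (r : nat) (i : mi) : mi :=
  mi_of (fun p => ent i (if p == r then r.+1 else if p == r.+1 then r else p)).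

Inductive gen : Type :=
| GenE of mi
| GenY of {r : nat | (1 <= r <= n)%N}
| GenPsi of {r : nat | (1 <= r <= n.-1)%N}.

Local Notation tm := (term F gen).

Definition tE (i : mi) : tm := TGen (GenE i).
(* The junk value for an index out of range is 0. *)
Definition tY (r : nat) : tm :=
  if insub r is Some k then TGen (GenY k) else TZero.
Definition tPsi (r : nat) : tm :=
  if insub r is Some k then TGen (GenPsi k) else TZero.

Definition tdelta (b : bool) : tm := if b then TOne else TZero.

(* i -> j *)
Definition arr (i j : 'Z_e) : bool := j == i + 1.

Local Open Scope palg_scope.

Inductive klr_rel : tm -> tm -> Prop :=
| klr_ee i j : klr_rel (tE i * tE j) (if i == j then tE i else 0)
| klr_sum : klr_rel (\big[@TAdd F gen/0]_(i : mi) tE i) 1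
| klr_ye r i : (1 <= r <= n)%N -> klr_rel (tY r * tE i) (tE i * tY r)
| klr_psie r i : (1 <= r <= n.-1)%N ->
    klr_rel (tPsi r * tE i) (tE (swap r i) * tPsi r)
| klr_yy r s : (1 <= r <= n)%N -> (1 <= s <= n)%N ->
    klr_rel (tY r * tY s) (tY s * tY r)
| klr_psiy r s : (1 <= r <= n.-1)%N -> (1 <= s <= n)%N -> (s != r)%N -> (s != r.+1)%N ->
    klr_rel (tPsi r * tY s) (tY s * tPsi r)
| klr_psipsi r s : (1 <= r <= n.-1)%N -> (1 <= s <= n.-1)%N ->
    (r.+1 < s)%N || (s.+1 < r)%N ->
    klr_rel (tPsi r * tPsi s) (tPsi s * tPsi r)
| klr_psiyS r i : (1 <= r <= n.-1)%N ->
    klr_rel (tPsi r * tY r.+1 * tE i)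
            ((tY r * tPsi r + tdelta (ent i r == ent i r.+1)) * tE i)
| klr_ySpsi r i : (1 <= r <= n.-1)%N ->
    klr_rel (tY r.+1 * tPsi r * tE i)
            ((tPsi r * tY r + tdelta (ent i r == ent i r.+1)) * tE i)
| klr_quad r i : (1 <= r <= n.-1)%N ->
    klr_rel (tPsi r * tPsi r * tE i)
      (if ent i r == ent i r.+1 then 0
       else if arr (ent i r) (ent i r.+1) then (tY r.+1 - tY r) * tE i
       else if arr (ent i r.+1) (ent i r) then (tY r - tY r.+1) * tE i
       else tE i)
| klr_braid r i : (1 <= r)%N -> (r.+1 <= n.-1)%N ->
    klr_rel (tPsi r * tPsi r.+1 * tPsi r * tE i)
      (if (ent i r.+2 == ent i r) && arr (ent i r) (ent i r.+1) then
         (tPsi r.+1 * tPsi r * tPsi r.+1 + 1) * tE i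
       else if (ent i r.+2 == ent i r) && arr (ent i r.+1) (ent i r) then
         (tPsi r.+1 * tPsi r * tPsi r.+1 - 1) * tE i
       else tPsi r.+1 * tPsi r * tPsi r.+1 * tE i).

Variable kappa : 'Z_e * 'Z_e.

(* c(i) *)
Definition level (i : 'Z_e) : nat := (kappa.1 == i) + (kappa.2 == i).

Inductive cyc_rel : tm -> tm -> Prop :=
| cyc_klr a b : klr_rel a b -> cyc_rel a b
| cyc_y1 i : cyc_rel (iter (level (ent i 1)) (TMul (tY 1)) 1 * tE i) 0.

Definition cycKLR : Type := presalg cyc_rel.
HB.instance Definition _ := GRing.PzRing.on cycKLR.
HB.instance Definition _ := GRing.Lmodule.on cycKLR.

Local Close Scope palg_scope.

Definition klr_e (i : mi) : cycKLR := pi_presalg cyc_rel (tE i).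
Definition klr_y (r : nat) : cycKLR := pi_presalg cyc_rel (tY r).
Definition klr_psi (r : nat) : cycKLR := pi_presalg cyc_rel (tPsi r).

(** * Specht modules *)

(* The residue sequence of ((n-m),(1^m)). *)
Definition res_bihook (m : nat) : mi :=
  mi_of (fun r => if (r <= m)%N then kappa.2 - (r - 1)%:R
                  else kappa.1 + (r - m - 1)%:R).

Inductive bihook_rel (m : nat) : cycKLR -> Prop :=
| bihook_e : bihook_rel m (klr_e (res_bihook m) - 1)
| bihook_y r : (1 <= r <= n)%N -> bihook_rel m (klr_y r)
| bihook_psi r : (1 <= r <= n.-1)%N -> r != m -> bihook_rel m (klr_psi r).

(* S_((n-m),(1^m)), presented as a module over the cyclotomic algebra. *)
Definition S_bihook (m : nat) : lmodType cycKLR := cycmod (bihook_rel m).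
Definition z_bihook (m : nat) : S_bihook m := cycgen (bihook_rel m).

(* The residue sequence of ((n-m,1^m),0). *)
Definition res_hook (m : nat) : mi :=
  mi_of (fun r => if (r <= m.+1)%N then kappa.1 - (r - 1)%:R
                  else kappa.1 + (r - m - 1)%:R).

Inductive hook_rel (m : nat) : cycKLR -> Prop :=
| hook_e : hook_rel m (klr_e (res_hook m) - 1)
| hook_y r : (1 <= r <= n)%N -> hook_rel m (klr_y r)
| hook_psi r : (1 <= r <= n.-1)%N -> r != m.+1 -> hook_rel m (klr_psi r)
| hook_garnir : (m.+2 <= n)%N -> hook_rel m (\prod_(1 <= r < m.+2) klr_psi r).

(* S_((n-m,1^m),0), presented as a module over the cyclotomic algebra. *)
Definition S_hook (m : nat) : lmodType cycKLR := cycmod (hook_rel m).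
Definition z_hook (m : nat) : S_hook m := cycgen (hook_rel m).

(* psi_b psi_(b-1) ... psi_a, which is 1 if b < a *)
Definition psi_down (b a : nat) : cycKLR := \prod_(r <- rev (index_iota a b.+1)) klr_psi r.

(* v(a_1, ..., a_m), with the list a numbered from 0 by nth *)
Definition vtab (m : nat) (a : seq nat) : S_bihook m :=
  (\prod_(1 <= j < m.+1) psi_down (nth 0%N a j.-1 - 1) j) *: z_bihook m.

Definition gamma (m : nat) : {linear S_bihook m -> S_bihook m.+1} :=
  cychom (bihook_rel m) (vtab m.+1 (rcons (iota 1 m) n)).

Definition chi (m : nat) : {linear S_hook m -> S_bihook m} :=
  cychom (hook_rel m) (vtab m (iota 2 m)).

Definition phi (m : nat) : {linear S_hook m.-1 -> S_bihook m} :=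
  cychom (hook_rel m.-1) (vtab m (rcons (iota 2 m.-1) n)).

End QuiverHecke.

(* Main.v *)
Require Import Defs.
From HB Require Import structures.
From mathcomp Require Import all_boot all_algebra.
From mathcomp Require Import boolp.
From mathcomp Require Import zify ring.

(* Write L for a node of the leg (1^m) and A for a node of the arm (n-m); then
   v(a_1, ..., a_m) is the word of length n with L in the positions a_j. As
   kappa_2 = kappa_1 - 1, an L and an A competing for position r have residues
   differing by r, so psi_r and y_r act on words by local rules that depend only
   on r modulo e. These rules define a representation on the span of all words,
   the Fock module; by induction on the number of inversions its part with m
   letters L is isomorphic to S_((n-m),(1^m)). There gamma_m turns a final A into
   L, and im chi_m, ker gamma_m = im gamma_(m-1) and im phi_m are spanned by the
   words that start with A, end with L, or both. So each factor of the series is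
   spanned by the words with prescribed first and last letters. It is simple: a
   nonzero submodule contains a single word, because two words are separated by
   some e(i) or some y_q, and words with the same ends and the same number of L's
   are connected by the psi_r and y_r. *)

(** The rules are forced by the relations. On L A in positions r, r + 1 the exchange by psi_r is how
    standard vectors are built. A descent A L is psi_r of L A, so the quadratic relation gives its
    image under psi_r. On two equal letters the braid relation leaves a term only next to a multiple
    of e; hence the windows of three letters and their signs.

    Conversely, it has to be proved that these rules satisfy all relations. Each relation concerns
    boundedly many consecutive letters and classes, so one finite computation settles it for all e
    and n. As the words are independent in the Fock module by construction, this also gives the
    independence of the standard vectors.

    Apart from turning L A into A L, a generator can only exchange an A in position i with a later L
    in position j, where 1 < i and, as e divides n, j < n. So a first A and a last L never change,
    which is where the submodules come from. Also because e divides n, an L and an A in position n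
    have the same residue, so the last letter can be altered compatibly with the e(i). *)

Set Implicit Arguments.
Unset Strict Implicit.
Unset Printing Implicit Defensive.

Import GRing.Theory.

(** * Words *)

Section Words.
Variable n : nat.

Definition word : Type := n.-tuple bool.
HB.instance Definition _ := Finite.on word.

Implicit Types w u : word.

(* The letter in position p, where true is L and false is A. The sentinels, L in
   position 0 and A beyond n, make the local rules below correct at both ends. *)
Definition lw w (p : nat) : bool := nth false (true :: w) p.

Lemma lw0 w : lw w 0 = true. Proof. by []. Qed.

Lemma lw_out w p : n < p -> lw w p = false.
Proof. by case: p => // p np; rewrite /lw /= nth_default // size_tuple. Qed.

Lemma eq_word w u : (forall p, 0 < p <= n -> lw w p = lw u p) -> w = u.
Proof.
move=> wu; apply/val_inj/(@eq_from_nth _ false); first by rewrite !size_tuple.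
by move=> p; rewrite size_tuple => pn; apply: (wu p.+1).
Qed.

Definition mkword (f : nat -> bool) : word := [tuple f p.+1 | p < n].

Lemma lw_mk f p : 0 < p <= n -> lw (mkword f) p = f p.
Proof.
case: p => // p pn; rewrite /lw /= (nth_map (Ordinal pn)) ?size_enum_ord //.
by congr (f _.+1); rewrite nth_enum_ord.
Qed.

Definition tr (i j p : nat) : nat := if p == i then j else if p == j then i else p.

Lemma tr_l i j : tr i j i = j. Proof. by rewrite /tr eqxx. Qed.
Lemma tr_r i j : tr i j j = i. Proof. by rewrite /tr eqxx; case: eqP. Qed.
Lemma tr_out i j p : p != i -> p != j -> tr i j p = p.
Proof. by rewrite /tr => /negPf-> /negPf->. Qed.

Definition swp i j w : word := mkword (fun p => lw w (tr i j p)).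

Lemma lw_swp i j w p : 0 < i <= n -> 0 < j <= n ->
  lw (swp i j w) p = lw w (tr i j p).
Proof.
move=> i_n j_n; case: (posnP p) => [->|p_gt0].
  by rewrite /tr !ltn_eqF //; lia.
have [pn|np] := leqP p n; first by rewrite lw_mk ?p_gt0.
by rewrite /tr !gtn_eqF ?lw_out //; lia.
Qed.

Lemma swpK i j : 0 < i <= n -> 0 < j <= n -> involutive (swp i j).
Proof.
move=> i_n j_n w; apply: eq_word => p _; rewrite !lw_swp //; congr (lw w _).
by rewrite /tr; do !case: eqP => //; lia.
Qed.

Definition cnt w p : nat := \sum_(1 <= q < p) lw w q.
Definition weight w : nat := cnt w n.+1.
(** Up to a constant depending on the weight, this is the number of pairs formed by an A and a later
    L; it is the measure of the inductions below. *)
Definition len w : nat := \sum_(1 <= q < n.+1) q * lw w q.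

Lemma cnt1 w : cnt w 1 = 0. Proof. by rewrite /cnt big_geq. Qed.

Lemma cntS w p : 0 < p -> cnt w p.+1 = cnt w p + lw w p.
Proof. by move=> p_gt0; rewrite /cnt big_nat_recr. Qed.

Lemma cnt_le w p : cnt w p.+1 <= p.
Proof.
elim: p => [|p IHp]; first by rewrite cnt1.
by rewrite cntS //; case: (lw _ _); lia.
Qed.

Lemma eq_cnt_from b w u p : 0 < b <= p -> cnt w b = cnt u b ->
  (forall q, b <= q < p -> lw w q = lw u q) -> cnt w p = cnt u p.
Proof.
move=> /andP[b_gt0 bp] Eb E; rewrite /cnt (big_cat_nat b_gt0 bp) /=.
rewrite [RHS](big_cat_nat b_gt0 bp) /=; congr (_ + _); first exact: Eb.
by apply: eq_big_nat => q qP; rewrite E.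
Qed.

Lemma eq_cnt w u p : (forall q, 0 < q < p -> lw w q = lw u q) -> cnt w p = cnt u p.
Proof. by move=> E; apply: eq_big_nat => q qP; rewrite E. Qed.

(** Additive form, free of truncated subtraction. A constant [g] gives the weight, the identity
    gives [len], and the indicator of an initial segment gives [cnt]. *)
Lemma sum_swp (g : nat -> nat) i j w : 0 < i <= n -> 0 < j <= n -> i != j ->
  \sum_(1 <= p < n.+1) g p * lw (swp i j w) p + (g i * lw w i + g j * lw w j) =
  \sum_(1 <= p < n.+1) g p * lw w p + (g i * lw w j + g j * lw w i).
Proof.
move=> i_n j_n ij.
have split h : \sum_(1 <= p < n.+1) g p * h p = g i * h i + (g j * h j +
    \sum_(1 <= p < n.+1 | (p != i) && (p != j)) g p * h p).
  rewrite (bigD1_seq i) ?iota_uniq ?mem_index_iota //=; congr (_ + _).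
  rewrite big_mkcond (bigD1_seq j) ?iota_uniq ?mem_index_iota //= [j == i]eq_sym ij.
  congr (_ + _); rewrite big_mkcond [RHS]big_mkcond; apply: eq_bigr => p _.
  by case: (p == i); case: (p == j).
rewrite !split [X in _ + (_ + X) + _ = _](eq_bigr (fun p => g p * lw w p)).
  by rewrite !lw_swp // /tr !eqxx [j == i]eq_sym (negPf ij); lia.
by move=> p /andP[/negPf pi /negPf pj]; rewrite lw_swp // /tr pi pj.
Qed.

Lemma weight_swp i j w : 0 < i <= n -> 0 < j <= n -> i != j ->
  weight (swp i j w) = weight w.
Proof.
move=> i_n j_n ij; have := sum_swp (fun=> 1) w i_n j_n ij.
by under eq_bigr do rewrite mul1n; under [X in _ = X + _]eq_bigr do rewrite mul1n;
  rewrite /weight /cnt; lia.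
Qed.

Lemma len_swp i j w : 0 < i <= n -> 0 < j <= n -> i < j -> ~~ lw w i -> lw w j ->
  len (swp i j w) + (j - i) = len w.
Proof.
move=> i_n j_n ij /negPf wi wj; have := sum_swp id w i_n j_n (negbT (ltn_eqF ij)).
by rewrite wi wj -/(len _) -/(len w); lia.
Qed.

Lemma len_swpU i j w : 0 < i <= n -> 0 < j <= n -> i < j -> lw w i -> ~~ lw w j ->
  len (swp i j w) = len w + (j - i).
Proof.
move=> i_n j_n ij wi /negPf wj; have := sum_swp id w i_n j_n (negbT (ltn_eqF ij)).
by rewrite wi wj -/(len _) -/(len w); lia.
Qed.

(** L is sorted before A, so the words without descents are L^m A^(n-m). *)
Definition desc w s : bool := ~~ lw w s && lw w s.+1.
Definition asc w s : bool := lw w s && ~~ lw w s.+1.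

Lemma desc_swp w s : 0 < s < n -> asc w s -> desc (swp s s.+1 w) s.
Proof.
move=> sn /andP[wl wr]; rewrite /desc !lw_swp; try lia.
by rewrite /tr !eqxx gtn_eqF // wl wr.
Qed.

Lemma asc_swp w s : 0 < s < n -> desc w s -> asc (swp s s.+1 w) s.
Proof.
move=> sn /andP[wl wr]; rewrite /asc !lw_swp; try lia.
by rewrite /tr !eqxx gtn_eqF // wl wr.
Qed.

(** The n - 2 inner letters contribute between 0 and n - 2. At the extreme weights this excludes
    some combinations of end letters. *)
Lemma weight_ends w : (2 <= n) ->
  (lw w 1 + lw w n <= weight w <= n - 2 + lw w 1 + lw w n).
Proof.
move=> n2; suff H p : (lw w 1 <= cnt w p.+2 <= p + lw w 1).
  have E : (n - 2).+2 = n by lia.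
  by have := H (n - 2); rewrite E /weight [cnt w n.+1]cntS; lia.
elim: p => [|p IHp]; first by rewrite cntS // cnt1 leqnn.
by rewrite cntS //; case: (lw w p.+2); lia.
Qed.

(** * Sorting the letters of an interval *)

Section Sorting.
Variables lo hi : nat.

Definition nodesc w : Prop := forall s, lo <= s < hi -> ~~ desc w s.
Definition same_outside w u : Prop :=
  forall p, 0 < p <= n -> ~~ (lo <= p <= hi) -> lw w p = lw u p.

Lemma nodesc_mono w p q : nodesc w -> lo <= p -> p <= q <= hi -> lw w q -> lw w p.
Proof.
move=> wS lop /andP[pq qhi]; elim: q pq qhi => [|q IHq] pq qhi wq.
  by move: pq; rewrite leqn0 => /eqP->.
move: pq; rewrite leq_eqVlt => /predU1P[->//|pq]; apply: IHq => //; first lia.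
by have := wS q; rewrite /desc wq andbT negbK; apply; lia.
Qed.

Hypotheses (lo_gt0 : 0 < lo) (hi_n : hi <= n).

(** If [w] has an L in position p and [u] an A, then all L's of [u] in the interval precede p, where
    [w] has L's too; so [u] would have strictly fewer L's. *)
Lemma nodesc_le w u p : nodesc w -> nodesc u -> same_outside w u ->
  weight w = weight u -> 0 < p <= n -> lw w p -> lw u p.
Proof.
move=> wS uS wu E pn wp; apply: contraT => /negPf up.
have uw q : 0 < q <= n -> lw u q -> lw w q.
  move=> qn uq; have [lq|lq] := boolP (lo <= q <= hi); last by rewrite wu.
  have lp : lo <= p <= hi.
    by apply: contraT => lp; move: wp; rewrite wu ?up.
  have [qp|pq] := leqP q p; first by apply: (nodesc_mono wS _ _ wp); lia.
  by rewrite (nodesc_mono uS (p := p) _ _ uq) in up; lia.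
suff: weight u < weight w by rewrite E ltnn.
rewrite /weight /cnt (bigD1_seq p) ?iota_uniq ?mem_index_iota //=.
rewrite [ltnRHS](bigD1_seq p) ?iota_uniq ?mem_index_iota //= wp up add0n add1n ltnS.
rewrite big_nat_cond [leqRHS]big_nat_cond leq_sum // => q /andP[qn _].
by case uq: (lw u q) => //; rewrite uw //; lia.
Qed.

Lemma nodesc_uniq w u : nodesc w -> nodesc u -> same_outside w u ->
  weight w = weight u -> w = u.
Proof.
move=> wS uS wu E; apply: eq_word => p pn; apply/idP/idP; first exact: nodesc_le wu E pn.
by apply: nodesc_le => // q qn lq; rewrite wu.
Qed.

(** The last two clauses replace a reduced word: properties pass from [u] to [w] through ascents and
    from [w] to [u] through descents. *)
Lemma sort_word w : exists u, [/\ nodesc u, same_outside w u, weight u = weight w,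
  forall T : word -> Prop, (forall v s, lo <= s < hi -> asc v s -> T v ->
    T (swp s s.+1 v)) -> T u -> T w &
  forall T : word -> Prop, (forall v s, lo <= s < hi -> desc v s -> T v ->
    T (swp s s.+1 v)) -> T w -> T u].
Proof.
have [k] := ubnP (len w); elim: k => // k IHk in w *; rewrite ltnS => wk.
have [/asboolP wS|] := boolP `[< nodesc w >]; first by exists w.
move=> /asboolPn/existsNP[s] /not_implyP[sP] /negP; rewrite negbK => ds.
have sn : 0 < s < n by lia.
have sw : len (swp s s.+1 w) < k.
  by case/andP: (ds) => wl wr; have := @len_swp s s.+1 w; lia.
have [u [uS uw uwt uup udown]] := IHk _ sw; exists u; split=> //.
- move=> p pn lp; rewrite -uw // lw_swp; try lia.
  by congr (lw w _); rewrite /tr; do !case: eqP; lia.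
- by rewrite uwt weight_swp //; lia.
- move=> T Tup Tu; rewrite -(@swpK s s.+1 _ _ w); try lia.
  by apply: Tup (uup _ Tup Tu) => //; apply: asc_swp.
- by move=> T Td Tw; apply: udown (Td) _; apply: Td.
Qed.

End Sorting.
End Words.

(** * Local rules on words *)

(* The residue of a position r modulo e: 0, 1, -1, or any other. *)
Variant class := C0 | C1 | Cm1 | Cgen.
Definition class_nat (c : class) : nat := match c with C0 => 0 | C1 => 1 | Cm1 => 2 | Cgen => 3 end.
Lemma class_natK : cancel class_nat
  (fun k => match k with 0 => C0 | 1 => C1 | 2 => Cm1 | _ => Cgen end).
Proof. by case. Qed.
HB.instance Definition _ := Equality.copy class (can_type class_natK).

Definition classes : seq class := [:: C0; C1; Cm1; Cgen].
Lemma mem_classes c : c \in classes. Proof. by case: c. Qed.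

(* A local rule reads the letters of a window; (sg, i, j) stands for exchanging its
   letters i and j, with a minus sign if sg, and None for the value 0. *)
Definition rule : Type := bitseq -> option (bool * nat * nat).

(* The window starts at r, except for C1 where it starts at r - 1. *)
Definition psi_rule (c : class) : rule := fun s =>
  match c, s with
  | C0, [:: x; y] => if x && ~~ y then Some (false, 0, 1) else None
  | Cgen, [:: x; y] => if x != y then Some (false, 0, 1) else None
  | C1, [:: l; x; y] => if x && ~~ y then Some (false, 1, 2)
                       else if ~~ l && y then Some (~~ x, 0, 2) else None
  | Cm1, [:: x; y; z] => if x && ~~ y then Some (false, 0, 1)
                       else if ~~ x && z then Some (~~ y, 0, 2) else None
  | _, _ => None
  end.

(** Let e divide r and write A L in positions r, r + 1 as psi_r of L A, which y_r and y_(r+1) kill.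
    Moving them past psi_r leaves only the correction term for equal residues, with sign minus for
    y_r and plus for y_(r+1). *)
Definition y_rule (c : class) : rule := fun s =>
  match c, s with
  | C0, [:: x; y] => if ~~ x && y then Some (true, 0, 1) else None
  | C1, [:: x; y] => if ~~ x && y then Some (false, 0, 1) else None
  | _, _ => None
  end.

(** Offset from r - 1: only in class C1 is the letter to the left of position r read. *)
Definition psi_shift (c : class) : nat := if c is C1 then 0 else 1.
Definition psi_width (c : class) : nat := if c is (C1 | Cm1) then 3 else 2.

Section Monomial.
Variable n : nat.
Local Notation word := (word n).
Implicit Types (w u : word) (x : option (bool * word)).

Definition win b N w : bitseq := [seq lw w p | p <- iota b N].

Lemma size_win b N w : size (win b N w) = N.
Proof. by rewrite size_map size_iota. Qed.

Lemma nth_win b N w k : k < N -> nth false (win b N w) k = lw w (b + k).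
Proof. by move=> kN; rewrite (nth_map 0) ?size_iota // nth_iota. Qed.

Lemma eq_win b N w u : (forall k, k < N -> lw w (b + k) = lw u (b + k)) ->
  win b N w = win b N u.
Proof.
move=> E; apply/eq_in_map => p; rewrite mem_iota => /andP[bp pb].
by rewrite -(subnKC bp) E; lia.
Qed.

Record locop := LocOp { base : nat; width : nat; act_rule : rule }.

Definition act (o : locop) w : option (bool * word) :=
  if act_rule o (win (base o) (width o) w) is Some (sg, i, j)
  then Some (sg, swp (base o + i) (base o + j) w) else None.

Definition kact (o : locop) x : option (bool * word) :=
  if x is Some (sg, w) then
    if act o w is Some (sg', u) then Some (sg (+) sg', u) else None
  else None.

(** A window may reach position 0 or go beyond n. The letters actually exchanged still lie in
    positions 1 to n, because the sentinels are never an A on the left or an L on the right. *)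
Definition in_range (o : locop) : Prop := forall w sg i j,
  act_rule o (win (base o) (width o) w) = Some (sg, i, j) ->
  [/\ i < j, j < width o, 0 < base o + i & base o + j <= n].

Lemma kact_commute o1 o2 w : in_range o1 -> in_range o2 ->
  base o1 + width o1 <= base o2 -> kact o1 (act o2 w) = kact o2 (act o1 w).
Proof.
move=> ok1 ok2 lt12; rewrite /kact /act.
case E2: (act_rule o2 (win (base o2) (width o2) w)) => [[[s2 i2] j2]|];
  case E1: (act_rule o1 (win (base o1) (width o1) w)) => [[[s1 i1] j1]|] //.
- have [? ? ? ?] := ok1 _ _ _ _ E1; have [? ? ? ?] := ok2 _ _ _ _ E2 => /=.
  rewrite (@eq_win (base o1) (width o1) (swp _ _ w) w) ?E1 => [|k kN]; last first.
    by rewrite lw_swp; try lia; rewrite /tr !ltn_eqF; lia.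
  rewrite (@eq_win (base o2) (width o2) (swp _ _ w) w) ?E2 => [|k kN]; last first.
    by rewrite lw_swp; try lia; rewrite /tr !gtn_eqF; lia.
  rewrite addbC; congr (Some (_, _)); apply: eq_word => p pn.
  rewrite !lw_swp; try lia; congr (lw w _); rewrite /tr.
  by do !case: eqP; lia.
- have [? ? ? ?] := ok2 _ _ _ _ E2 => /=.
  rewrite (@eq_win (base o1) (width o1) (swp _ _ w) w) ?E1 // => k kN.
  by rewrite lw_swp; try lia; rewrite /tr !ltn_eqF; lia.
- have [? ? ? ?] := ok1 _ _ _ _ E1 => /=.
  rewrite (@eq_win (base o2) (width o2) (swp _ _ w) w) ?E2 // => k kN.
  by rewrite lw_swp; try lia; rewrite /tr !gtn_eqF; lia.
Qed.

(* A signed word known only through its letters in the window [B, B + K), and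
   agreeing with w outside it; local relations reduce to computations on t. *)
Definition sem B K w (t : option (bool * bitseq)) x : Prop :=
  match t, x with
  | Some (sg, s), Some (sg', u) => [/\ sg' = sg, win B K u = s &
      forall p, ~~ (B <= p < B + K) -> lw u p = lw w p]
  | None, None => True
  | _, _ => False
  end.

Definition swl i j (s : bitseq) : bitseq :=
  mkseq (fun p => nth false s (tr i j p)) (size s).

(** The shadow of [kact] on a known window, [d] being the offset in it of the letters that the rule
    reads. *)
Definition wact (d N : nat) (f : rule) (t : option (bool * bitseq)) :=
  if t is Some (sg, s) then
    if f (take N (drop d s)) is Some (sg', i, j)
    then Some (sg (+) sg', swl (d + i) (d + j) s) else None
  else None.

Lemma sem_step B K w d o t x : in_range o -> base o = B + d -> d + width o <= K ->
  sem B K w t x -> sem B K w (wact d (width o) (act_rule o) t) (kact o x).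
Proof.
case: t x => [[sg s]|] [[sg' u]|] //= ok bo dK [-> uw E].
have Ew : take (width o) (drop d s) = win (base o) (width o) u.
  rewrite -uw -map_drop -map_take drop_iota take_iota bo; congr map.
  by congr iota; lia.
rewrite Ew /act; case Ea: (act_rule o _) => [[[s1 i] j]|] //=.
have [? ? ? ?] := ok _ _ _ _ Ea; split=> // [|p pB].
  apply: (@eq_from_nth _ false); rewrite size_win ?size_mkseq -?uw ?size_win // => k kK.
  rewrite nth_win // nth_mkseq ?size_win // lw_swp; try lia.
  rewrite nth_win; last by rewrite /tr; do !case: eqP; lia.
  by congr (lw u _); rewrite /tr; do !case: eqP; lia.
rewrite lw_swp -?E //; try lia; congr (lw u _).
by rewrite /tr; do !case: eqP; lia.
Qed.

Lemma sem_uniq B K w t x x' : sem B K w t x -> sem B K w t x' -> x = x'.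
Proof.
case: t x x' => [[sg s]|] [[sg1 u1]|] [[sg2 u2]|] //= [-> w1 E1] [-> w2 E2].
congr (Some (_, _)); apply: eq_word => p pn.
have [/andP[Bp pB]|pB] := boolP (B <= p < B + K); last by rewrite E1 // E2.
by rewrite -(subnKC Bp) -(@nth_win B K) -?(@nth_win B K u2) ?w1 ?w2 //; lia.
Qed.

Lemma sem_init B K w : sem B K w (Some (false, win B K w)) (Some (false, w)).
Proof. by []. Qed.

Variable e : nat.

(* The residues of a letter L and of a letter A competing for position r differ
   by r. *)
Definition cls (r : nat) : class :=
  if e %| r then C0 else if e %| r.-1 then C1 else if e %| r.+1 then Cm1 else Cgen.

Definition psi_op (r : nat) : locop :=
  LocOp (r.-1 + psi_shift (cls r)) (psi_width (cls r)) (psi_rule (cls r)).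
Definition y_op (r : nat) : locop :=
  LocOp (r.-1 + psi_shift (cls r)) 2 (y_rule (cls r)).

Lemma letter_gt0 w p : ~~ lw w p -> 0 < p. Proof. by case: p. Qed.
Lemma letter_le w p : lw w p -> p <= n.
Proof. by apply: contraTT; rewrite -ltnNge => /lw_out->. Qed.

Lemma psi_in_range r : 0 < r < n -> in_range (psi_op r).
Proof.
move=> rn w sg i j; rewrite /psi_op /=.
case: (cls r) => /=; do !case: ifP => //; rewrite /psi_shift /=.
- by move=> _ [_ <- <-]; split; lia.
- by move=> _ [_ <- <-]; split; lia.
- by move=> /andP[/letter_gt0 ? /letter_le ?] _ [_ <- <-]; split; lia.
- by move=> _ [_ <- <-]; split; lia.
- by move=> /andP[/letter_gt0 ? /letter_le ?] _ [_ <- <-]; split; lia.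
- by move=> _ [_ <- <-]; split; lia.
Qed.

Lemma y_in_range r : in_range (y_op r).
Proof.
move=> w sg i j; rewrite /y_op /=.
by case: (cls r) => //=; case: ifP => //; rewrite /psi_shift /=;
  move=> /andP[/letter_gt0 ? /letter_le ?] [_ <- <-]; split; lia.
Qed.

Definition wpsi c k := wact (k + psi_shift c) (psi_width c) (psi_rule c).
Definition wy c k := wact (k + psi_shift c) 2 (y_rule c).

Lemma sem_psi B K w k t x : 0 < B.+1 + k < n -> k + 4 <= K -> sem B K w t x ->
  sem B K w (wpsi (cls (B.+1 + k)) k t) (kact (psi_op (B.+1 + k)) x).
Proof.
move=> kn kK; apply: (sem_step (psi_in_range kn)) => /=; first lia.
by case: (cls _); rewrite /psi_width /psi_shift /=; lia.
Qed.

Lemma sem_y B K w k t x : k + 3 <= K -> sem B K w t x ->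
  sem B K w (wy (cls (B.+1 + k)) k t) (kact (y_op (B.+1 + k)) x).
Proof.
move=> kK; apply: (sem_step (@y_in_range _)) => /=; first lia.
by case: (cls _); rewrite /psi_shift /=; lia.
Qed.

Hypothesis e_ge3 : 3 <= e.

Lemma dvdn_near a k : e %| a -> 0 < k < 3 -> (e %| a + k) = false.
Proof. by move=> ea k3; rewrite dvdn_addr // gtnNdvd //; lia. Qed.

Lemma clsZ r : (cls r == C0) = (e %| r).
Proof. by rewrite /cls; case: ifP => //; case: ifP => //; case: ifP. Qed.

Lemma clsP r : 0 < r -> (cls r == C1) = (e %| r.-1).
Proof.
case: r => // r _; rewrite /cls /=.
have [er1|_] := boolP (e %| r.+1); last by case: (e %| r) => //; case: (e %| _).
by apply/esym/negbTE/negP => er; have := @dvdn_near r 1 er; rewrite addn1 er1 => /(_ isT).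
Qed.

Lemma clsM r : 0 < r -> (cls r == Cm1) = (e %| r.+1).
Proof.
case: r => // r _; rewrite /cls /=.
have [er1|_] := boolP (e %| r.+1).
  by have /= := @dvdn_near r.+1 1 er1; rewrite addn1 => ->.
have [er|_] := boolP (e %| r); last by case: (e %| _).
by have /= := @dvdn_near r 2 er; rewrite addn2 => ->.
Qed.

(* The classes run cyclically through C0, C1, e - 3 times Cgen, Cm1. *)
Definition adm (c c' : class) : bool := ((c == C0) == (c' == C1)) && ((c == Cm1) == (c' == C0)).

Lemma adm_cls r : 0 < r -> adm (cls r) (cls r.+1).
Proof.
by move=> r_gt0; rewrite /adm !clsZ clsP // clsM //= !eqxx.
Qed.

End Monomial.

(** * Local relations on windows *)

Definition neg1 T (t : option (bool * T)) : option (bool * T) :=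
  if t is Some (sg, s) then Some (~~ sg, s) else None.

Definition one_if T (b : bool) (t : option (bool * T)) : option (bool * T) :=
  if b then t else None.

(* A sufficient condition for t1 = t2 + t3: in the relations below at least one
   of the three terms vanishes. *)
Definition is_sum (T : eqType) (t1 t2 t3 : option (bool * T)) : bool :=
  [|| (t3 == None) && (t1 == t2), (t2 == None) && (t1 == t3) |
      (t1 == None) && (t2 == neg1 t3)].

Fixpoint bits (k : nat) : seq bitseq :=
  if k is k'.+1 then [seq b :: s | b <- [:: true; false], s <- bits k'] else [:: [::]].

Lemma mem_bits s : s \in bits (size s).
Proof.
elim: s => //= b s IHs; rewrite !mem_cat.
by case: b; rewrite map_f ?orbT.
Qed.

(* Adjacency of the residues of the letters x, y in positions r, r+1, where r has
   class c: equality, i -> j and i <- j; then equality in positions r and r+2. *)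
Definition ceq (c : class) (x y : bool) := (c == C0) && (x != y).
Definition carr (c : class) (x y : bool) :=
  [|| ~~ x && ~~ y, [&& x, ~~ y & c == C1] | [&& ~~ x, y & c == Cm1]].
Definition carl (c : class) (x y : bool) :=
  [|| x && y, [&& x, ~~ y & c == Cm1] | [&& ~~ x, y & c == C1]].
Definition ceq2 (c c' : class) (x y z : bool) :=
  (x != z) && (if y == x then c == C0 else c' == C0).

(** The five letters are those in positions r to r + 4, which contain the windows of indices r + 1
    and r + 2 in every class. The conjuncts are the two mixed relations, the quadratic relation and
    the braid relation. *)
Definition loc_rel (c0 c1 c2 c3 : class) (s : bitseq) : bool :=
  let t := Some (false, s) in
  let x := nth false s 1 in let y := nth false s 2 in let z := nth false s 3 in
  let p0 := wpsi c0 0 in let p1 := wpsi c1 1 in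
  let y0 := wy c0 0 in let y1 := wy c1 1 in
  [&& is_sum (p0 (y1 t)) (y0 (p0 t)) (one_if (ceq c0 x y) t),
      is_sum (y1 (p0 t)) (p0 (y0 t)) (one_if (ceq c0 x y) t),
      (if ceq c0 x y then p0 (p0 t) == None
       else if carr c0 x y then is_sum (p0 (p0 t)) (y1 t) (neg1 (y0 t))
       else if carl c0 x y then is_sum (p0 (p0 t)) (y0 t) (neg1 (y1 t))
       else p0 (p0 t) == t) &
      is_sum (p0 (p1 (p0 t))) (p1 (p0 (p1 t)))
        (if ceq2 c0 c1 x y z && carr c0 x y then t
         else if ceq2 c0 c1 x y z && carl c0 x y then neg1 t else None)].

(** Operators whose indices differ by at least 4 have disjoint windows, so only differences up to 3
    are computed; seven letters contain the windows of indices r + 1 to r + 4. *)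
Definition loc_comm (c0 c1 c2 c3 : class) (s : bitseq) : bool :=
  let t := Some (false, s) in
  let p0 := wpsi c0 0 in let p1 := wpsi c1 1 in
  let p2 := wpsi c2 2 in let p3 := wpsi c3 3 in
  let y0 := wy c0 0 in let y1 := wy c1 1 in let y2 := wy c2 2 in let y3 := wy c3 3 in
  [&& p0 (p2 t) == p2 (p0 t), p0 (p3 t) == p3 (p0 t),
      p0 (y2 t) == y2 (p0 t), p0 (y3 t) == y3 (p0 t),
      p1 (y0 t) == y0 (p1 t), p2 (y0 t) == y0 (p2 t), p3 (y0 t) == y0 (p3 t),
      y0 (y1 t) == y1 (y0 t), y0 (y2 t) == y2 (y0 t) & y0 (y3 t) == y3 (y0 t)].

(** Four consecutive classes satisfy [adm] whatever e >= 3 is, so a single computation serves every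
    e. *)
Definition for_windows K (Q : class -> class -> class -> class -> bitseq -> bool) : bool :=
  all (fun c0 => all (fun c1 => adm c0 c1 ==> all (fun c2 => adm c1 c2 ==>
    all (fun c3 => adm c2 c3 ==> all (Q c0 c1 c2 c3) (bits K)) classes) classes)
    classes) classes.

Lemma for_windowsP K Q c0 c1 c2 c3 s : for_windows K Q ->
  adm c0 c1 -> adm c1 c2 -> adm c2 c3 -> size s = K -> Q c0 c1 c2 c3 s.
Proof.
move=> /allP/(_ _ (mem_classes c0))/allP/(_ _ (mem_classes c1))/implyP H a01 a12 a23 sK.
have /allP/(_ _ (mem_classes c2))/implyP/(_ a12) := H a01.
move=> /allP/(_ _ (mem_classes c3))/implyP/(_ a23)/allP; apply.
by rewrite -sK mem_bits.
Qed.

Lemma loc_rel_ok : for_windows 5 loc_rel. Proof. by vm_compute. Qed.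
Lemma loc_comm_ok : for_windows 7 loc_comm. Proof. by vm_compute. Qed.

Local Open Scope ring_scope.

(** * Residues *)

Section Residues.
Variables (e n : nat) (kappa : 'Z_e * 'Z_e).
Hypotheses (e_ge3 : (3 <= e)%N) (kappa21 : kappa.2 = kappa.1 - 1).
Implicit Types w u : word n.

Lemma natZ_eq0 k : ((k%:R : 'Z_e) == 0) = (e %| k)%N.
Proof. by rewrite -val_eqE /= val_Zp_nat //; lia. Qed.

Lemma eqZ (u v : 'Z_e) k : u - v = k%:R -> (u == v) = (e %| k)%N.
Proof. by move=> E; rewrite -natZ_eq0 -E subr_eq0. Qed.

Lemma eqZN (u v : 'Z_e) k : v - u = k%:R -> (u == v) = (e %| k)%N.
Proof. by rewrite eq_sym; apply: eqZ. Qed.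

(** In the standard tableau encoded by [w], an L extends the leg, whose residues decrease, and an A
    extends the arm, whose residues increase; [p.-1 - cnt w p] counts the earlier A's. *)
Definition resid w (p : nat) : 'Z_e :=
  if lw w p then kappa.2 - (cnt w p)%:R else kappa.1 + (p.-1 - cnt w p)%:R.

Definition wres w : mi e n := mi_of n (resid w).

Lemma ent_mi_of (f : nat -> 'Z_e) r : (0 < r <= n)%N -> ent (mi_of n f) r = f r.
Proof.
case: r => // r rn; rewrite /ent /mi_of /= (nth_map (Ordinal rn)) ?size_enum_ord //.
by congr (f _.+1); rewrite nth_enum_ord.
Qed.

Lemma eq_mi (i j : mi e n) : (forall r, (0 < r <= n)%N -> ent i r = ent j r) -> i = j.
Proof.
move=> ij; apply/val_inj/(@eq_from_nth _ 0); first by rewrite !size_tuple.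
move=> p; rewrite size_tuple => pn.
by have := ij p.+1 pn; rewrite /ent /= !(set_nth_default 0) ?size_tuple.
Qed.

Lemma residE w p : (0 < p)%N ->
  resid w p = kappa.1 - 1 - (cnt w p)%:R + (if lw w p then 0 else p%:R).
Proof.
case: p => // p _; rewrite /resid kappa21 /=; case: (lw _ _); first by ring.
by rewrite natrB ?cnt_le //; ring.
Qed.

Let not1 : (e %| 1)%N = false. Proof. by rewrite gtnNdvd //; lia. Qed.
Let not2 : (e %| 2)%N = false. Proof. by rewrite gtnNdvd //; lia. Qed.

Lemma resid_eq w r : (0 < r)%N ->
  (resid w r == resid w r.+1) = ceq (cls e r) (lw w r) (lw w r.+1).
Proof.
move=> r0; rewrite /ceq clsZ !residE // cntS //.
case: (lw w r); case: (lw w r.+1); rewrite /= ?andbF ?andbT.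
- by rewrite (@eqZ _ _ 1) //; ring.
- by rewrite (@eqZN _ _ r) //; ring.
- by rewrite (@eqZ _ _ r) //; ring.
- by rewrite (@eqZN _ _ 1) //; ring.
Qed.

Lemma resid_arr w r : (0 < r)%N ->
  arr (resid w r) (resid w r.+1) = carr (cls e r) (lw w r) (lw w r.+1).
Proof.
move=> r0; rewrite /arr /carr clsP // clsM // !residE // cntS //.
case: (lw w r); case: (lw w r.+1); rewrite /= ?orbF ?andbF ?andbT.
- by rewrite (@eqZN _ _ 2) //; ring.
- by case: r r0 => // r _; rewrite (@eqZ _ _ r) //; ring.
- by rewrite (@eqZN _ _ r.+1) //; ring.
- by rewrite (@eqZ _ _ 0) ?dvdn0 //; ring.
Qed.

Lemma resid_arl w r : (0 < r)%N ->
  arr (resid w r.+1) (resid w r) = carl (cls e r) (lw w r) (lw w r.+1).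
Proof.
move=> r0; rewrite /arr /carl clsP // clsM // !residE // cntS //.
case: (lw w r); case: (lw w r.+1); rewrite /= ?orbF ?andbF ?andbT.
- by rewrite (@eqZ _ _ 0) ?dvdn0 //; ring.
- by rewrite (@eqZN _ _ r.+1) //; ring.
- by case: r r0 => // r _; rewrite (@eqZ _ _ r) //; ring.
- by rewrite (@eqZN _ _ 2) //; ring.
Qed.

Lemma resid_eq2 w r : (0 < r)%N -> (resid w r.+2 == resid w r) =
  ceq2 (cls e r) (cls e r.+1) (lw w r) (lw w r.+1) (lw w r.+2).
Proof.
move=> r0; rewrite /ceq2 !clsZ !residE // !cntS //.
case: (lw w r); case: (lw w r.+1); case: (lw w r.+2); rewrite /= ?andbF ?andbT.
- by rewrite (@eqZN _ _ 2) //; ring.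
- by rewrite (@eqZ _ _ r) //; ring.
- by rewrite (@eqZN _ _ 1) //; ring.
- by rewrite (@eqZ _ _ r.+1) //; ring.
- by rewrite (@eqZN _ _ r.+1) //; ring.
- by rewrite (@eqZ _ _ 1) //; ring.
- by rewrite (@eqZN _ _ r) //; ring.
- by rewrite (@eqZ _ _ 2) //; ring.
Qed.

Lemma cnt_full w p : (p <= n.+1)%N ->
  cnt w p = (\sum_(1 <= q < n.+1) (q < p) * lw w q)%N.
Proof.
move=> pn; rewrite /cnt (big_nat_widen 1 _ n.+1) //= big_mkcond /=.
by apply: eq_bigr => q _; case: ltnP; rewrite ?mul1n ?mul0n.
Qed.

Lemma cnt_swp i j w p : (0 < i)%N -> (i < j <= n)%N -> (p <= n.+1)%N ->
  (cnt (swp i j w) p + ((i < p) * lw w i + (j < p) * lw w j) =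
   cnt w p + ((i < p) * lw w j + (j < p) * lw w i))%N.
Proof.
move=> i0 ijn pn; have := @sum_swp n (fun q => q < p)%N i j w.
by rewrite -!cnt_full //; apply; lia.
Qed.

(** Each letter carries its residue along: the exchange changes neither the number of L's before the
    moved L nor the number of A's before the moved A. *)
Lemma resid_swp_adj s w p : (0 < s < n)%N -> lw w s != lw w s.+1 -> (0 < p <= n)%N ->
  resid (swp s s.+1 w) p = resid w (tr s s.+1 p).
Proof.
move=> sn ds pn; have C q := @cnt_swp s s.+1 w q ltac:(lia) ltac:(lia).
have {}C q : (q <= n.+1)%N -> q != s.+1 -> cnt (swp s s.+1 w) q = cnt w q.
  by move=> qn /eqP qs; have := C q qn; lia.
have p0 : (0 < p)%N by lia.
have t0 : (0 < tr s s.+1 p)%N by rewrite /tr; do !case: eqP; lia.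
rewrite !residE //.
rewrite lw_swp; try lia; rewrite /tr; case: eqP => [->|ps].
  rewrite C ?cntS; try lia.
  by move: ds; case: (lw w s); case: (lw w s.+1) => //= _; ring.
case: eqP => [->|ps1]; last by rewrite C //; lia.
rewrite cntS; last lia.
rewrite C ?lw_swp; try lia; rewrite /tr eqxx.
by move: ds; case: (lw w s); case: (lw w s.+1) => //= _; ring.
Qed.

(** An exchange at distance two acts on the residues as an adjacent transposition: the residue in
    position b stays the same if e divides b, that in position b + 2 if e divides b + 1, and the
    other two trade places. *)
Lemma resid_swp2 b w p : (0 < b)%N -> (b.+2 <= n)%N -> ~~ lw w b -> lw w b.+2 ->
  (0 < p <= n)%N ->
  ((e %| b)%N -> resid (swp b b.+2 w) p = resid w (tr b.+1 b.+2 p)) /\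
  ((e %| b.+1)%N -> resid (swp b b.+2 w) p = resid w (tr b b.+1 p)).
Proof.
move=> b0 bn /negPf wb wb2 pn; have C q := @cnt_swp b b.+2 w q ltac:(lia) ltac:(lia).
have C1 q : (q <= n.+1)%N -> q != b.+1 -> q != b.+2 -> cnt (swp b b.+2 w) q = cnt w q.
  by move=> qn /eqP q1 /eqP q2; have := C q qn; lia.
have u1 : lw (swp b b.+2 w) b.+1 = lw w b.+1.
  by rewrite lw_swp /tr; do ?case: eqP; lia.
have u0 : lw (swp b b.+2 w) b = true by rewrite lw_swp /tr ?eqxx //; lia.
have u2 : lw (swp b b.+2 w) b.+2 = false.
  by rewrite lw_swp /tr ?eqxx; try lia; case: eqP; lia.
have E0 : resid (swp b b.+2 w) b = kappa.1 - 1 - (cnt w b)%:R.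
  by rewrite residE // u0 C1 ?addr0 //; lia.
have E1 : resid (swp b b.+2 w) b.+1 =
    kappa.1 - 1 - (cnt w b).+1%:R + (if lw w b.+1 then 0 else b.+1%:R).
  by rewrite residE // u1 cntS // C1 ?u0 ?addn1 //; lia.
have E2 : resid (swp b b.+2 w) b.+2 =
    kappa.1 - 1 - ((cnt w b).+1 + lw w b.+1)%:R + b.+2%:R.
  by rewrite residE // u2 !cntS // C1 ?u0 ?u1 ?addn1 //; lia.
have W0 : resid w b = kappa.1 - 1 - (cnt w b)%:R + b%:R by rewrite residE // wb.
have W1 : resid w b.+1 = kappa.1 - 1 - (cnt w b)%:R + (if lw w b.+1 then 0 else b.+1%:R).
  by rewrite residE // cntS // wb addn0.
have W2 : resid w b.+2 = kappa.1 - 1 - (cnt w b + lw w b.+1)%:R.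
  by rewrite residE // !cntS // wb wb2 addn0 addr0.
have out : p != b -> p != b.+1 -> p != b.+2 -> resid (swp b b.+2 w) p = resid w p.
  move=> p0 p1 p2; rewrite !residE ?C1 //; try lia.
  by rewrite lw_swp /tr ?(negPf p0) ?(negPf p2) //; lia.
split; rewrite -natZ_eq0 => /eqP eb; rewrite /tr.
- have [->|pb1] := eqVneq p b.+1.
    by rewrite E1 W2; case: (lw w b.+1) => /=; rewrite ?addn1 ?addn0 -?natr1 ?eb; ring.
  have [->|pb2] := eqVneq p b.+2.
    by rewrite E2 W1; case: (lw w b.+1) => /=; rewrite ?addn1 ?addn0 -?natr1 ?eb; ring.
  by have [->|pb] := eqVneq p b; [rewrite E0 W0 eb addr0|rewrite out].
- have {}eb : b%:R = -1 :> 'Z_e by apply/eqP; rewrite -subr_eq0 opprK natr1 eb.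
  have [->|pb] := eqVneq p b.
    by rewrite E0 W1; case: (lw w b.+1) => /=; rewrite ?addn1 ?addn0 -?natr1 ?eb; ring.
  have [->|pb1] := eqVneq p b.+1.
    by rewrite E1 W0; case: (lw w b.+1) => /=; rewrite ?addn1 ?addn0 -?natr1 ?eb; ring.
  have [->|pb2] := eqVneq p b.+2; last by rewrite out.
  by rewrite E2 W2; case: (lw w b.+1) => /=; rewrite ?addn1 ?addn0 -?natr1 ?eb; ring.
Qed.

Lemma act_psi_res r w sg u : (0 < r < n)%N -> act (psi_op e r) w = Some (sg, u) ->
  wres u = swap r (wres w).
Proof.
move=> rn; rewrite /act /psi_op /= => E.
suff H p : (0 < p <= n)%N -> resid u p = resid w (tr r r.+1 p).
  apply: eq_mi => p pn; rewrite /swap [RHS]ent_mi_of // [LHS]ent_mi_of // H //.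
  by rewrite /tr ent_mi_of //; do !case: eqP; lia.
case: r => // r in rn E * => pn.
have adj : lw w r.+1 && ~~ lw w r.+2 ->
    resid (swp r.+1 r.+2 w) p = resid w (tr r.+1 r.+2 p).
  by move=> /andP[wr /negPf wr1]; apply: resid_swp_adj; rewrite ?wr ?wr1.
move: E; case cr: (cls e r.+1) => /=; rewrite ?addn0 ?addn1.
- by case: ifP => // /adj H [_ <-]; rewrite addn0 addn1.
- case: ifP => [/adj H [_ <-]|_]; first by rewrite addn1 addn2.
  case: ifP => // /andP[wl wr] [_ <-]; rewrite addn0 addn2.
  have {}cr : (e %| r)%N by rewrite -[r]/(r.+1.-1) -clsP ?cr.
  by have [->] := resid_swp2 (letter_gt0 wl) (letter_le wr) wl wr pn.
- case: ifP => [/adj H [_ <-]|_]; first by rewrite addn0 addn1.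
  case: ifP => // /andP[wl wr] [_ <-]; rewrite addn0 addn2.
  have {}cr : (e %| r.+2)%N by rewrite -clsM ?cr.
  by have [_ ->] := resid_swp2 (letter_gt0 wl) (letter_le wr) wl wr pn.
- by case: ifP => // wr [_ <-]; rewrite addn0 addn1; apply: resid_swp_adj.
Qed.

(** A [y] only exchanges different letters in positions b, b + 1 with e dividing b, and there the
    two residues are equal. *)
Lemma act_y_res r w sg u : (0 < r <= n)%N -> act (y_op e r) w = Some (sg, u) ->
  wres u = wres w.
Proof.
case: r => // r rn; rewrite /act /y_op /= => E.
have main b : (e %| b)%N -> ~~ lw w b && lw w b.+1 -> wres (swp b b.+1 w) = wres w.
  move=> eb /andP[wl wr]; have b0 := letter_gt0 wl; have bn := letter_le wr.
  apply: eq_mi => p pn; rewrite !ent_mi_of //.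
  have Eb : resid w b = resid w b.+1.
    by apply/eqP; rewrite resid_eq // /ceq clsZ eb wr (negPf wl).
  rewrite resid_swp_adj ?b0 //; first by rewrite /tr; do !case: eqP => [->|_] //.
  by rewrite wr (negPf wl).
move: E; case cr: (cls e r.+1) => //=; rewrite ?addn0 ?addn1.
  by case: ifP => // ds [_ <-]; rewrite addn0 addn1; apply: main; rewrite // -clsZ cr.
case: ifP => // ds [_ <-]; rewrite addn0 addn1; apply: main => //.
by rewrite -[r]/(r.+1.-1) -clsP ?cr.
Qed.

End Residues.

Lemma swapK e n r (i : mi e n) : (0 < r < n)%N -> swap r (swap r i) = i.
Proof.
move=> rn; apply: eq_mi => p pn; rewrite /swap ent_mi_of //.
by rewrite ent_mi_of; do !case: eqP => //; move=> *; subst; try lia.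
Qed.

(** * Modules over a presented algebra *)

Section Representations.
Variables (F : fieldType) (G : Type) (rel : term F G -> term F G -> Prop).

Fixpoint ev (V : lmodType F) (rho : G -> V -> V) (t : term F G) (x : V) : V :=
  match t with
  | TGen g => rho g x
  | TZero => 0
  | TOne => x
  | TOpp a => - ev rho a x
  | TAdd a b => ev rho a x + ev rho b x
  | TMul a b => ev rho a (ev rho b x)
  | TScale c a => c *: ev rho a x
  end.

Lemma ev_linear (V : lmodType F) (rho : G -> V -> V) :
  (forall g, linear (rho g)) -> forall t, linear (ev rho t).
Proof.
move=> rhoL; elim=> [g|||a IHa|a IHa b IHb|a IHa b IHb|d a IHa] c x y //=.
- exact: rhoL.
- by rewrite scaler0 addr0.
- by rewrite IHa opprD scalerN.
- by rewrite IHa IHb scalerDr addrACA.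
- by rewrite IHb IHa.
- by rewrite IHa scalerDr !scalerA mulrC.
Qed.

Structure rep (V : lmodType F) := Rep {
  rep_act :> G -> V -> V;
  rep_linear : forall g, linear (rep_act g);
  rep_sound : forall a b, rel a b -> ev rep_act a =1 ev rep_act b }.

Section RepModule.
Variables (V : lmodType F) (rho : rep V).

Lemma ev_cong a b : cong rel a b -> ev rho a =1 ev rho b.
Proof.
have L t c x y : ev rho t (c *: x + y) = c *: ev rho t x + ev rho t y.
  exact: ev_linear (@rep_linear V rho) t c x y.
have L0 t : ev rho t 0 = 0 by have := L t (-1) 0 0; rewrite !scaleN1r !addNr.
have LD t x y : ev rho t (x + y) = ev rho t x + ev rho t y.
  by have := L t 1 x y; rewrite !scale1r.
have LZ t c x : ev rho t (c *: x) = c *: ev rho t x.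
  by have := L t c x 0; rewrite L0 !addr0.
elim=> {a b} //=; try by move=> *.
- by move=> a b c _ IH1 _ IH2 x; rewrite IH1.
- by move=> a a' _ IH x; rewrite IH.
- by move=> a a' b b' _ IH1 _ IH2 x; rewrite IH1 IH2.
- by move=> a a' b b' _ IH1 _ IH2 x; rewrite IH1 IH2.
- by move=> c a a' _ IH x; rewrite IH.
- by move=> a b c x; rewrite addrA.
- by move=> a b x; rewrite addrC.
- by move=> a x; rewrite add0r.
- by move=> a x; rewrite addNr.
- by move=> c d a x; rewrite scalerA.
- by move=> a x; rewrite scale1r.
- by move=> c a b x; rewrite scalerDr.
- by move=> a c d x; rewrite scalerDl.
- exact: rep_sound.
Qed.

(** A copy of [V] tagged by the representation, so that the module structure over the algebra is
    kept apart from the one over F. *)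
Definition repmod (_ : rep V) : Type := V.
HB.instance Definition _ (r : rep V) := GRing.Zmodule.on (repmod r).

Let scale (h : presalg rel) (x : repmod rho) : repmod rho := ev rho (repr h) x.

Let scale_pi t x : scale (pi_presalg rel t) x = ev rho t x.
Proof. exact: ev_cong (cong_repr rel t) x. Qed.
Let scaleA g h x : scale g (scale h x) = scale (g * h) x.
Proof. by rewrite [RHS]scale_pi. Qed.
Let scale1 : left_id 1 scale.
Proof. by move=> x; rewrite scale_pi. Qed.
Let scaleDr : right_distributive scale +%R.
Proof.
move=> h x y; have := ev_linear (@rep_linear V rho) (repr h) 1 x y.
by rewrite !scale1r.
Qed.
Let scaleDl x : {morph scale^~ x : g h / g + h}.
Proof. by move=> g h /=; rewrite [LHS]scale_pi. Qed.

HB.instance Definition _ :=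
  GRing.Zmodule_isLmodule.Build (presalg rel) (repmod rho) scaleA scale1 scaleDr scaleDl.

Lemma repmodE t (x : repmod rho) : pi_presalg rel t *: x = ev rho t x :> V.
Proof. exact: scale_pi. Qed.

(** Recovers the F-action on [V] from the multiples of 1 in the algebra. *)
Lemma repmodZ (c : F) (x : repmod rho) : (c *: (1 : presalg rel)) *: x = (c *: (x : V)) :> V.
Proof.
have -> : c *: (1 : presalg rel) = pi_presalg rel (TScale c TOne).
  apply/pi_presalgP/cong_scale/cong_repr.
by rewrite repmodE.
Qed.

End RepModule.
End Representations.

(** * The span of all words and the operators on it *)

Section Fock.
Variables (F : fieldType) (e n : nat) (kappa : 'Z_e * 'Z_e).
Local Notation word := (word n).
Implicit Types (w u : word) (x : option (bool * word)).

Definition vec : Type := {ffun word -> F^o}.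
HB.instance Definition _ := GRing.Lmodule.on vec.
Implicit Types f g : vec.

Definition delta w : vec := [ffun u => (u == w)%:R : F^o].

Definition lext (h : word -> vec) f : vec := \sum_w f w *: h w.

Lemma lext_linear h : linear (lext h).
Proof.
move=> c f g; rewrite /lext scaler_sumr -big_split /=; apply: eq_bigr => w _.
by rewrite !ffunE scalerDl scalerA.
Qed.

Lemma lext_delta h w : lext h (delta w) = h w.
Proof.
rewrite /lext (bigD1 w) //= ffunE eqxx scale1r big1 ?addr0 // => u /negPf uw.
by rewrite ffunE uw scale0r.
Qed.

Lemma vec_sum f : f = \sum_w f w *: delta w.
Proof.
apply/ffunP => u; rewrite sum_ffunE (bigD1 u) //= big1 ?addr0 => [|w /negPf wu].
  by rewrite !ffunE eqxx /GRing.scale /= mulr1.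
by rewrite !ffunE eq_sym wu scaler0.
Qed.

Lemma linear_ext (h k : vec -> vec) : linear h -> linear k ->
  (forall w, h (delta w) = k (delta w)) -> h =1 k.
Proof.
move=> hL kL hk f.
pose h' := HB.pack_for {linear vec -> vec} h (GRing.isLinear.Build F vec vec _ h hL).
pose k' := HB.pack_for {linear vec -> vec} k (GRing.isLinear.Build F vec vec _ k kL).
rewrite -[h]/(h' : _ -> _) -[k]/(k' : _ -> _) (vec_sum f) !linear_sum.
by apply: eq_bigr => w _; rewrite !linearZ /= hk.
Qed.

Definition kden x : vec := if x is Some (sg, w) then (-1) ^+ sg *: delta w else 0.

Definition opM (o : locop) : vec -> vec := lext (fun w => kden (act o w)).
Definition eM (i : mi e n) : vec -> vec :=
  lext (fun w => if wres kappa w == i then delta w else 0).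

HB.instance Definition _ o :=
  GRing.isLinear.Build F vec vec *:%R (opM o) (lext_linear (fun w => kden (act o w))).
HB.instance Definition _ i := GRing.isLinear.Build F vec vec *:%R (eM i)
  (lext_linear (fun w => if wres kappa w == i then delta w else 0)).

Lemma opM_delta o w : opM o (delta w) = kden (act o w).
Proof. exact: lext_delta. Qed.

Lemma linZ (h : vec -> vec) c f : linear h -> h (c *: f) = c *: h f.
Proof.
move=> hL; have h0 : h 0 = 0 by have := hL (-1) 0 0; rewrite !scaleN1r !addNr.
by have := hL c f 0; rewrite h0 !addr0.
Qed.

Lemma lin0 (h : vec -> vec) : linear h -> h 0 = 0.
Proof. by move=> hL; have := hL (-1) 0 0; rewrite !scaleN1r !addNr. Qed.

Lemma opM_kden o x : opM o (kden x) = kden (kact o x).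
Proof.
case: x => [[sg w]|] /=; last by rewrite /opM (lin0 (lext_linear _)).
rewrite linZ; last exact: lext_linear.
rewrite opM_delta; case: (act o w) => [[sg' u]|] /=; last by rewrite scaler0.
by rewrite scalerA signr_addb.
Qed.

Lemma kden_neg x : kden (neg1 x) = - kden x.
Proof. by case: x => [[sg w]|] /=; rewrite ?oppr0 // signrN scaleNr. Qed.

Lemma sem_neg B K w t x : sem B K w t x -> sem B K w (neg1 t) (neg1 x).
Proof. by case: t x => [[sg s]|] [[sg' u]|] //= [-> ? ?]. Qed.

Lemma sem_sum B K w t1 t2 t3 x1 x2 x3 : sem B K w t1 x1 -> sem B K w t2 x2 ->
  sem B K w t3 x3 -> is_sum t1 t2 t3 -> kden x1 = kden x2 + kden x3.
Proof.
have none x : sem B K w None x -> x = None by case: x.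
move=> s1 s2 s3 /or3P[] /andP[/eqP E /eqP E'].
- rewrite E in s3; rewrite E' in s1.
  by rewrite (none _ s3) (sem_uniq s1 s2) addr0.
- rewrite E in s2; rewrite E' in s1.
  by rewrite (none _ s2) (sem_uniq s1 s3) add0r.
- rewrite E in s1; rewrite E' in s2.
  by rewrite (none _ s1) (sem_uniq s2 (sem_neg s3)) kden_neg addNr.
Qed.

Definition gen_act (g : gen e n) : vec -> vec :=
  match g with
  | GenE i => eM i
  | GenY r => opM (y_op e (sval r))
  | GenPsi r => opM (psi_op e (sval r))
  end.

Lemma gen_act_linear a : linear (gen_act a).
Proof. by case: a => ?; exact: lext_linear. Qed.

Local Notation EV := (ev gen_act).

Lemma EV_linear t : linear (EV t).
Proof. exact: ev_linear gen_act_linear t. Qed.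

Lemma EV_Y r f : (0 < r <= n)%N -> EV (tY F e n r) f = opM (y_op e r) f.
Proof. by move=> rn; rewrite /tY insubT /=. Qed.

Lemma EV_Psi r f : (0 < r <= n.-1)%N -> EV (tPsi F e n r) f = opM (psi_op e r) f.
Proof. by move=> rn; rewrite /tPsi insubT /=. Qed.

Lemma EV_ext t1 t2 : (forall w, EV t1 (delta w) = EV t2 (delta w)) -> EV t1 =1 EV t2.
Proof. by apply: linear_ext; exact: EV_linear. Qed.

Lemma EV_extE t1 t2 i :
  (forall w, wres kappa w = i -> EV t1 (delta w) = EV t2 (delta w)) ->
  EV (TMul t1 (tE F i)) =1 EV (TMul t2 (tE F i)).
Proof.
move=> H; apply: EV_ext => w /=; rewrite /eM lext_delta; case: eqP => [/H //|_].
by rewrite !(lin0 (EV_linear _)).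
Qed.

Hypotheses (e_ge3 : (3 <= e)%N) (kappa21 : kappa.2 = kappa.1 - 1) (n_gt0 : (0 < n)%N).

Lemma adm4 r : [&& adm (cls e r.+1) (cls e r.+2), adm (cls e r.+2) (cls e r.+3) &
  adm (cls e r.+3) (cls e r.+4)].
Proof. by rewrite !adm_cls. Qed.

Lemma loc_relP r w : loc_rel (cls e r.+1) (cls e r.+2) (cls e r.+3) (cls e r.+4)
  (win r 5 w).
Proof. by have /and3P[a b c] := adm4 r; apply: for_windowsP loc_rel_ok _ _ _ _. Qed.

Lemma loc_commP r w : loc_comm (cls e r.+1) (cls e r.+2) (cls e r.+3) (cls e r.+4)
  (win r 7 w).
Proof. by have /and3P[a b c] := adm4 r; apply: for_windowsP loc_comm_ok _ _ _ _. Qed.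

Local Notation Ps r := (opM (psi_op e r)).
Local Notation Yo r := (opM (y_op e r)).

Lemma delta_kden w : delta w = kden (Some (false, w)).
Proof. by rewrite /= scale1r. Qed.

Section Local.
Variables (r : nat) (w : word).
Hypothesis rn : (r.+1 < n)%N.
Let x0 := Some (false, w).
Let t0 K := Some (false, win r K w).

Let p0 K t x : (4 <= K)%N -> sem r K w t x ->
  sem r K w (wpsi (cls e r.+1) 0 t) (kact (psi_op e r.+1) x).
Proof. by have := @sem_psi n e r K w 0 t x; rewrite addn0 rn; apply. Qed.
Let y0 K t x : (3 <= K)%N -> sem r K w t x ->
  sem r K w (wy (cls e r.+1) 0 t) (kact (y_op e r.+1) x).
Proof. by have := @sem_y n e r K w 0 t x; rewrite addn0; apply. Qed.
Let y1 K t x : (4 <= K)%N -> sem r K w t x ->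
  sem r K w (wy (cls e r.+2) 1 t) (kact (y_op e r.+2) x).
Proof. by have := @sem_y n e r K w 1 t x; rewrite addn1; apply. Qed.
Let p1 K t x : (r.+2 < n)%N -> (5 <= K)%N -> sem r K w t x ->
  sem r K w (wpsi (cls e r.+2) 1 t) (kact (psi_op e r.+2) x).
Proof. by move=> rn1; have := @sem_psi n e r K w 1 t x; rewrite addn1 rn1; apply. Qed.

Let i0 K : sem r K w (t0 K) x0. Proof. exact: sem_init. Qed.

Let lt1 : nth false (win r 5 w) 1 = lw w r.+1. Proof. by []. Qed.
Let lt2 : nth false (win r 5 w) 2 = lw w r.+2. Proof. by []. Qed.
Let lt3 : nth false (win r 5 w) 3 = lw w r.+3. Proof. by []. Qed.

Lemma kden_if (b : bool) x : kden (if b then x else None) = (if b then kden x else 0).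
Proof. by case: b. Qed.

Lemma sem_if (b : bool) B K u t x : sem B K u t x -> sem B K u (one_if b t) (one_if b x).
Proof. by case: b. Qed.

(** The index is r + 1 so that the window starts at position r, which for r = 0 is the left
    sentinel; the boundary then needs no separate case. *)
Lemma rel_psiy : Ps r.+1 (Yo r.+2 (delta w)) = Yo r.+1 (Ps r.+1 (delta w)) +
  (if resid kappa w r.+1 == resid kappa w r.+2 then delta w else 0).
Proof.
have /and4P[H _ _ _] := loc_relP r w; rewrite resid_eq // delta_kden !opM_kden -kden_if.
by apply: sem_sum H; rewrite ?lt1 ?lt2; [apply/p0/y1/i0|apply/y0/p0/i0|apply/sem_if/i0].
Qed.

Lemma rel_ypsi : Yo r.+2 (Ps r.+1 (delta w)) = Ps r.+1 (Yo r.+1 (delta w)) +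
  (if resid kappa w r.+1 == resid kappa w r.+2 then delta w else 0).
Proof.
have /and4P[_ H _ _] := loc_relP r w; rewrite resid_eq // delta_kden !opM_kden -kden_if.
by apply: sem_sum H; rewrite ?lt1 ?lt2; [apply/y1/p0/i0|apply/p0/y0/i0|apply/sem_if/i0].
Qed.

Lemma rel_quad : Ps r.+1 (Ps r.+1 (delta w)) =
  if resid kappa w r.+1 == resid kappa w r.+2 then 0
  else if arr (resid kappa w r.+1) (resid kappa w r.+2)
    then Yo r.+2 (delta w) - Yo r.+1 (delta w)
  else if arr (resid kappa w r.+2) (resid kappa w r.+1)
    then Yo r.+1 (delta w) - Yo r.+2 (delta w)
  else delta w.
Proof.
have /and4P[_ _ H _] := loc_relP r w; move: H.
rewrite resid_eq // resid_arr // resid_arl // lt1 lt2 delta_kden !opM_kden -!kden_neg.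
have pp : sem r 5 w (wpsi (cls e r.+1) 0 (wpsi (cls e r.+1) 0 (t0 5)))
  (kact (psi_op e r.+1) (kact (psi_op e r.+1) x0)) by apply/p0/p0/i0.
case: ifP => [_ H|_]; first by move: pp; rewrite (eqP H) => /(@sem_uniq _ r 5 w None _ None) -> .
case: ifP => [_ H|_].
  by apply: (sem_sum pp _ _ H); [apply/y1/i0|apply/sem_neg/y0/i0].
case: ifP => [_ H|_ H]; first by
  apply: (sem_sum pp _ _ H); [apply/y0/i0|apply/sem_neg/y1/i0].
by move: pp; rewrite (eqP H) => /(sem_uniq (i0 5)) <-.
Qed.

Lemma rel_braid : (r.+2 < n)%N -> Ps r.+1 (Ps r.+2 (Ps r.+1 (delta w))) =
  Ps r.+2 (Ps r.+1 (Ps r.+2 (delta w))) +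
  if (resid kappa w r.+3 == resid kappa w r.+1) &&
     arr (resid kappa w r.+1) (resid kappa w r.+2) then delta w
  else if (resid kappa w r.+3 == resid kappa w r.+1) &&
     arr (resid kappa w r.+2) (resid kappa w r.+1) then - delta w
  else 0.
Proof.
move=> rn2; have /and4P[_ _ _ H] := loc_relP r w; move: H.
rewrite resid_eq2 // resid_arr // resid_arl // lt1 lt2 lt3 delta_kden !opM_kden -!kden_neg.
set b1 := _ && _; set b2 := _ && _ => H.
rewrite (_ : (if b1 then _ else _) = kden (if b1 then x0 else if b2 then neg1 x0 else None)).
  apply: sem_sum H; [by apply/p0 => //; apply/p1 => //; apply/p0 => //| |].
    by apply/p1 => //; apply/p0 => //; apply/p1 => //.
  by case: (b1); case: (b2).
by case: (b1); case: (b2).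
Qed.

End Local.

Section Commute.
Variables (r : nat) (w : word).
Let x0 := Some (false, w).
Let t0 := Some (false, win r 7 w).

Let p k t x : (r.+1 + k < n)%N -> (k < 4)%N -> sem r 7 w t x ->
  sem r 7 w (wpsi (cls e (r.+1 + k)) k t) (kact (psi_op e (r.+1 + k)) x).
Proof. by move=> rn k4; apply: sem_psi => //; lia. Qed.
Let y k t x : (k < 4)%N -> sem r 7 w t x ->
  sem r 7 w (wy (cls e (r.+1 + k)) k t) (kact (y_op e (r.+1 + k)) x).
Proof. by move=> k4; apply: sem_y => //; lia. Qed.

Let i0 : sem r 7 w t0 x0. Proof. exact: sem_init. Qed.

Let swap_by t1 t2 o1 o2 : sem r 7 w t1 (kact o1 (act o2 w)) ->
  sem r 7 w t2 (kact o2 (act o1 w)) -> t1 == t2 ->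
  opM o1 (opM o2 (delta w)) = opM o2 (opM o1 (delta w)).
Proof.
move=> s1 s2 /eqP E; rewrite -E in s2.
by rewrite !opM_delta !opM_kden (sem_uniq s1 s2).
Qed.

Let actE o : act o w = kact o x0.
Proof. by rewrite /=; case: (act o w) => [[]|]. Qed.

Let far_by o1 o2 : in_range n o1 -> in_range n o2 ->
  (base o1 + width o1 <= base o2)%N ->
  opM o1 (opM o2 (delta w)) = opM o2 (opM o1 (delta w)).
Proof. by move=> ? ? ?; rewrite !opM_delta !opM_kden kact_commute. Qed.

Lemma rel_psipsi s : (r.+3 <= s < n)%N ->
  Ps r.+1 (Ps s (delta w)) = Ps s (Ps r.+1 (delta w)).
Proof.
move=> /andP[rs sn]; have [far|near] := leqP r.+1.+4 s.
  apply: far_by; try (by apply: psi_in_range; lia).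
  rewrite /= /psi_width /psi_shift.
  by case: (cls e r.+1); case: (cls e s); lia.
have [k Es k23] : exists2 k, s = (r.+1 + k)%N & k \in [:: 2; 3]%N.
  by exists (s - r.+1)%N; rewrite ?inE; lia.
have P0 t x : sem r 7 w t x -> sem r 7 w (wpsi (cls e r.+1) 0 t) (kact (psi_op e r.+1) x).
  by have := @p 0 t x; rewrite addn0; apply; lia.
have Pk t x : sem r 7 w t x -> sem r 7 w (wpsi (cls e s) k t) (kact (psi_op e s) x).
  by have := @p k t x; rewrite -Es; apply; rewrite // ?Es; move: k23; rewrite !inE; lia.
apply: swap_by; rewrite ?actE; [by apply/P0/Pk/i0|by apply/Pk/P0/i0|].
have /and4P[H2 H3 _ _] := loc_commP r w.
by move: k23 Es; rewrite !inE => /orP[] /eqP-> ->; rewrite ?addn2 ?addn3.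
Qed.

Lemma rel_yy s : (r.+1 <= s)%N -> Yo r.+1 (Yo s (delta w)) = Yo s (Yo r.+1 (delta w)).
Proof.
rewrite leq_eqVlt => /predU1P[<-//|rs]; have [far|near] := leqP r.+1.+4 s.
  apply: far_by; try exact: y_in_range.
  rewrite /= /psi_width /psi_shift.
  by case: (cls e r.+1); case: (cls e s); lia.
have [k Es k23] : exists2 k, s = (r.+1 + k)%N & k \in [:: 1; 2; 3]%N.
  by exists (s - r.+1)%N; rewrite ?inE; lia.
have P0 t x : sem r 7 w t x -> sem r 7 w (wy (cls e r.+1) 0 t) (kact (y_op e r.+1) x).
  by have := @y 0 t x; rewrite addn0; apply; lia.
have Pk t x : sem r 7 w t x -> sem r 7 w (wy (cls e s) k t) (kact (y_op e s) x).
  by have := @y k t x; rewrite -Es; apply; rewrite // ?Es; move: k23; rewrite !inE; lia.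
apply: swap_by; rewrite ?actE; [by apply/P0/Pk/i0|by apply/Pk/P0/i0|].
move: (loc_commP r w) => /andP[_ /andP[_ /andP[_ /andP[_ /andP[_ /andP[_ /andP[_]]]]]]].
move=> /and3P[H1 H2 H3].
by move: k23 Es; rewrite !inE => /or3P[] /eqP-> ->; rewrite ?addn1 ?addn2 ?addn3.
Qed.

Lemma rel_psiy_gt s : (r.+1 < n)%N -> (r.+3 <= s)%N ->
  Ps r.+1 (Yo s (delta w)) = Yo s (Ps r.+1 (delta w)).
Proof.
move=> rn rs; have [far|near] := leqP r.+1.+4 s.
  apply: far_by; [exact: psi_in_range|exact: y_in_range|].
  rewrite /= /psi_width /psi_shift.
  by case: (cls e r.+1); case: (cls e s); lia.
have [k Es k23] : exists2 k, s = (r.+1 + k)%N & k \in [:: 2; 3]%N.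
  by exists (s - r.+1)%N; rewrite ?inE; lia.
have P0 t x : sem r 7 w t x -> sem r 7 w (wpsi (cls e r.+1) 0 t) (kact (psi_op e r.+1) x).
  by have := @p 0 t x; rewrite addn0; apply; lia.
have Pk t x : sem r 7 w t x -> sem r 7 w (wy (cls e s) k t) (kact (y_op e s) x).
  by have := @y k t x; rewrite -Es; apply; rewrite // ?Es; move: k23; rewrite !inE; lia.
apply: swap_by; rewrite ?actE; [by apply/P0/Pk/i0|by apply/Pk/P0/i0|].
have /and4P[_ _ H2 /andP[H3 _]] := loc_commP r w.
by move: k23 Es; rewrite !inE => /orP[] /eqP-> ->; rewrite ?addn2 ?addn3.
Qed.

Lemma rel_psiy_lt s : (r.+1 < s < n)%N ->
  Ps s (Yo r.+1 (delta w)) = Yo r.+1 (Ps s (delta w)).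
Proof.
move=> /andP[rs sn]; have [far|near] := leqP r.+1.+4 s.
  apply/esym/far_by; [exact: y_in_range|apply: psi_in_range; lia|].
  rewrite /= /psi_width /psi_shift.
  by case: (cls e r.+1); case: (cls e s); lia.
have [k Es k23] : exists2 k, s = (r.+1 + k)%N & k \in [:: 1; 2; 3]%N.
  by exists (s - r.+1)%N; rewrite ?inE; lia.
have P0 t x : sem r 7 w t x -> sem r 7 w (wy (cls e r.+1) 0 t) (kact (y_op e r.+1) x).
  by have := @y 0 t x; rewrite addn0; apply; lia.
have Pk t x : sem r 7 w t x -> sem r 7 w (wpsi (cls e s) k t) (kact (psi_op e s) x).
  by have := @p k t x; rewrite -Es; apply; rewrite // ?Es; move: k23; rewrite !inE; lia.
apply: swap_by; rewrite ?actE; [by apply/Pk/P0/i0|by apply/P0/Pk/i0|].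
have /and4P[_ _ _ /and5P[_ H1 H2 H3 _]] := loc_commP r w.
by move: k23 Es; rewrite !inE => /or3P[] /eqP-> ->; rewrite ?addn1 ?addn2 ?addn3.
Qed.

End Commute.
End Fock.

(** * The Fock module *)

Section FockModule.
Variables (F : fieldType) (e n : nat) (kappa : 'Z_e * 'Z_e).
Hypotheses (e_ge3 : (3 <= e)%N) (kappa21 : kappa.2 = kappa.1 - 1) (n_gt0 : (0 < n)%N).
Local Notation word := (word n).
Local Notation vec := (vec F n).
Implicit Types (w u : word) (f : vec).
Local Notation EV := (ev (@gen_act F e n kappa)).
Local Notation delta := (@delta F n).
Local Notation wres := (@wres e n kappa).

Lemma eM0 i : eM kappa i (0 : vec) = 0. Proof. exact: lin0 (lext_linear _). Qed.
Lemma opM0 o : opM o (0 : vec) = 0. Proof. exact: lin0 (lext_linear _). Qed.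
Lemma eM_delta i w : eM kappa i (delta w) = if wres w == i then delta w else 0.
Proof. exact: lext_delta. Qed.

Lemma eM_kden i o w j : (forall sg u, act o w = Some (sg, u) -> wres u = j) ->
  eM kappa i (kden F (act o w)) = if j == i then kden F (act o w) else 0.
Proof.
case: (act o w) => [[sg u]|] /= H; last by rewrite eM0 if_same.
rewrite linZ; last exact: lext_linear.
by rewrite eM_delta (H _ _ erefl); case: eqP => //; rewrite scaler0.
Qed.

Lemma ent_wres w r : (0 < r <= n)%N -> ent (wres w) r = resid kappa w r.
Proof. exact: ent_mi_of. Qed.

Lemma EV_tdelta (b : bool) f : EV (tdelta F e n b) f = if b then f else 0.
Proof. by case: b. Qed.

Lemma EV_if (b : bool) t1 t2 f : EV (if b then t1 else t2) f = if b then EV t1 f else EV t2 f.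
Proof. by case: b. Qed.

Lemma EV_sum f : EV (\big[@TAdd F (gen e n)/TZero]_(i : mi e n) tE F i) f =
  \sum_(i : mi e n) eM kappa i f.
Proof. exact: (big_morph (fun t => EV t f)). Qed.

Lemma klr_sound a b : klr_rel a b -> EV a =1 EV b.
Proof.
have EL t := @EV_linear F e n kappa t.
case=> {a b}.
- move=> i j; apply: EV_ext => w; rewrite EV_if /= !eM_delta.
  have [<-|/negPf wj] := eqVneq (wres w) j.
    by rewrite eM_delta eq_sym; case: eqP.
  by rewrite eM0; case: eqP => // ->; rewrite wj.
- apply: EV_ext => w; rewrite EV_sum (bigD1 (wres w)) //= big1 => [|i /negPf wi].
    by rewrite eM_delta eqxx addr0.
  by rewrite eM_delta eq_sym wi.
- move=> r i rn; apply: EV_ext => w /=; rewrite EV_Y // EV_Y // eM_delta opM_delta.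
  rewrite (@eM_kden i _ w (wres w)) => [|sg u]; last exact: act_y_res.
  by case: ifP => _; rewrite ?opM_delta ?opM0.
- move=> r i rn; have rn' : (0 < r < n)%N by lia.
  apply: EV_ext => w /=; rewrite EV_Psi // EV_Psi // eM_delta opM_delta.
  rewrite (@eM_kden _ _ w (swap r (wres w))) => [|sg u]; last exact: act_psi_res.
  rewrite (inj_eq (can_inj (fun j => swapK j rn'))).
  by case: ifP => _; rewrite ?opM_delta ?opM0.
- move=> r s rn sn; apply: EV_ext => w /=; rewrite !EV_Y //.
  case: r s rn sn => // r [//|s] rn sn.
  by case: (leqP r s) => rs; [apply: rel_yy|apply/esym/rel_yy; lia].
- move=> r s rn sn rs rs1; apply: EV_ext => w /=; rewrite !EV_Y // !EV_Psi //.
  case: r s rn sn rs rs1 => // r [//|s] rn sn rs rs1.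
  by case: (leqP r s) => lrs; [apply: rel_psiy_gt; lia|apply: rel_psiy_lt; lia].
- move=> r s rn sn rs; apply: EV_ext => w /=; rewrite !EV_Psi //.
  case: r s rn sn rs => // r [//|s] rn sn /orP[] rs; [|symmetry]; apply: rel_psipsi; lia.
- move=> r i rn; apply: EV_extE => w wi /=.
  rewrite EV_Psi // !EV_Y; try lia; rewrite EV_Psi // EV_tdelta -wi !ent_wres; try lia.
  by case: r rn wi => // r rn _; rewrite (rel_psiy F e_ge3 kappa21) //; lia.
- move=> r i rn; apply: EV_extE => w wi /=.
  rewrite EV_Psi // !EV_Y; try lia; rewrite EV_Psi // EV_tdelta -wi !ent_wres; try lia.
  by case: r rn wi => // r rn _; rewrite (rel_ypsi F e_ge3 kappa21) //; lia.
- move=> r i rn; apply: EV_ext => w; rewrite !EV_if /= !eM_delta.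
  case: eqP => [wi|_]; last by rewrite !(lin0 (EL _)) oppr0 addr0 !if_same.
  rewrite !EV_Psi // !EV_Y; try lia; rewrite -wi !ent_wres; try lia.
  by case: r rn wi => // r rn _; rewrite (rel_quad F e_ge3 kappa21) //; lia.
- move=> r i r0 rn; apply: EV_ext => w; rewrite !EV_if /= !eM_delta.
  case: eqP => [wi|_]; last by rewrite !(lin0 (EL _)) oppr0 !addr0 !if_same.
  rewrite !EV_Psi //; try lia; rewrite -wi !ent_wres; try lia.
  case: r r0 rn wi => // r _ rn _; rewrite (rel_braid F e_ge3 kappa21) //; try lia.
  by case: (_ && _) => //; case: (_ && _) => //; rewrite addr0.
Qed.

(** y_1 has class C1 and reads positions 0 and 1; the sentinel L in position 0 leaves no A L to
    exchange. *)
Lemma y1_act f : opM (y_op e 1) f = 0.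
Proof.
apply: (linear_ext (lext_linear _) (k := fun=> 0)) => [c x y|w].
  by rewrite scaler0 addr0.
rewrite lext_delta /act /y_op (_ : cls e 1 = C1) //=.
by apply/eqP; rewrite clsP ?dvdn0.
Qed.

Lemma cyc_sound a b : cyc_rel kappa a b -> EV a =1 EV b.
Proof.
case=> {a b} [a b|i]; first exact: klr_sound.
apply: EV_ext => w /=; rewrite eM_delta; case: eqP => [wi|_]; last first.
  exact: (lin0 (@EV_linear F e n kappa _)).
(* The first residue of a word is kappa_1 or kappa_2, so the exponent of y_1 is positive. *)
have : (0 < level kappa (ent i 1))%N.
  rewrite -wi ent_wres // /level /resid cnt1 subr0 addr0.
  by case: (lw w 1); rewrite eqxx ?addnS.
case: (level _ _) => //= k _; rewrite EV_Y //; exact: y1_act.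
Qed.

Definition Fock_rep : rep (cyc_rel kappa) vec :=
  Rep (@gen_act_linear F e n kappa) cyc_sound.

Definition Fock : lmodType (cycKLR F n kappa) := repmod Fock_rep.

Local Notation H := (cycKLR F n kappa).

Lemma FockE t (x : Fock) : (pi_presalg (cyc_rel kappa) t : H) *: x = EV t x :> vec.
Proof. exact: repmodE. Qed.

Lemma Fock_e i (x : Fock) : klr_e F kappa i *: x = eM kappa i x :> vec.
Proof. exact: FockE. Qed.

Lemma Fock_y r (x : Fock) : (0 < r <= n)%N -> klr_y F n kappa r *: x = opM (y_op e r) x :> vec.
Proof. by move=> rn; rewrite -(EV_Y kappa) //; exact: FockE. Qed.

Lemma Fock_psi r (x : Fock) : (0 < r < n)%N ->
  klr_psi F n kappa r *: x = opM (psi_op e r) x :> vec.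
Proof. by move=> rn; rewrite -(EV_Psi kappa); [exact: FockE|lia]. Qed.

Lemma FockZ c (x : Fock) : (c *: (1 : H)) *: x = c *: (x : vec) :> vec.
Proof. exact: repmodZ. Qed.

End FockModule.

(** * Relations and the action on words *)

Section PresentedOps.
Variables (F : fieldType) (G : Type) (rel : term F G -> term F G -> Prop).
Local Notation pi := (pi_presalg rel).

Lemma pi_mul a b : pi (TMul a b) = pi a * pi b.
Proof. by apply/pi_presalgP/cong_mul; apply/cong_sym/cong_repr. Qed.
Lemma pi_add a b : pi (TAdd a b) = pi a + pi b.
Proof. by apply/pi_presalgP/cong_add; apply/cong_sym/cong_repr. Qed.
Lemma pi_opp a : pi (TOpp a) = - pi a.
Proof. by apply/pi_presalgP/cong_opp; apply/cong_sym/cong_repr. Qed.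
Lemma pi_scale c a : pi (TScale c a) = c *: pi a.
Proof. by apply/pi_presalgP/cong_scale; apply/cong_sym/cong_repr. Qed.

Lemma presalg_ind (Q : presalg rel -> Prop) :
  (forall g, Q (pi (TGen g))) -> Q 0 -> Q 1 -> (forall a, Q a -> Q (- a)) ->
  (forall a b, Q a -> Q b -> Q (a + b)) -> (forall a b, Q a -> Q b -> Q (a * b)) ->
  (forall c a, Q a -> Q (c *: a)) -> forall h, Q h.
Proof.
move=> Qg Q0 Q1 QN QD QM QZ h; rewrite -[h]pi_presalgK.
elim: (repr h) => {h} //.
- by move=> a; rewrite pi_opp; apply: QN.
- by move=> a Qa b Qb; rewrite pi_add; apply: QD.
- by move=> a Qa b Qb; rewrite pi_mul; apply: QM.
- by move=> c a Qa; rewrite pi_scale; apply: QZ.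
Qed.

End PresentedOps.

Section Relations.
Variables (F : fieldType) (e n : nat) (kappa : 'Z_e * 'Z_e).
Local Notation H := (cycKLR F n kappa).
Local Notation psi := (klr_psi F n kappa).
Local Notation y := (klr_y F n kappa).
Local Notation ee := (klr_e F kappa).
Implicit Types i j : mi e n.

Lemma cyc_eq (a b : term F (gen e n)) :
  klr_rel a b -> pi_presalg (cyc_rel kappa) a = pi_presalg (cyc_rel kappa) b.
Proof. by move=> ab; apply/pi_presalgP/cong_rel/cyc_klr. Qed.

Lemma klr_eeE i j : ee i * ee j = if i == j then ee i else 0.
Proof. by have := cyc_eq (klr_ee F i j); rewrite pi_mul => ->; case: ifP. Qed.

Lemma klr_psieE r i : (0 < r < n)%N -> psi r * ee i = ee (swap r i) * psi r.
Proof.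
move=> rn; have rn' : (0 < r <= n.-1)%N by lia.
by have := cyc_eq (klr_psie F i rn'); rewrite !pi_mul.
Qed.

Lemma klr_psiyE r s : (0 < r < n)%N -> (0 < s <= n)%N -> s != r -> s != r.+1 ->
  psi r * y s = y s * psi r.
Proof.
move=> rn sn sr sr1; have rn' : (0 < r <= n.-1)%N by lia.
by have := cyc_eq (klr_psiy F e rn' sn sr sr1); rewrite !pi_mul.
Qed.

Lemma klr_psipsiE r s : (0 < r < n)%N -> (0 < s < n)%N -> (r.+1 < s)%N || (s.+1 < r)%N ->
  psi r * psi s = psi s * psi r.
Proof.
move=> rn sn rs; have rn' : (0 < r <= n.-1)%N by lia.
have sn' : (0 < s <= n.-1)%N by lia.
by have := cyc_eq (klr_psipsi F e rn' sn' rs); rewrite !pi_mul.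
Qed.

Lemma klr_psiySE r i : (0 < r < n)%N ->
  psi r * y r.+1 * ee i = (y r * psi r + (ent i r == ent i r.+1)%:R) * ee i.
Proof.
move=> rn; have rn' : (0 < r <= n.-1)%N by lia.
have := cyc_eq (klr_psiyS F i rn'); rewrite !pi_mul !pi_add !pi_mul => ->.
by case: eqP.
Qed.

Lemma klr_ySpsiE r i : (0 < r < n)%N ->
  y r.+1 * psi r * ee i = (psi r * y r + (ent i r == ent i r.+1)%:R) * ee i.
Proof.
move=> rn; have rn' : (0 < r <= n.-1)%N by lia.
have := cyc_eq (klr_ySpsi F i rn'); rewrite !pi_mul !pi_add !pi_mul => ->.
by case: eqP.
Qed.

Lemma klr_quadE r i : (0 < r < n)%N -> psi r * psi r * ee i =
  if ent i r == ent i r.+1 then 0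
  else if arr (ent i r) (ent i r.+1) then (y r.+1 - y r) * ee i
  else if arr (ent i r.+1) (ent i r) then (y r - y r.+1) * ee i
  else ee i.
Proof.
move=> rn; have rn' : (0 < r <= n.-1)%N by lia.
have := cyc_eq (klr_quad F i rn'); rewrite !pi_mul => ->.
case: ifP => _ //; case: ifP => _; first by rewrite pi_mul pi_add pi_opp.
by case: ifP => _ //; rewrite pi_mul pi_add pi_opp.
Qed.

Definition braid_const (r : nat) (i : mi e n) : H :=
  if (ent i r.+2 == ent i r) && arr (ent i r) (ent i r.+1) then 1
  else if (ent i r.+2 == ent i r) && arr (ent i r.+1) (ent i r) then - 1
  else 0.

Lemma klr_braidE r i : (0 < r)%N -> (r.+1 < n)%N -> psi r * psi r.+1 * psi r * ee i =
  (psi r.+1 * psi r * psi r.+1 + braid_const r i) * ee i.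
Proof.
move=> r0 rn; have rn' : (r.+1 <= n.-1)%N by lia.
have := cyc_eq (klr_braid F i r0 rn'); rewrite !pi_mul /braid_const => ->.
case: ifP => _; first by rewrite !(pi_mul, pi_add).
by case: ifP => _; rewrite !(pi_mul, pi_add, pi_opp) ?addr0.
Qed.

Lemma klr_braidE' r i : (0 < r)%N -> (r.+1 < n)%N -> psi r.+1 * psi r * psi r.+1 * ee i =
  (psi r * psi r.+1 * psi r - braid_const r i) * ee i.
Proof. by move=> r0 rn; rewrite mulrBl klr_braidE // mulrDl addrK. Qed.

End Relations.

(** * Exchanges made by a single generator *)

Section Action.
Variables (n e : nat).
Implicit Types w u : word n.

Lemma act_psi_asc w r : (0 < r)%N -> asc w r ->
  act (psi_op e r) w = Some (false, swp r r.+1 w).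
Proof.
case: r => // r _ /andP[wr wr1]; rewrite /act /psi_op /=.
by case: (cls e r.+1) => /=; rewrite ?addn0 ?addn1 wr ?wr1 /= ?(negPf wr1) /= ?addn0
  ?addn1 ?addn2.
Qed.

(** Off an ascent, psi_r exchanges an A with a later L and so lowers [len]. The bounds on i and j
    hold because a multiple of e lies next to, or at, the exchanged positions, or else because class
    Cgen excludes r = 1 and r = n - 1. *)
Lemma act_psi_nasc w r sg u : (0 < r)%N -> ~~ asc w r ->
  act (psi_op e r) w = Some (sg, u) -> exists i j,
  [/\ [/\ (0 < i < j)%N, (j <= n)%N, ~~ lw w i, lw w j & u = swp i j w],
     (3 <= e)%N -> (1 < i)%N & (3 <= e)%N -> (e %| n)%N -> (j < n)%N].
Proof.
case: r => // r _ ar; have E : lw w r.+1 && ~~ lw w r.+2 = false by exact: negPf ar.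
have main i j : (i < j)%N -> ~~ lw w i && lw w j ->
    ((3 <= e)%N -> i != 1%N) -> ((3 <= e)%N -> (e %| n)%N -> j != n) -> exists i' j',
    [/\ [/\ (0 < i' < j')%N, (j' <= n)%N, ~~ lw w i', lw w j' & swp i j w = swp i' j' w],
     (3 <= e)%N -> (1 < i')%N & (3 <= e)%N -> (e %| n)%N -> (j' < n)%N].
  move=> ij /andP[wi wj] i1 jn; exists i, j; rewrite (letter_gt0 wi) (letter_le wj).
  split=> [//|e3|e3 en]; first by have := i1 e3; have := letter_gt0 wi; lia.
  by have := jn e3 en; have := letter_le wj; lia.
have nd a k : (3 <= e)%N -> (e %| a)%N -> (0 < k < 3)%N -> (e %| a + k)%N = false.
  by move=> e3; apply: dvdn_near.
rewrite /act /psi_op /=; case cr: (cls e r.+1) => /=; rewrite ?addn0 ?addn1 ?E //.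
- have {}cr : (e %| r)%N by move: cr; rewrite /cls; do !case: ifP.
  case: ifP => // wij [_ <-]; rewrite addn0 addn2; apply: main => // [e3|e3 en].
    by apply/eqP => r1; move: cr; rewrite r1 gtnNdvd //; lia.
  by apply/eqP => rn; have := nd r 2%N e3 cr; rewrite addn2 rn en => /(_ isT).
- have {}cr : (e %| r.+2)%N by move: cr; rewrite /cls; do !case: ifP.
  case: ifP => // wij [_ <-]; rewrite addn0 addn2; apply: main => // [e3|e3 en].
    by apply/eqP => -[r1]; move: cr; rewrite r1 gtnNdvd //; lia.
  by apply/eqP => rn; have := nd r.+2 1%N e3 cr; rewrite addn1 rn en => /(_ isT).
- have [c1 c2] : (e %| r)%N = false /\ (e %| r.+2)%N = false.
    by move: cr; rewrite /cls /=; do !case: ifP.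
  case: ifP => // /eqP ws [_ <-]; rewrite addn0 addn1; apply: main => // [|e3|e3 en].
  + by move: ar ws; rewrite /asc; case: (lw w r.+1); case: (lw w r.+2).
  + by apply/eqP => -[r1]; rewrite r1 dvdn0 in c1.
  + by apply/eqP => rn; rewrite rn en in c2.
Qed.

Lemma act_psi w r sg u : (0 < r < n)%N -> act (psi_op e r) w = Some (sg, u) ->
  weight u = weight w /\ (len u <= len w + asc w r)%N /\ (~~ asc w r -> (len u < len w)%N).
Proof.
move=> rn; have [ar|ar] := boolP (asc w r).
  rewrite act_psi_asc //; last lia.
  move=> -[_ <-]; rewrite weight_swp; try lia.
  by case/andP: (ar) => w1 w2; rewrite len_swpU //; lia.
move=> /act_psi_nasc[||i [j [[i0 jn wi wj ->] _ _]]] //; first lia.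
rewrite weight_swp; try lia.
by have := @len_swp n i j w; lia.
Qed.

Lemma act_y w r sg u : (0 < r)%N -> act (y_op e r) w = Some (sg, u) -> exists q,
  [/\ (0 < q < n)%N, desc w q, u = swp q q.+1 w & (e %| q)%N && ((q == r) || (q.+1 == r))].
Proof.
case: r => // r _; rewrite /act /y_op /=.
case cr: (cls e r.+1) => //=; rewrite ?addn0 ?addn1; case: ifP => // ds [_ <-].
  exists r.+1; rewrite ?addn0 ?addn1 -clsZ cr !eqxx; split=> //.
  by case/andP: ds => _ /letter_le.
have er : (e %| r)%N by move: cr; rewrite /cls; do !case: ifP.
exists r; rewrite ?addn0 ?addn1 eqxx orbT andbT; split=> //.
by case/andP: ds => /letter_gt0-> /letter_le.
Qed.

Lemma act_y_len w r sg u : (0 < r)%N -> act (y_op e r) w = Some (sg, u) ->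
  weight u = weight w /\ (len u < len w)%N.
Proof.
move=> r0 /(act_y r0)[q [qn /andP[wl wr] -> _]]; rewrite weight_swp; try lia.
by split=> //; have := @len_swp n q q.+1 w; lia.
Qed.

(** The word L^m A^(n-m) of the generator z. *)
Definition zword m : word n := mkword n (fun p => (p <= m)%N).

Lemma lw_zword m p : (0 < p <= n)%N -> lw (zword m) p = (p <= m)%N.
Proof. exact: lw_mk. Qed.

Lemma cnt_zword m p : (0 < p <= n.+1)%N -> cnt (zword m) p = minn p.-1 m.
Proof.
case: p => // p; elim: p => [|p IHp] pn; first by rewrite cnt1 min0n.
by rewrite cntS // IHp ?lw_zword //=; lia.
Qed.

Lemma weight_zword m : (m <= n)%N -> weight (zword m) = m.
Proof. by move=> mn; rewrite /weight cnt_zword //=; lia. Qed.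

Lemma nodesc_zword m : nodesc 1 n (zword m).
Proof. by move=> s sn; rewrite /desc !lw_zword; lia. Qed.

Lemma zword_uniq w m : nodesc 1 n w -> weight w = m -> w = zword m.
Proof.
move=> wS wm; apply: (@nodesc_uniq n 1 n) => //; first exact: nodesc_zword.
  by move=> p pn; rewrite pn.
by rewrite weight_zword // -wm /weight cnt_le.
Qed.

End Action.

(** * Standard bases of the Specht modules *)

Section FockAction.
Variables (F : fieldType) (e n : nat) (kappa : 'Z_e * 'Z_e).
Hypotheses (e_ge3 : (3 <= e)%N) (kappa21 : kappa.2 = kappa.1 - 1) (n_gt0 : (0 < n)%N).
Local Notation H := (cycKLR F n kappa).
Local Notation vec := (vec F n).
Local Notation delta := (@delta F n).
Local Notation FK := (Fock F e_ge3 kappa21 n_gt0).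
Implicit Types (w u : word n) (f g : vec) (h k : H) (Q : pred (word n)).

Definition hact h f : vec := (h *: (f : FK) : FK).

Lemma hact_linear h : linear (hact h).
Proof.
move=> c f g; transitivity ((h *: ((c *: (1 : H)) *: (f : FK) + (g : FK))) : FK).
  by rewrite /hact -[c *: f](@FockZ F e n kappa e_ge3 kappa21 n_gt0 c f).
have hc : h * (c *: (1 : H)) = (c *: (1 : H)) * h.
  by rewrite -presalg_scaleAr -presalg_scaleAl mulr1 mul1r.
rewrite scalerDr scalerA hc -scalerA; congr (_ + _); exact: FockZ.
Qed.
HB.instance Definition _ h := GRing.isLinear.Build F vec vec *:%R (hact h) (hact_linear h).

Lemma hactM h k f : hact (h * k) f = hact h (hact k f).
Proof. by rewrite /hact scalerA. Qed.
Lemma hactDl h k f : hact (h + k) f = hact h f + hact k f.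
Proof. by rewrite /hact scalerDl. Qed.
Lemma hactNl h f : hact (- h) f = - hact h f.
Proof. by rewrite /hact scaleNr. Qed.
Lemma hact0l f : hact 0 f = 0.
Proof. by rewrite /hact scale0r. Qed.
Lemma hact1l f : hact 1 f = f.
Proof. by rewrite /hact scale1r. Qed.
Lemma hactZl c h f : hact (c *: h) f = c *: hact h f.
Proof.
by rewrite -[c *: h]mul1r -presalg_scaleAr presalg_scaleAl hactM; exact: FockZ.
Qed.

Lemma hact_e i f : hact (klr_e F kappa i) f = eM kappa i f.
Proof. exact: Fock_e. Qed.
Lemma hact_y r f : (0 < r <= n)%N -> hact (klr_y F n kappa r) f = opM (y_op e r) f.
Proof. exact: Fock_y. Qed.
Lemma hact_psi r f : (0 < r < n)%N -> hact (klr_psi F n kappa r) f = opM (psi_op e r) f.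
Proof. exact: Fock_psi. Qed.

Lemma hact_psi_asc w s : (0 < s < n)%N -> asc w s ->
  hact (klr_psi F n kappa s) (delta w) = delta (swp s s.+1 w).
Proof.
by move=> sn as_; rewrite hact_psi // opM_delta act_psi_asc /= ?scale1r //; lia.
Qed.

Definition supp (Q : pred (word n)) f : Prop := forall w, ~~ Q w -> f w = 0.

Lemma suppD Q f g : supp Q f -> supp Q g -> supp Q (f + g).
Proof. by move=> Qf Qg w Qw; rewrite ffunE Qf ?Qg ?addr0. Qed.
Lemma suppZ Q c f : supp Q f -> supp Q (c *: f).
Proof. by move=> Qf w Qw; rewrite ffunE Qf ?scaler0. Qed.
Lemma supp0 Q : supp Q 0.
Proof. by move=> w _; rewrite ffunE. Qed.
Lemma supp_delta Q w : Q w -> supp Q (delta w).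
Proof. by move=> Qw u; rewrite ffunE; case: eqP => // ->; rewrite Qw. Qed.

Lemma supp_sum Q f : supp Q f -> f = \sum_(w | Q w) f w *: delta w.
Proof.
move=> Qf; rewrite {1}[f]vec_sum [RHS]big_mkcond; apply: eq_bigr => w _.
by case: ifP => // /negbT/Qf->; rewrite scale0r.
Qed.

Lemma supp_ind Q (T : vec -> Prop) f : T 0 -> (forall a b, T a -> T b -> T (a + b)) ->
  (forall c a, T a -> T (c *: a)) -> (forall w, Q w -> T (delta w)) -> supp Q f -> T f.
Proof.
by move=> T0 TD TZ Td /supp_sum->; apply: big_ind => // w /Td; exact: TZ.
Qed.

Lemma supp_lext Q (t : word n -> vec) f : (forall w, Q w -> supp Q (t w)) ->
  supp Q f -> supp Q (lext t f).
Proof.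
move=> Qt Qf w Qw; rewrite /lext sum_ffunE big1 // => u _; rewrite ffunE.
have [Qu|/Qf->] := boolP (Q u); first by rewrite Qt ?scaler0.
by rewrite scale0r.
Qed.

Lemma supp_kden Q x : (forall sg u, x = Some (sg, u) -> Q u) -> supp Q (kden F x).
Proof.
case: x => [[sg u]|] Qx; last exact: supp0.
by apply/suppZ/supp_delta/(Qx sg).
Qed.

(** Only [psi] and [y] have to preserve [Q], since the e(i) act diagonally on words. *)
Lemma supp_hact Q : (forall r w sg u, (0 < r < n)%N -> act (psi_op e r) w = Some (sg, u) ->
    Q w -> Q u) ->
  (forall r w sg u, (0 < r <= n)%N -> act (y_op e r) w = Some (sg, u) -> Q w -> Q u) ->
  forall h f, supp Q f -> supp Q (hact h f).
Proof.
move=> Qpsi Qy h; elim/presalg_ind: h => [a|||h IH|h k IH1 IH2|h k IH1 IH2|c h IH] f Qf.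
- rewrite /hact FockE; case: a => [i|[r rn]|[r rn]] /=.
  + by apply: supp_lext Qf => w Qw; case: ifP => _; [exact: supp_delta|exact: supp0].
  + by apply: supp_lext Qf => w Qw; apply: supp_kden => sg u /Qy; apply.
  + by apply: supp_lext Qf => w Qw; apply: supp_kden => sg u /Qpsi; apply; rewrite // ; lia.
- by rewrite hact0l; exact: supp0.
- by rewrite hact1l.
- by rewrite hactNl -scaleN1r; apply/suppZ/IH.
- by rewrite hactDl; apply: suppD; [exact: IH1|exact: IH2].
- by rewrite hactM; apply/IH1/IH2.
- by rewrite hactZl; apply/suppZ/IH.
Qed.

Lemma supp_weight (a : pred nat) h f : supp (a \o @weight n) f ->
  supp (a \o @weight n) (hact h f).
Proof.
apply: supp_hact => r w sg u rn /=.
  by move=> /(act_psi rn)[-> _].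
by have [r0 _] := andP rn; move=> /(act_y_len r0)[-> _].
Qed.

End FockAction.

(** * Equivariance of the map from words to standard vectors *)

Section Specht.
Variables (F : fieldType) (e n : nat) (kappa : 'Z_e * 'Z_e).
Hypotheses (e_ge3 : (3 <= e)%N) (kappa21 : kappa.2 = kappa.1 - 1) (n_gt0 : (0 < n)%N).
Variable m : nat.
Hypothesis mn : (m <= n)%N.
Local Notation H := (cycKLR F n kappa).
Local Notation vec := (vec F n).
Local Notation delta := (@delta F n).
Local Notation hact := (@hact F e n kappa e_ge3 kappa21 n_gt0).
Local Notation S := (S_bihook F n kappa m).
Local Notation z := (z_bihook F n kappa m).
Local Notation psi := (klr_psi F n kappa).
Local Notation y := (klr_y F n kappa).
Local Notation ee := (klr_e F kappa).
Local Notation down := (psi_down F n kappa).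
Implicit Types (w u v : word n) (f g : vec) (h k : H) (i : mi e n).

(** The factor of v(a_1, ..., a_m) belonging to position p: if p = a_j, then j is [(cnt w p).+1]. *)
Definition vfac w p : H := if lw w p then down p.-1 (cnt w p).+1 else 1.

(** Words of another weight go to 0, so that [Psi] is defined on the whole Fock module. *)
Definition vword w : S :=
  if weight w == m then (\prod_(1 <= p < n.+1) vfac w p) *: z else 0.

Lemma psi_downS b a : (a <= b.+1)%N -> down b.+1 a = psi b.+1 * down b a.
Proof.
move=> ab; rewrite /psi_down [index_iota a b.+2]/index_iota subSn // -[_.+1]addn1 iotaD.
by rewrite rev_cat big_cat /= big_seq1 subnKC.
Qed.

Lemma psi_down1 b a : (b < a)%N -> down b a = 1.
Proof. by move=> ba; rewrite /psi_down /index_iota (eqP (_ : _ - _ == 0)%N) ?big_nil. Qed.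

Lemma vword_zword : vword (zword n m) = z.
Proof.
rewrite /vword weight_zword // eqxx big1_seq ?scale1r // => p.
rewrite mem_index_iota /vfac => /andP[_ pn]; rewrite lw_zword //.
by case: ifP => // pm; rewrite psi_down1 // cnt_zword //; lia.
Qed.

(** The L in position s moves to s + 1 and its factor gains psi_s on the left. The earlier factors
    only involve indices up to s - 2, so psi_s commutes with them. *)
Lemma psi_vword w s : (0 < s < n)%N -> asc w s -> psi s *: vword w = vword (swp s s.+1 w).
Proof.
move=> sn as_; rewrite /vword weight_swp; try lia.
case: eqP => _; last by rewrite scaler0.
rewrite scalerA; congr (_ *: _); have [ws /negPf ws1] := andP as_.
have s0 : (0 < s)%N by lia.
have cut u : \prod_(1 <= p < n.+1) vfac u p =
    \prod_(1 <= p < s) vfac u p * (vfac u s * vfac u s.+1 * \prod_(s.+2 <= p < n.+1) vfac u p).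
  rewrite (big_cat_nat (n := s)) //=; last by lia.
  by rewrite [X in _ * X]big_ltn ?[X in _ * (_ * X)]big_ltn ?mulrA //; lia.
rewrite (cut w) (cut (swp s s.+1 w)) mulrA.
have us : lw (swp s s.+1 w) s = false by rewrite lw_swp /tr ?eqxx //; lia.
have us1 : lw (swp s s.+1 w) s.+1 = true.
  by rewrite lw_swp /tr ?eqxx ?gtn_eqF //; lia.
have uo p : p != s -> p != s.+1 -> lw (swp s s.+1 w) p = lw w p.
  by move=> /negPf p1 /negPf p2; rewrite lw_swp /tr ?p1 ?p2 //; lia.
have cl p : (p <= s)%N -> cnt (swp s s.+1 w) p = cnt w p.
  by move=> ps; apply: eq_cnt => q qp; apply: uo; lia.
have cr p : (s.+2 <= p)%N -> cnt (swp s s.+1 w) p = cnt w p.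
  move=> ps; apply: (@eq_cnt_from n s.+2) => [|//|q qp]; first exact: ps.
    by rewrite !cntS // us us1 ws ws1 cl //; lia.
  by apply: uo; lia.
have -> : \prod_(1 <= p < s) vfac (swp s s.+1 w) p = \prod_(1 <= p < s) vfac w p.
  by apply: eq_big_nat => p ps; rewrite /vfac uo ?cl //; lia.
have -> : \prod_(s.+2 <= p < n.+1) vfac (swp s s.+1 w) p =
          \prod_(s.+2 <= p < n.+1) vfac w p.
  by apply: eq_big_nat => p ps; rewrite /vfac uo ?cr //; lia.
have cs : (cnt w s < s)%N by case: (s) s0 => // s' _; rewrite ltnS cnt_le.
have -> : vfac (swp s s.+1 w) s * vfac (swp s s.+1 w) s.+1 = psi s * (vfac w s * vfac w s.+1).
  rewrite /vfac us us1 ws ws1 mul1r mulr1 /= cntS // us addn0 cl //.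
  by case: (s) cs => // s' cs; rewrite psi_downS.
rewrite !mulrA; congr (_ * _ * _ * _); rewrite big_seq; apply/esym.
suff: GRing.comm (psi s) (\prod_(p <- index_iota 1 s | p \in index_iota 1 s) vfac w p) by [].
apply: commr_prod => p; rewrite mem_index_iota /vfac => ps.
case: ifP => _; last exact: commr1.
rewrite /psi_down big_seq; apply: commr_prod => q; rewrite mem_rev mem_index_iota => qp.
by apply: klr_psipsiE; lia.
Qed.

Definition sc (c : F) (x : S) : S := (c *: (1 : H)) *: x.

Lemma scaler_sc h c x : h *: sc c x = sc c (h *: x).
Proof. by rewrite /sc !scalerA -presalg_scaleAr -presalg_scaleAl mulr1 mul1r. Qed.

(** The future left inverse of [Phi]. A map out of S is given by the presentation, whereas
    compatibility of this map with the algebra must be proved generator by generator, as [Eqv]. *)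
Definition Psi f : S := \sum_w sc (f w) (vword w).

Lemma PsiD f g : Psi (f + g) = Psi f + Psi g.
Proof.
rewrite /Psi -big_split; apply: eq_bigr => w _ /=.
by rewrite /sc ffunE scalerDl scalerDl.
Qed.

Lemma PsiZ c f : Psi (c *: f) = sc c (Psi f).
Proof.
rewrite /Psi {2}/sc scaler_sumr; apply: eq_bigr => w _.
by rewrite /sc ffunE scalerA -presalg_scaleAl mul1r scalerA.
Qed.

Lemma Psi0 : Psi 0 = 0.
Proof. by have := PsiZ 0 0; rewrite scale0r /sc !scale0r. Qed.

Lemma PsiN f : Psi (- f) = - Psi f.
Proof. by rewrite -[- f]scaleN1r PsiZ /sc !scaleNr !scale1r. Qed.

Lemma Psi_delta w : Psi (delta w) = vword w.
Proof.
rewrite /Psi (bigD1 w) //= big1 => [|u /negPf uw].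
  by rewrite /sc ffunE eqxx !scale1r addr0.
by rewrite /sc ffunE uw !scale0r.
Qed.

Definition Eqv h f : Prop := Psi (hact h f) = h *: Psi f.

Lemma EqvM h k f : Eqv k f -> Eqv h (hact k f) -> Eqv (h * k) f.
Proof. by rewrite /Eqv hactM -scalerA => -> ->. Qed.
Lemma EqvDl h k f : Eqv h f -> Eqv k f -> Eqv (h + k) f.
Proof. by rewrite /Eqv hactDl PsiD scalerDl => -> ->. Qed.
Lemma EqvNl h f : Eqv h f -> Eqv (- h) f.
Proof. by rewrite /Eqv hactNl PsiN scaleNr => ->. Qed.
Lemma Eqv0l f : Eqv 0 f.
Proof. by rewrite /Eqv hact0l Psi0 scale0r. Qed.
Lemma Eqv1l f : Eqv 1 f.
Proof. by rewrite /Eqv hact1l scale1r. Qed.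
Lemma Eqv_bool (b : bool) f : Eqv b%:R f.
Proof. by case: b; [exact: Eqv1l|exact: Eqv0l]. Qed.
Lemma EqvD h f g : Eqv h f -> Eqv h g -> Eqv h (f + g).
Proof. by rewrite /Eqv linearD !PsiD scalerDr => -> ->. Qed.
Lemma EqvZ h c f : Eqv h f -> Eqv h (c *: f).
Proof. by rewrite /Eqv linearZ /= !PsiZ scaler_sc => ->. Qed.
Lemma Eqv0 h : Eqv h 0.
Proof. by rewrite /Eqv linear0 Psi0 scaler0. Qed.

Lemma Eqv_psi_asc w s : (0 < s < n)%N -> asc w s -> Eqv (psi s) (delta w).
Proof.
move=> sn as_; rewrite /Eqv hact_psi // opM_delta act_psi_asc //; last lia.
by rewrite /= scale1r !Psi_delta psi_vword.
Qed.

Lemma Psi_weight f : supp (fun w => weight w != m) f -> Psi f = 0.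
Proof.
move=> Qf; rewrite /Psi big1 // => w _; have [wm|wm] := boolP (weight w != m).
  by rewrite /vword (negPf wm) /sc scaler0.
by rewrite Qf // /sc !scale0r.
Qed.

Lemma res_zword : wres kappa (zword n m) = res_bihook n kappa m.
Proof.
apply: eq_mi => r rn; rewrite !ent_mi_of // /resid lw_zword // cnt_zword; last lia.
case: leqP => rm; first by congr (_ - _%:R); lia.
by congr (_ + _%:R); lia.
Qed.

Lemma Eqv_offweight h w : weight w != m -> Eqv h (delta w).
Proof.
move=> wm; rewrite /Eqv Psi_delta /vword (negPf wm) scaler0 Psi_weight //.
by apply: (@supp_weight F e n kappa e_ge3 kappa21 n_gt0 (predC1 m)); exact: supp_delta.
Qed.

Lemma weight_ind (T : word n -> Prop) : T (zword n m) ->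
  (forall w s, (0 < s < n)%N -> asc w s -> weight w = m -> T w -> T (swp s s.+1 w)) ->
  forall w, weight w = m -> T w.
Proof.
move=> Tz Tup w; have [u [uS _ uw up _]] := sort_word (leqnn 1) (leqnn n) w.
move=> wm; have := up (fun v => weight v = m -> T v); apply => // [v s sn as_ Tv vm|_].
  have {}vm : weight v = m by rewrite -vm weight_swp //; lia.
  by apply: Tup => //; exact: Tv.
by rewrite (zword_uniq uS (etrans uw wm)).
Qed.

Lemma wres_swp w s : (0 < s < n)%N -> asc w s ->
  wres kappa (swp s s.+1 w) = swap s (wres kappa w).
Proof.
move=> sn as_; apply: (act_psi_res (e := e) e_ge3 kappa21 sn (sg := false)).
by rewrite act_psi_asc //; lia.
Qed.

Lemma e_vword w : weight w = m -> forall i,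
  ee i *: vword w = if wres kappa w == i then vword w else 0.
Proof.
move: w; apply: weight_ind => [i|w s sn as_ wm IH i].
  have ez : ee (res_bihook n kappa m) *: z = z.
    by apply/eqP; rewrite -subr_eq0 -{2}[z]scale1r -scalerBl; apply/eqP/cycgen_rel/bihook_e.
  rewrite vword_zword res_zword -{1}ez scalerA klr_eeE eq_sym.
  by case: (eqVneq (res_bihook n kappa m) i) => [<-|_]; rewrite ?scale0r.
rewrite -psi_vword // scalerA -[i](swapK i sn) -klr_psieE // -scalerA IH.
rewrite wres_swp // (inj_eq (can_inj (fun j => swapK j sn))).
by case: ifP; rewrite ?scaler0.
Qed.

Lemma Eqv_e i w : Eqv (ee i) (delta w).
Proof.
have [wm|] := eqVneq (weight w) m; last exact: Eqv_offweight.
rewrite /Eqv hact_e /eM lext_delta Psi_delta e_vword //.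
by case: ifP => _; rewrite ?Psi_delta ?Psi0.
Qed.

Lemma e_wres w : weight w = m -> ee (wres kappa w) *: vword w = vword w.
Proof. by move=> wm; rewrite e_vword // eqxx. Qed.

Lemma hact_wres w : hact (ee (wres kappa w)) (delta w) = delta w.
Proof. by rewrite hact_e /eM lext_delta eqxx. Qed.

Lemma Eqv_drop_e h w : weight w = m -> Eqv (h * ee (wres kappa w)) (delta w) ->
  Eqv h (delta w).
Proof. by move=> wm; rewrite /Eqv hactM hact_wres -scalerA Psi_delta e_wres. Qed.

(** A word with a descent is psi_s of a word with smaller [len]; a defining relation can then be
    used to rewrite h psi_s e(i). *)
Lemma Eqv_up h w s : (0 < s < n)%N -> asc w s -> weight w = m ->
  Eqv (h * psi s * ee (wres kappa w)) (delta w) -> Eqv h (delta (swp s s.+1 w)).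
Proof.
move=> sn as_ wm; rewrite -mulrA /Eqv hactM -scalerA hactM -scalerA Psi_delta.
by rewrite e_wres // hact_wres hact_psi_asc // Psi_delta psi_vword.
Qed.

Lemma Eqv_up0 h w s : (0 < s < n)%N -> asc w s ->
  Eqv (h * psi s) (delta w) -> Eqv h (delta (swp s s.+1 w)).
Proof.
move=> sn as_; rewrite /Eqv hactM -scalerA hact_psi_asc //.
by rewrite !Psi_delta psi_vword.
Qed.

Lemma Eqv_braid_const r i f : Eqv (braid_const F kappa r i) f.
Proof.
rewrite /braid_const; case: ifP => _; first exact: Eqv1l.
by case: ifP => _; [apply/EqvNl/Eqv1l|exact: Eqv0l].
Qed.

Definition low L f : Prop := supp (fun w => (len w < L)%N) f.

Lemma low_psi w r : (0 < r < n)%N -> low (len w + 2) (hact (psi r) (delta w)).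
Proof.
move=> rn; rewrite hact_psi // opM_delta; apply: supp_kden => sg u /(act_psi rn)[_ [H _]].
by apply: leq_ltn_trans H _; case: (asc w r); lia.
Qed.

Lemma low_psi_nasc w r : (0 < r < n)%N -> ~~ asc w r ->
  low (len w) (hact (psi r) (delta w)).
Proof.
move=> rn ar; rewrite hact_psi // opM_delta; apply: supp_kden => sg u.
by move=> /(act_psi rn)[_ [_ H]]; exact: H.
Qed.

Lemma low_y w r : (0 < r <= n)%N -> low (len w) (hact (y r) (delta w)).
Proof.
move=> rn; have [r0 _] := andP rn; rewrite hact_y // opM_delta.
by apply: supp_kden => sg u /(act_y_len r0)[].
Qed.

Lemma low_psi_low L f r : (0 < r < n)%N -> low L f -> low L.+1 (hact (psi r) f).
Proof.
move=> rn; apply: (supp_ind (T := fun g => low L.+1 (hact (psi r) g))) => [|a b Ta Tb|c a Ta|w wL].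
- by rewrite linear0; exact: supp0.
- by rewrite linearD; exact: suppD.
- by rewrite linearZ; exact: suppZ.
- move=> u; rewrite -leqNgt => uL; apply: (low_psi (w := w) rn); rewrite -leqNgt.
  by apply: leq_trans uL; lia.
Qed.

Lemma Eqv_low h L f : (forall w, (len w < L)%N -> Eqv h (delta w)) -> low L f -> Eqv h f.
Proof.
move=> HL; apply: (supp_ind (T := Eqv h)).
- exact: Eqv0.
- by move=> a b; exact: EqvD.
- by move=> c a; exact: EqvZ.
- exact: HL.
Qed.

Section Step.
Variable w : word n.
Hypothesis wm : weight w = m.
Hypothesis IHy : forall u r, (len u < len w)%N -> (0 < r <= n)%N -> Eqv (y r) (delta u).
Hypothesis IHpsi : forall u r, (len u < len w)%N -> (0 < r < n)%N -> Eqv (psi r) (delta u).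

Let low_IHpsi r f : (0 < r < n)%N -> low (len w) f -> Eqv (psi r) f.
Proof. by move=> rn; apply: Eqv_low => u uw; exact: IHpsi. Qed.

(** Without descents [w] is the word of z, killed on both sides. Otherwise [w] is psi_s of a word
    with smaller [len], and y_r is moved past psi_s. *)
Lemma Eqv_y_step r : (0 < r <= n)%N -> Eqv (y r) (delta w).
Proof.
move=> rn; have [/asboolP wS|] := boolP `[< nodesc 1 n w >].
  have -> : w = zword n m by exact: zword_uniq.
  rewrite /Eqv Psi_delta vword_zword (_ : y r *: z = 0); last first.
    by apply: cycgen_rel; exact: bihook_y.
  rewrite hact_y // opM_delta; case E: (act _ _) => [[sg u]|]; last by rewrite Psi0.
  have [r0 _] := andP rn; have [q [qn dq _ _]] := act_y r0 E.
  by have := @nodesc_zword n m q; rewrite dq; move=> /(_ ltac:(lia)).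
move=> /asboolPn/existsNP[s] /not_implyP[sn] /negP; rewrite negbK => ds.
have {}sn : (0 < s < n)%N by lia.
pose v := swp s s.+1 w; have av : asc v s by exact: asc_swp.
have vw : w = swp s s.+1 v by rewrite /v swpK //; lia.
have vm : weight v = m by rewrite weight_swp //; lia.
have lv : (len v < len w)%N.
  by case/andP: ds => wl wr; have := @len_swp n s s.+1 w; rewrite /v; lia.
have psiy t : (0 < t <= n)%N -> Eqv (psi s * y t) (delta v).
  move=> tn; apply: EqvM; first exact: IHy.
  apply: low_IHpsi => // u; rewrite -leqNgt => uw.
  by apply: (low_y (w := v) tn); rewrite -leqNgt; lia.
rewrite vw; apply: Eqv_up => //.
have drop h : Eqv h (delta v) -> Eqv (h * ee (wres kappa v)) (delta v).
  by move=> Hh; apply: EqvM; [exact: Eqv_e|rewrite hact_wres].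
have [->|rs1] := eqVneq r s.+1.
  rewrite klr_ySpsiE //; apply/drop/EqvDl; last exact: Eqv_bool.
  by apply: psiy; lia.
have [->|rs] := eqVneq r s.
  have -> : y s * psi s * ee (wres kappa v) =
      (psi s * y s.+1 - (ent (wres kappa v) s == ent (wres kappa v) s.+1)%:R) *
      ee (wres kappa v).
    by rewrite mulrBl klr_psiySE // mulrDl addrK.
  apply/drop/EqvDl; last by apply/EqvNl/Eqv_bool.
  by apply: psiy; lia.
by rewrite -klr_psiyE //; apply/drop/psiy.
Qed.

Lemma low_mono L L' f : (L <= L')%N -> low L f -> low L' f.
Proof. by move=> LL' Lf u; rewrite -leqNgt => uL; apply: Lf; rewrite -leqNgt; lia. Qed.

Lemma Eqv_drop h v : weight v = m -> Eqv h (delta v) ->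
  Eqv (h * ee (wres kappa v)) (delta v).
Proof. by move=> vm Hh; apply: EqvM; [exact: Eqv_e|rewrite hact_wres]. Qed.

(** As [v] has no ascent at a, the first psi_a strictly lowers [len]; this makes up for the increase
    psi_b may cause, so all three factors act below [len w]. *)
Lemma Eqv_braid v a b : (len v + 2 <= len w)%N -> (0 < a < n)%N -> (0 < b < n)%N ->
  ~~ asc v a -> Eqv (psi a * psi b * psi a) (delta v).
Proof.
move=> lv an bn av; apply: EqvM; first by apply: IHpsi => //; lia.
have lowv := low_psi_nasc an av.
apply: EqvM; first by apply: low_IHpsi => //; apply: low_mono lowv; lia.
by apply: low_IHpsi => //; apply: low_mono (low_psi_low bn lowv); lia.
Qed.

(** Here [w] is psi_(s1) psi_(s2) applied to [v2], so psi_(s2) on [w] is one side of a braid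
    relation on [v2]. *)
Lemma Eqv_braid_up s1 s2 (c : mi e n -> H) : (0 < s1 < n)%N -> (0 < s2 < n)%N ->
  desc w s1 -> desc (swp s1 s1.+1 w) s2 -> ~~ asc (swp s2 s2.+1 (swp s1 s1.+1 w)) s1 ->
  (forall i, psi s2 * psi s1 * psi s2 * ee i = (psi s1 * psi s2 * psi s1 + c i) * ee i) ->
  (forall i f, Eqv (c i) f) -> Eqv (psi s2) (delta w).
Proof.
move=> s1n s2n d1 d2; set v := swp s1 s1.+1 w in d2 *; set v2 := swp s2 s2.+1 v => a2 rel cE.
have swK s u : (0 < s < n)%N -> swp s s.+1 (swp s s.+1 u) = u.
  by move=> sn; apply: swpK; lia.
have vm : weight v2 = m by rewrite !weight_swp //; lia.
have lv : (len v2 + 2 <= len w)%N.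
  case/andP: d1 => p1 p2; case/andP: d2 => p3 p4.
  have := @len_swp n s1 s1.+1 w; have := @len_swp n s2 s2.+1 v.
  by rewrite -/v -/v2; lia.
have a1 : asc v s1 by exact: asc_swp.
have a3 : asc v2 s2 by exact: asc_swp.
rewrite -(swK s1 w) //; apply: Eqv_up0 => //; rewrite -/v -(swK s2 v) //.
apply: Eqv_up0 => //; apply: Eqv_drop_e => //; rewrite rel.
apply: Eqv_drop => //; apply: EqvDl; last exact: cE.
exact: Eqv_braid.
Qed.

(** The letters A L L in positions s, s + 1, s + 2 come from L L A. *)
Lemma Eqv_ALL s : (0 < s)%N -> (s.+1 < n)%N -> desc w s -> lw w s.+2 ->
  Eqv (psi s.+1) (delta w).
Proof.
move=> s0 sn ds ws2; have [ws ws1] := andP ds.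
have [b0 [b1 b2]] : (0 < s <= n)%N /\ (0 < s.+1 <= n)%N /\ (0 < s.+2 <= n)%N by lia.
have [n1 n2] : s.+2 != s /\ s.+2 != s.+1 by lia.
apply: (@Eqv_braid_up s s.+1 (fun i => - braid_const F kappa s i)) => //.
- by rewrite s0 ltnW.
- by rewrite /desc !lw_swp // tr_r tr_out // ws.
- by rewrite /asc !lw_swp // [tr _ _ s.+1]tr_l [tr _ _ s.+2]tr_out // ws2 andbF.
- by move=> i; rewrite klr_braidE'.
- by move=> i f; apply/EqvNl/Eqv_braid_const.
Qed.

(** The letters A A L in positions r, r + 1, r + 2 come from L A A. *)
Lemma Eqv_AAL r : (0 < r)%N -> (r.+1 < n)%N -> desc w r.+1 -> ~~ lw w r ->
  Eqv (psi r) (delta w).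
Proof.
move=> r0 rn ds wr; have [wr1 wr2] := andP ds.
have [b0 [b1 b2]] : (0 < r <= n)%N /\ (0 < r.+1 <= n)%N /\ (0 < r.+2 <= n)%N by lia.
have [n1 n2] : r != r.+1 /\ r != r.+2 by lia.
apply: (@Eqv_braid_up r.+1 r (fun i => braid_const F kappa r i)) => //.
- by rewrite r0 ltnW.
- by rewrite /desc !lw_swp // tr_l tr_out // wr.
- by rewrite /asc !lw_swp // tr_r tr_out // (negPf wr).
- by move=> i; rewrite klr_braidE.
- by move=> i f; exact: Eqv_braid_const.
Qed.

(** An ascent is the construction of the standard vectors, and a descent is the quadratic relation.
    For equal letters take any descent s of [w]: the braid relation applies if s is next to r, and
    psi_s commutes with psi_r otherwise. *)
Lemma Eqv_psi_step r : (0 < r < n)%N -> Eqv (psi r) (delta w).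
Proof.
move=> rn; have [|ar] := boolP (asc w r); first exact: Eqv_psi_asc.
have len_desc v s : (0 < s < n)%N -> desc v s -> len v = (len (swp s s.+1 v)).+1.
  by move=> sn /andP[vl vr]; have := @len_swp n s s.+1 v; lia.
have weight_s v s : (0 < s < n)%N -> weight (swp s s.+1 v) = weight v.
  by move=> sn; rewrite weight_swp //; lia.
have swsw v s : (0 < s < n)%N -> v = swp s s.+1 (swp s s.+1 v).
  by move=> sn; rewrite swpK //; lia.
have [dr|dr] := boolP (desc w r).
  have lv := len_desc _ _ rn dr; have vm := weight_s w r rn.
  have av := asc_swp rn dr; rewrite (swsw w r rn); apply: Eqv_up => //; first by rewrite vm.
  have vm' : weight (swp r r.+1 w) = m by rewrite vm.
  have Hy t : (0 < t <= n)%N -> Eqv (y t) (delta (swp r r.+1 w)).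
    by move=> tn; apply: IHy => //; lia.
  have Hy0 : (0 < r <= n)%N by lia.
  have Hy1 : (0 < r.+1 <= n)%N by lia.
  rewrite klr_quadE //; case: ifP => _; first exact: Eqv0l.
  case: ifP => _; first by apply: Eqv_drop => //; apply: EqvDl; [|apply: EqvNl]; exact: Hy.
  case: ifP => _; last exact: Eqv_e.
  by apply: Eqv_drop => //; apply: EqvDl; [|apply: EqvNl]; exact: Hy.
have wr : lw w r = lw w r.+1.
  by move: ar dr; rewrite /asc /desc; case: (lw w r); case: (lw w r.+1).
have [/asboolP wS|] := boolP `[< nodesc 1 n w >].
  have Ew : w = zword n m by exact: zword_uniq.
  (* The letters of [zword n m] in positions m and m + 1 differ, so r is not m and z is killed by
     psi_r. *)
  have rm : r != m.
    by apply/eqP => rm; move: wr; rewrite Ew !lw_zword; lia.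
  rewrite /Eqv Psi_delta Ew vword_zword (_ : psi r *: z = 0); last first.
    by apply: cycgen_rel; apply: bihook_psi => //; lia.
  rewrite hact_psi // opM_delta -Ew; case E: (act _ _) => [[sg u]|]; last by rewrite Psi0.
  have [r0 _] := andP rn; have [i [j [[ij jn wi wj _] _ _]]] := act_psi_nasc r0 ar E.
  by case/negP: wi; apply: (nodesc_mono wS _ _ wj); lia.
move=> /asboolPn/existsNP[s] /not_implyP[sn] /negP; rewrite negbK => ds.
have {}sn : (0 < s < n)%N by lia.
have [sr|sr] := eqVneq s r; first by rewrite -sr ds in dr.
have [rs1|rs1] := eqVneq s.+1 r.
  rewrite -rs1; apply: Eqv_ALL => //; try lia.
  by rewrite rs1 -wr -rs1; case/andP: ds.
have [rs2|rs2] := eqVneq r.+1 s.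
  by apply: Eqv_AAL; rewrite ?rs2 ?wr ?rs2 //; [lia|lia|case/andP: ds].
have lv := len_desc _ _ sn ds; have vm := weight_s w s sn; rewrite wm in vm.
have av := asc_swp sn ds; rewrite (swsw w s sn); apply: Eqv_up0 => //.
rewrite klr_psipsiE //; last by lia.
apply: EqvM; first by apply: IHpsi => //; lia.
apply: low_IHpsi => //; apply: low_mono (low_psi_nasc rn _); first lia.
have [b1 b2] : (0 < s <= n)%N /\ (0 < s.+1 <= n)%N by lia.
have [n1 [n2 n3]] : r != s /\ r.+1 != s /\ r != s.+1 by lia.
by rewrite /asc !lw_swp // !tr_out.
Qed.

End Step.
End Specht.

(** * Embedding the Specht modules into the Fock module *)

Section SpechtBasis.
Variables (F : fieldType) (e n : nat) (kappa : 'Z_e * 'Z_e).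
Hypotheses (e_ge3 : (3 <= e)%N) (kappa21 : kappa.2 = kappa.1 - 1) (n_gt0 : (0 < n)%N).
Variable m : nat.
Hypothesis mn : (m <= n)%N.
Local Notation H := (cycKLR F n kappa).
Local Notation vec := (vec F n).
Local Notation delta := (@delta F n).
Local Notation hact := (@hact F e n kappa e_ge3 kappa21 n_gt0).
Local Notation S := (S_bihook F n kappa m).
Local Notation z := (z_bihook F n kappa m).
Local Notation psi := (klr_psi F n kappa).
Local Notation y := (klr_y F n kappa).
Local Notation FK := (Fock F e_ge3 kappa21 n_gt0).
Local Notation Psi := (@Psi F e n kappa m).
Local Notation vword := (@vword F e n kappa m).
Local Notation Eqv := (@Eqv F e n kappa e_ge3 kappa21 n_gt0 m).
Implicit Types (w u v : word n) (f g : vec) (h k : H) (x : S).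

(** The [y] and the [psi] are treated in one induction, because the step for each uses the other on
    words of smaller [len]. *)
Lemma Eqv_gen L w : (len w < L)%N -> forall r,
  ((0 < r <= n)%N -> Eqv (y r) (delta w)) /\ ((0 < r < n)%N -> Eqv (psi r) (delta w)).
Proof.
elim: L w => // L IHL w; rewrite ltnS => wL r.
have [wm|] := eqVneq (weight w) m; last first.
  by move=> wm; split=> _; apply: Eqv_offweight.
have IHy u s : (len u < len w)%N -> (0 < s <= n)%N -> Eqv (y s) (delta u).
  by move=> uw; have [] := IHL u (leq_trans uw wL) s.
have IHpsi u s : (len u < len w)%N -> (0 < s < n)%N -> Eqv (psi s) (delta u).
  by move=> uw; have [] := IHL u (leq_trans uw wL) s.
by split=> rn; [exact: Eqv_y_step|exact: Eqv_psi_step].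
Qed.

Lemma Psi_hact h f : Psi (hact h f) = h *: Psi f.
Proof.
elim/presalg_ind: h f => [a|||h IH|h k IH1 IH2|h k IH1 IH2|c h IH] f.
- rewrite -/(Eqv _ f) [f]vec_sum; apply: big_ind => [|a1 a2|w _]; [exact: Eqv0|exact: EqvD|].
  apply: EqvZ; have G := Eqv_gen (ltnSn (len w)).
  case: a => [i|[r rn]|[r rn]]; first exact: Eqv_e.
  + have [H1 _] := G r; move: (H1 rn).
    by rewrite /klr_y /tY (insubT (fun r => (0 < r <= n)%N) rn).
  + have [_ H2] := G r; move: (H2 ltac:(lia)).
    by rewrite /klr_psi /tPsi (insubT (fun r => (0 < r <= n.-1)%N) rn).
- exact: Eqv0l.
- exact: Eqv1l.
- exact: EqvNl.
- exact: EqvDl.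
- exact: EqvM.
- by rewrite hactZl PsiZ IH -scaler_sc /sc scalerA -presalg_scaleAr mulr1.
Qed.

Definition Phi : {linear S -> FK} := cychom (bihook_rel m) (delta (zword n m) : FK).

(** The only ascent of this word is at m and no A precedes an L, so every other generator of the
    relations finds nothing to exchange. *)
Lemma zword_rel h : bihook_rel m h -> hact h (delta (zword n m)) = 0.
Proof.
have nd : nodesc 1 n (zword n m) by exact: nodesc_zword.
case=> {h} [|r rn|r rn rm].
- by rewrite hactDl hactNl hact1l -res_zword // hact_wres subrr.
- rewrite hact_y // opM_delta; case E: (act _ _) => [[sg u]|] //.
  have [r0 _] := andP rn; have [q [qn dq _ _]] := act_y r0 E.
  by case/negP: (nd q ltac:(lia)).
- have rn' : (0 < r < n)%N by lia.
  have ar : ~~ asc (zword n m) r by rewrite /asc !lw_zword; lia.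
  rewrite hact_psi // opM_delta; case E: (act _ _) => [[sg u]|] //.
  have [r0 _] := andP rn; have [i [j [[ij jn wi wj _] _ _]]] := act_psi_nasc r0 ar E.
  by case/negP: wi; apply: (nodesc_mono nd _ _ wj); lia.
Qed.

Lemma Phi_z : Phi z = delta (zword n m) :> vec.
Proof. exact: (@cychomE _ _ FK _ (fun h => @zword_rel h)). Qed.

Lemma PhiZ h x : Phi (h *: x) = hact h (Phi x) :> vec.
Proof. by rewrite linearZ. Qed.

(** The composite is equivariant and fixes the generator z. *)
Lemma PhiK x : Psi (Phi x) = x.
Proof.
have [h ->] := cycgenP x; rewrite PhiZ Psi_hact [Phi _]Phi_z Psi_delta.
by rewrite vword_zword.
Qed.

Lemma Phi_weight x : supp (fun w => weight w == m) (Phi x).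
Proof.
have [h ->] := cycgenP x; rewrite PhiZ [Phi _]Phi_z.
apply: (@supp_weight F e n kappa e_ge3 kappa21 n_gt0 (pred1 m)).
by apply: supp_delta; rewrite /= weight_zword.
Qed.

Lemma Phi_vword w : weight w = m -> Phi (vword w) = delta w :> vec.
Proof.
move: w; apply: weight_ind => // [|w s sn as_ wm IH].
  by rewrite vword_zword // Phi_z.
by rewrite -psi_vword // PhiZ IH hact_psi_asc.
Qed.

Lemma Phi_inj x x' : Phi x = Phi x' :> vec -> x = x'.
Proof. by move=> E; rewrite -(PhiK x) E PhiK. Qed.

Lemma Phi_eq0 x : (Phi x = 0 :> vec) <-> x = 0.
Proof.
split=> [E|->]; last by rewrite linear0.
by apply: Phi_inj; rewrite E linear0.
Qed.

End SpechtBasis.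

(** * The homomorphisms on words *)

Section LastLetter.
Variables (F : fieldType) (n : nat).
Hypothesis n_gt0 : (0 < n)%N.
Local Notation vec := (vec F n).
Local Notation delta := (@delta F n).
Implicit Types (w u : word n) (f g : vec).

Definition setlast (b : bool) w : word n := mkword n (fun p => if p == n then b else lw w p).

Lemma lw_setlast b w p : lw (setlast b w) p = if p == n then b else lw w p.
Proof.
have [->|p0] := posnP p; first by rewrite lw0 ltn_eqF.
have [pn|np] := leqP p n; first by rewrite lw_mk ?p0.
by rewrite gtn_eqF // !lw_out.
Qed.

Lemma setlast_id b w : lw w n = b -> setlast b w = w.
Proof. by move=> wb; apply: eq_word => p _; rewrite lw_setlast; case: eqP => [->|]. Qed.

Lemma setlastK b c w : setlast c (setlast b w) = setlast c w.
Proof. by apply: eq_word => p _; rewrite !lw_setlast; case: eqP. Qed.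

Lemma cnt_setlast b w p : (p <= n)%N -> cnt (setlast b w) p = cnt w p.
Proof. by move=> pn; apply: eq_cnt => q qp; rewrite lw_setlast ltn_eqF //; lia. Qed.

Lemma weight_setlast b w : (weight (setlast b w) + lw w n = weight w + b)%N.
Proof. by rewrite /weight !cntS // cnt_setlast // lw_setlast eqxx; lia. Qed.

Lemma swp_setlast b w i j : (0 < i)%N -> (i < j < n)%N ->
  swp i j (setlast b w) = setlast b (swp i j w).
Proof.
move=> i0 ij; apply: eq_word => p pn; rewrite lw_setlast !lw_swp ?lw_setlast; try lia.
by congr (if _ then _ else _); rewrite /tr; do !case: eqP; lia.
Qed.

Lemma lw_swp_last w i j : (0 < i)%N -> (i < j < n)%N -> lw (swp i j w) n = lw w n.
Proof. by move=> i0 ij; rewrite lw_swp ?tr_out //; lia. Qed.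

(* The homomorphisms gamma_m, all at once, on the Fock module. *)
Definition Gam : vec -> vec := lext (fun w => if lw w n then 0 else delta (setlast true w)).

Lemma Gam_linear : linear Gam. Proof. exact: lext_linear. Qed.
HB.instance Definition _ := GRing.isLinear.Build F vec vec *:%R Gam Gam_linear.

Lemma Gam_delta w : Gam (delta w) = if lw w n then 0 else delta (setlast true w).
Proof. exact: lext_delta. Qed.

Lemma Gam_coef f w : lw w n = false -> Gam f (setlast true w) = f w.
Proof.
move=> wn; rewrite /Gam /lext sum_ffunE (bigD1 w) //= wn big1 => [|u uw].
  by rewrite !ffunE eqxx addr0 /GRing.scale /= mulr1.
case: ifP => un; first by rewrite !ffunE scaler0.
rewrite !ffunE; case: eqP => [E|_]; last by rewrite scaler0.
by rewrite -(setlast_id un) -(setlast_id wn) -(setlastK true) -E setlastK eqxx in uw.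
Qed.

Lemma Gam_supp f : supp (fun w => lw w n) (Gam f).
Proof.
move=> u un; rewrite /Gam /lext sum_ffunE big1 // => w _; rewrite ffunE.
case: ifP => _; first by rewrite ffunE scaler0.
rewrite ffunE; case: eqP => [E|_]; last by rewrite scaler0.
by rewrite E lw_setlast eqxx in un.
Qed.

Lemma Gam_eq0 f : Gam f = 0 <-> supp (fun w => lw w n) f.
Proof.
split=> [E w /negPf wn|Qf]; first by rewrite -Gam_coef // E ffunE.
apply: (supp_ind (T := fun g => Gam g = 0) _ _ _ _ Qf).
- exact: linear0.
- by move=> a b /= Ea Eb; rewrite linearD /= Ea Eb addr0.
- by move=> c a /= Ea; rewrite linearZ /= Ea scaler0.
- by move=> w wn; rewrite Gam_delta wn.
Qed.

Lemma opM_Gam o w : in_range n o -> (base o + width o <= n)%N ->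
  opM o (Gam (delta w)) = Gam (opM o (delta w)).
Proof.
move=> ok on; rewrite Gam_delta opM_delta.
have Ew b : win (base o) (width o) (setlast b w) = win (base o) (width o) w.
  by apply: eq_win => k kw; rewrite lw_setlast ltn_eqF //; lia.
case wn: (lw w n).
  rewrite linear0 /act; case E: (act_rule _ _) => [[[sg i] j]|] /=.
    have [? ? ? ?] := ok _ _ _ _ E.
    by rewrite linearZ /= Gam_delta lw_swp_last ?wn ?scaler0 //; lia.
  by rewrite linear0.
rewrite opM_delta /act Ew; case E: (act_rule _ _) => [[[sg i] j]|] /=; last by rewrite linear0.
have [? ? ? ?] := ok _ _ _ _ E.
by rewrite linearZ /= Gam_delta lw_swp_last ?wn ?swp_setlast //; lia.
Qed.

End LastLetter.

(** * Changing the last letter commutes with the algebra *)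

Section GamAction.
Variables (F : fieldType) (e n : nat) (kappa : 'Z_e * 'Z_e).
Hypotheses (e_ge3 : (3 <= e)%N) (kappa21 : kappa.2 = kappa.1 - 1) (n_gt0 : (0 < n)%N).
Hypothesis en : (e %| n)%N.
Local Notation vec := (vec F n).
Local Notation delta := (@delta F n).
Local Notation hact := (@hact F e n kappa e_ge3 kappa21 n_gt0).
Local Notation Gam := (@Gam F n).
Implicit Types (w u : word n) (f g : vec).

Lemma nge3 : (3 <= n)%N. Proof. exact: leq_trans e_ge3 (dvdn_leq n_gt0 en). Qed.

Lemma dvdn_last a k : (a + k = n)%N -> (0 < k < 3)%N -> (e %| a)%N = false.
Proof.
by move=> an k3; apply/negbTE/negP => ea; have := dvdn_near e_ge3 ea k3; rewrite an en.
Qed.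

(** The residues of an A and of an L in position n differ by n, which is 0 modulo e. *)
Lemma wres_setlast w b : wres kappa (setlast b w) = wres kappa w.
Proof.
apply: eq_mi => p pn; rewrite !ent_mi_of //.
have [p0 pn'] := andP pn.
rewrite !(residE kappa21) // cnt_setlast // lw_setlast //; congr (_ + _).
have n0 : n%:R = 0 :> 'Z_e by apply/eqP; rewrite natZ_eq0.
by case: eqP => // ->; rewrite n0 !if_same.
Qed.

Lemma Gam_y r f : (0 < r <= n)%N -> opM (y_op e r) (Gam f) = Gam (opM (y_op e r) f).
Proof.
move=> rn; move: f; apply: linear_ext.
- by move=> c a b; rewrite !linearP.
- by move=> c a b; rewrite !linearP.
move=> w; have inr := @y_in_range n e r.
have [le|gt] := leqP (base (y_op e r) + width (y_op e r)) n; first exact: opM_Gam.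
(* If the window reaches position n, an exchange would take place in positions n - 1 and n with e
   dividing n - 1, which contradicts e dividing n. *)
have none (v : word n) : act (y_op e r) v = None.
  case E: (act _ _) => [[sg u]|] //; have [r0 _] := andP rn.
  have [q [qn _ _ /andP[eq qr]]] := act_y r0 E.
  exfalso; move: gt; rewrite /= /psi_shift; have [q0 qn'] := andP qn.
  have last : (q + 1)%N <> n by move=> E1; have := dvdn_last E1 isT; rewrite eq.
  case/orP: qr => /eqP qr; rewrite -qr.
    have -> : cls e q = C0 by apply/eqP; rewrite clsZ.
    by rewrite /=; lia.
  have -> : cls e q.+1 = C1 by apply/eqP; rewrite clsP.
  by rewrite /=; lia.
by rewrite opM_delta none linear0 Gam_delta; case: ifP => _;
  rewrite ?opM_delta ?none // linear0.
Qed.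

Lemma act_psi_last w : lw w n -> act (psi_op e n.-1) w = None.
Proof.
have n3 := nge3; move: n3 en => n3 en'; case: n w n3 en' => // k w n3 en' wn /=.
have ck : cls e k = Cm1 by apply/eqP; rewrite clsM //; lia.
have Ek : (k.-1 + 1)%N = k by lia.
by rewrite /act /psi_op ck /psi_shift Ek /= wn (@lw_out k.+1 w k.+2) // !andbF.
Qed.

(** Only psi_(n-1) reads position n. It has class Cm1 and sees the sentinel A in position n + 1, so
    it kills words ending with L; on the others it can only turn a final L A into A L, which [Gam]
    kills. *)
Lemma Gam_psi r f : (0 < r < n)%N -> opM (psi_op e r) (Gam f) = Gam (opM (psi_op e r) f).
Proof.
move=> rn; move: f; apply: linear_ext.
- by move=> c a b; rewrite !linearP.
- by move=> c a b; rewrite !linearP.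
move=> w; have inr := @psi_in_range n e r rn.
have [r1|r1] := eqVneq r n.-1; last first.
  apply: opM_Gam => //=; rewrite /psi_shift /psi_width; have [r0 _] := andP rn.
  case cr: (cls e r); try lia.
  have {}cr : (e %| r.+1)%N by rewrite -clsM ?cr.
  have last : (r.+1 + 1)%N <> n by move=> E1; have := dvdn_last E1 isT; rewrite cr.
  by lia.
subst r; rewrite Gam_delta opM_delta; case wn: (lw w n).
  by rewrite act_psi_last // linear0 linear0.
rewrite opM_delta act_psi_last ?lw_setlast ?eqxx //=.
have [as_|as_] := boolP (asc w n.-1).
  rewrite act_psi_asc //; last lia.
  rewrite linearZ /= Gam_delta prednK // lw_swp; try lia.
  by rewrite tr_r; case/andP: as_ => ->; rewrite scaler0.
case E: (act _ _) => [[sg u]|]; last by rewrite linear0.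
move: E; rewrite /act /psi_op.
have -> : cls e n.-1 = Cm1 by apply/eqP; rewrite clsM ?prednK //; lia.
have Ek : (n.-1.-1 + 1)%N = n.-1 by lia.
rewrite /psi_shift Ek /= prednK // (@lw_out n w n.+1) // andbF.
by move: as_; rewrite /asc prednK // => /negPf->.
Qed.

Lemma hact_Gam h f : hact h (Gam f) = Gam (hact h f).
Proof.
elim/presalg_ind: h f => [a|||h IH|h k IH1 IH2|h k IH1 IH2|c h IH] f.
- rewrite /hact !FockE; case: a => [i|[r rn]|[r rn]] /=; last 1 first.
  + by apply: Gam_psi; lia.
  + move: f; apply: linear_ext => [c a b|c a b|w].
    * by rewrite !linearP.
    * by rewrite !linearP.
    rewrite eM_delta Gam_delta; case wn: (lw w n).
      by rewrite linear0; case: ifP; rewrite ?Gam_delta ?wn ?linear0.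
    by rewrite eM_delta wres_setlast; case: ifP; rewrite ?Gam_delta ?wn ?linear0.
  + exact: Gam_y.
- by rewrite !hact0l linear0.
- by rewrite !hact1l.
- by rewrite !hactNl linearN IH.
- by rewrite !hactDl linearD IH1 IH2.
- by rewrite !hactM IH2 IH1.
- by rewrite !hactZl linearZ IH.
Qed.

End GamAction.

Lemma mem_kerE (R : pzRingType) (U V : lmodType R) (f : {linear U -> V}) x :
  (x \in ker f) <-> f x = 0.
Proof. by split=> [/eqP|/eqP]. Qed.

Lemma mem_imE (R : pzRingType) (U V : lmodType R) (f : {linear U -> V}) y :
  (y \in im f) <-> exists x, f x = y.
Proof. by split=> /asboolP. Qed.

Lemma mem_addE (R : pzRingType) (V : lmodType R) (N K : submodClosed V) x :
  (x \in add_sub N K) <-> exists2 y, y \in N & exists2 z, z \in K & x = y + z.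
Proof. by split=> /asboolP. Qed.

Section HookWord.
Variables (n m : nat).
Hypothesis mn : (m < n)%N.

(* The word A L^m A^(n-m-1) of v(2, ..., m+1). *)
Definition cword : word n := mkword n (fun p => (2 <= p <= m.+1)%N).

Lemma lw_cword p : (0 < p <= n)%N -> lw cword p = (2 <= p <= m.+1)%N.
Proof. exact: lw_mk. Qed.

Lemma cnt_cword p : (0 < p <= n.+1)%N -> cnt cword p = minn (p - 2) m.
Proof.
case: p => // p; elim: p => [|p IHp] pn; first by rewrite cnt1 min0n.
by rewrite cntS // IHp ?lw_cword //=; lia.
Qed.

Lemma weight_cword : weight cword = m.
Proof. by rewrite /weight cnt_cword //=; lia. Qed.

Lemma nodesc_cword : nodesc 2 n cword.
Proof. by move=> s sn; rewrite /desc !lw_cword; lia. Qed.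

End HookWord.

(** * Kernels and images in terms of words *)

Section Homs.
Variables (F : fieldType) (e n : nat) (kappa : 'Z_e * 'Z_e).
Hypotheses (e_ge3 : (3 <= e)%N) (kappa21 : kappa.2 = kappa.1 - 1) (n_gt0 : (0 < n)%N).
Hypothesis en : (e %| n)%N.
Local Notation H := (cycKLR F n kappa).
Local Notation vec := (vec F n).
Local Notation delta := (@delta F n).
Local Notation hact := (@hact F e n kappa e_ge3 kappa21 n_gt0).
Local Notation S := (S_bihook F n kappa).
Local Notation psi := (klr_psi F n kappa).
Local Notation Psi := (@Psi F e n kappa _).
Local Notation vword := (@vword F e n kappa).
Local Notation vfac := (@vfac F e n kappa).
Local Notation Phi := (@Phi F e n kappa e_ge3 kappa21 n_gt0).
Local Notation Gam := (@Gam F n).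
Local Notation down := (psi_down F n kappa).
Local Notation gamma := (gamma F n kappa).
Local Notation chi := (chi F n kappa).
Local Notation phi := (phi F n kappa).
Implicit Types (w u : word n) (f g : vec) (h k : H) (m : nat).

Definition vtab_prod m (a : seq nat) : H :=
  \prod_(1 <= j < m.+1) down (nth 0%N a j.-1 - 1)%N j.

(** Translates between products over the entries a_j and products over the positions of a word; the
    last entry n corresponds to the final L. *)
Lemma vtab_setlast m w (a : seq nat) : lw w n = false -> weight w = m -> size a = m ->
  vtab_prod m a = \prod_(1 <= p < n) vfac w p ->
  vtab F n kappa m.+1 (rcons a n) = vword m.+1 (setlast true w).
Proof.
move=> wn wm am Ea; have ws := weight_setlast n_gt0 true w.
rewrite wn wm addn0 addn1 in ws; rewrite /vtab /vword ws eqxx; congr (_ *: _).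
rewrite big_nat_recr //= [RHS]big_nat_recr //=; congr (_ * _).
  transitivity (vtab_prod m a).
    by apply: eq_big_nat => j jm; rewrite nth_rcons am; case: ltnP => //; lia.
  rewrite Ea; apply: eq_big_nat => p pn; rewrite /vfac lw_setlast // cnt_setlast ?ltn_eqF //; lia.
rewrite /vfac lw_setlast // eqxx cnt_setlast // nth_rcons am ltnn eqxx subn1.
by congr (down _ _.+1); move: wm; rewrite /weight cntS // wn addn0.
Qed.

Lemma vtab_gamma m : (m < n)%N ->
  vtab F n kappa m.+1 (rcons (iota 1 m) n) = vword m.+1 (setlast true (zword n m)).
Proof.
move=> mn; apply: vtab_setlast; rewrite ?size_iota ?weight_zword ?lw_zword //; try lia.
rewrite /vtab_prod !big1_seq // => [p|j]; rewrite mem_index_iota => jm.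
  rewrite /vfac lw_zword ?cnt_zword; try lia.
  by case: ifP => // pm; rewrite psi_down1 //; lia.
by rewrite psi_down1 // nth_iota; lia.
Qed.

Lemma prod_cword m N : (m.+2 <= N <= n.+1)%N -> (m < n)%N ->
  \prod_(1 <= p < N) vfac (cword n m) p = vtab_prod m (iota 2 m).
Proof.
move=> mN mn; rewrite big_ltn; last lia.
rewrite {1}/vfac lw_cword /=; last lia.
rewrite mul1r (big_cat_nat (n := m.+2)) //=; last by case/andP: mN.
rewrite [X in _ * X]big1_seq => [|p]; last first.
  by rewrite mem_index_iota /vfac => pm; rewrite lw_cword ?ifN //; lia.
rewrite mulr1 big_add1 /=; apply: eq_big_nat => j jm.
rewrite /vfac lw_cword ?cnt_cword ?ifT ?nth_iota; try lia.
by congr (down _ _); lia.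
Qed.

Lemma vtab_chi m : (m < n)%N -> vtab F n kappa m (iota 2 m) = vword m (cword n m).
Proof.
move=> mn; rewrite /vword weight_cword // eqxx; congr (_ *: _).
by rewrite prod_cword //; lia.
Qed.

Lemma vtab_phi m : (m.+1 < n)%N ->
  vtab F n kappa m.+1 (rcons (iota 2 m) n) = vword m.+1 (setlast true (cword n m)).
Proof.
move=> mn; apply: vtab_setlast; rewrite ?size_iota ?weight_cword ?prod_cword ?lw_cword //; lia.
Qed.

Lemma PhiE m x (h : H) : Phi m (h *: x) = hact h (Phi m x) :> vec.
Proof. exact: PhiZ. Qed.

(* The well-definedness of a homomorphism out of a presented module is checked in
   the Fock module, where Phi embeds its target. *)
Lemma cychom_Phi (P : H -> Prop) m (v : S m) (d : vec) : (m <= n)%N ->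
  Phi m v = d :> vec -> (forall h, P h -> hact h d = 0) ->
  forall h, Phi m (cychom P v (h *: cycgen P)) = hact h d :> vec.
Proof.
move=> mn vd Pd h; rewrite linearZ /= cychomE ?PhiE ?vd // => k Pk.
by apply: (@Phi_inj F e n kappa e_ge3 kappa21 n_gt0 m mn); rewrite PhiE vd Pd // linear0.
Qed.

Lemma Phi_gamma m x : (m < n)%N -> Phi m.+1 (gamma m x) = Gam (Phi m x) :> vec.
Proof.
move=> mn; have [h ->] := cycgenP x; rewrite PhiE -hact_Gam // [Phi m _]Phi_z; last lia.
have zn : lw (zword n m) n = false by rewrite lw_zword; lia.
have zw : weight (setlast true (zword n m)) = m.+1.
  by have := weight_setlast n_gt0 true (zword n m); rewrite zn weight_zword; lia.
apply: cychom_Phi => // [|k Pk]; rewrite Gam_delta zn.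
  by rewrite vtab_gamma // Phi_vword.
have := hact_Gam e_ge3 kappa21 n_gt0 en k (delta (zword n m)).
by rewrite Gam_delta zn => ->; rewrite (zword_rel _ _ _ _ Pk) ?linear0 //; lia.
Qed.

Definition first_A w : bool := ~~ lw w 1.
Definition last_L w : bool := lw w n.

Lemma supp_first h f : supp first_A f -> supp first_A (hact h f).
Proof.
apply: supp_hact => r w sg u rn E; rewrite /first_A => w1.
  have [r0 _] := andP rn; have [as_|as_] := boolP (asc w r).
    move: E; rewrite act_psi_asc // => -[_ <-].
    have r1 : r != 1%N by apply/eqP => r1; case/andP: as_; rewrite r1 (negPf w1).
    by rewrite lw_swp ?tr_out //; lia.
  have [i [j [[ij jn _ _ ->] i1 _]]] := act_psi_nasc r0 as_ E.
  by have := i1 e_ge3; rewrite lw_swp ?tr_out //; lia.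
have [r0 _] := andP rn; have [q [qn _ -> /andP[eq _]]] := act_y r0 E.
have q3 : (3 <= q)%N by apply: leq_trans e_ge3 (dvdn_leq _ eq); lia.
by rewrite lw_swp ?tr_out //; lia.
Qed.

(* The word A L^d A L^(m-d) A ... reached from A L^m A ... after applying
   psi_(m+1), psi_m, ..., psi_(d+2). *)
Definition garnir_word m (d : nat) : word n :=
  mkword n (fun p => (2 <= p <= m.+2)%N && (p != d.+2)).

Lemma garnir_step m j : (m.+2 <= n)%N -> (j <= m)%N ->
  hact (\prod_(m.+2 - j <= r < m.+2) psi r) (delta (cword n m)) = delta (garnir_word m (m - j)).
Proof.
move=> mn; elim: j => [|j IHj] jm.
  rewrite subn0 big_geq // hact1l; congr delta; apply: eq_word => p pn.
  by rewrite subn0 lw_cword // lw_mk //; lia.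
rewrite big_ltn; last lia.
have -> : (m.+2 - j.+1).+1 = (m.+2 - j)%N by lia.
rewrite hactM IHj; last lia.
have as_ : asc (garnir_word m (m - j)) (m.+2 - j.+1) by rewrite /asc !lw_mk; lia.
have sn : (0 < m.+2 - j.+1 < n)%N by lia.
rewrite hact_psi_asc //; congr delta; apply: eq_word => p pn.
rewrite lw_swp; try lia.
have [p1|p1] := eqVneq p (m.+2 - j.+1)%N.
  by rewrite p1 tr_l !lw_mk; lia.
have [p2|p2] := eqVneq p (m.+2 - j.+1).+1.
  by rewrite p2 tr_r !lw_mk; lia.
by rewrite tr_out // !lw_mk; lia.
Qed.

(** From position 2 on, no A precedes an L in this word, and exchanges off ascents never involve
    position 1. *)
Lemma cword_rel m h : (m < n)%N -> hook_rel m h -> hact h (delta (cword n m)) = 0.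
Proof.
move=> mn; have n3 := nge3 e_ge3 n_gt0 en.
have nd := nodesc_cword mn.
have psi0 r : (0 < r < n)%N -> r != m.+1 -> hact (psi r) (delta (cword n m)) = 0.
  move=> rn rm; have ar : ~~ asc (cword n m) r by rewrite /asc !lw_cword; lia.
  rewrite hact_psi // opM_delta; case E: (act _ _) => [[sg u]|] //.
  have [r0 _] := andP rn.
  have [i [j [[ij jn wi wj _] i1 _]]] := act_psi_nasc r0 ar E.
  by case/negP: wi; apply: (nodesc_mono nd _ _ wj); have := i1 e_ge3; lia.
case=> {h} [|r rn|r rn rm|mn2].
- rewrite hactDl hactNl hact1l (_ : res_hook n kappa m = wres kappa (cword n m)).
    by rewrite hact_wres subrr.
  apply: eq_mi => r rn; rewrite !ent_mi_of // (residE kappa21); last lia.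
  rewrite lw_cword // cnt_cword //; last lia.
  have [rm|rm] := leqP r m.+1; last first.
    rewrite ifN; last lia.
    have -> : minn (r - 2) m = m by lia.
    have -> : r%:R = (r - m - 1)%:R + m%:R + 1 :> 'Z_e.
      by rewrite -natrD natr1; congr _%:R; lia.
    by ring.
  have [r1|r1] := eqVneq r 1%N; first by rewrite r1 subnn (_ : 1 - 2 = 0)%N // min0n /=; ring.
  rewrite ifT; last lia.
  have -> : minn (r - 2) m = (r - 2)%N by lia.
  have -> : (r - 1)%:R = (r - 2)%:R + 1 :> 'Z_e by rewrite natr1; congr _%:R; lia.
  by ring.
- rewrite hact_y // opM_delta; case E: (act _ _) => [[sg u]|] //.
  have [r0 _] := andP rn; have [q [qn dq _ /andP[eq _]]] := act_y r0 E.
  have q3 : (3 <= q)%N by apply: leq_trans e_ge3 (dvdn_leq _ eq); lia.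
  by case/negP: (nd q ltac:(lia)).
- by apply: psi0 => //; lia.
(* The factors psi_2, ..., psi_(m+1) lead to A A L^m A ... A. There psi_1, of class C1, reads L A A
   including the sentinel, and gives 0. *)
- rewrite big_ltn // hactM (_ : 2 = m.+2 - m)%N; last lia.
  rewrite garnir_step // subnn hact_psi; last lia.
  have c1 : cls e 1 = C1 by apply/eqP; rewrite clsP.
  by rewrite opM_delta /act /psi_op c1 /= lw_mk.
Qed.

Lemma Phi_chi m h : (m < n)%N ->
  Phi m (chi m (h *: z_hook F n kappa m)) = hact h (delta (cword n m)) :> vec.
Proof.
move=> mn; apply: cychom_Phi; first lia.
  by rewrite vtab_chi // Phi_vword ?weight_cword //; lia.
by move=> k; apply: cword_rel.
Qed.

Lemma Phi_phi m h : (m.+1 < n)%N ->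
  Phi m.+1 (phi m.+1 (h *: z_hook F n kappa m)) =
  Phi m.+1 (gamma m (chi m (h *: z_hook F n kappa m))) :> vec.
Proof.
move=> mn; have mn' : (m < n)%N by lia.
have cn : lw (cword n m) n = false by rewrite lw_cword; lia.
have cw : weight (setlast true (cword n m)) = m.+1.
  by have := weight_setlast n_gt0 true (cword n m); rewrite cn weight_cword; lia.
rewrite Phi_gamma // Phi_chi // -hact_Gam // Gam_delta cn; apply: cychom_Phi => //.
  by rewrite /= vtab_phi // Phi_vword.
move=> k Pk; have := hact_Gam e_ge3 kappa21 n_gt0 en k (delta (cword n m)).
by rewrite Gam_delta cn => ->; rewrite (cword_rel _ Pk) ?linear0 //; lia.
Qed.

(** Both maps send the generator to the word A L^m A^(n-m-2) L. All facts about phi are reduced to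
    gamma and chi in this way. *)
Lemma phiE m x : (m.+1 < n)%N -> phi m.+1 x = gamma m (chi m x).
Proof.
move=> mn; have [h ->] := cycgenP x.
apply: (@Phi_inj F e n kappa e_ge3 kappa21 n_gt0 m.+1); first lia.
exact: Phi_phi.
Qed.

Lemma Phi_ind m (Q : pred (word n)) (N : submodClosed (S m)) x : (m <= n)%N ->
  (forall w, weight w = m -> Q w -> vword m w \in N) -> supp Q (Phi m x) -> x \in N.
Proof.
move=> mn Nw Qx; rewrite -(PhiK e_ge3 kappa21 n_gt0 mn x).
apply: (supp_ind (Q := fun w => Q w && (weight w == m))
  (T := fun f => (Psi f : S m) \in N)).
- by rewrite Psi0 rpred0.
- by move=> a b Na Nb; rewrite PsiD rpredD.
- by move=> c a Na; rewrite PsiZ rpredZ.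
- by move=> w /andP[Qw /eqP wm]; rewrite Psi_delta; apply: Nw.
- move=> w; rewrite negb_and => /orP[/Qx //|wm].
  by rewrite (Phi_weight e_ge3 kappa21 n_gt0 mn).
Qed.

Lemma mem_ker_gamma m x : (m < n)%N -> (x \in ker (gamma m)) <-> supp last_L (Phi m x).
Proof.
move=> mn; rewrite -Gam_eq0 // -Phi_gamma // mem_kerE.
by apply: iff_sym; apply: (Phi_eq0 e_ge3 kappa21 n_gt0 mn).
Qed.

Lemma gamma_vword m w : (m < n)%N -> weight w = m.+1 -> lw w n ->
  weight (setlast false w) = m /\ gamma m (vword m (setlast false w)) = vword m.+1 w.
Proof.
move=> mn wm wn; have ws : weight (setlast false w) = m.
  by have := weight_setlast n_gt0 false w; rewrite wn wm; lia.
split=> //; apply: (@Phi_inj F e n kappa e_ge3 kappa21 n_gt0 m.+1) => //.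
rewrite Phi_gamma // !Phi_vword //; last lia.
by rewrite Gam_delta lw_setlast // eqxx setlastK // setlast_id.
Qed.

Lemma mem_im_gamma m x : (m < n)%N -> (x \in im (gamma m)) <-> supp last_L (Phi m.+1 x).
Proof.
move=> mn; split=> [/mem_imE[u <-]|Qx]; first by rewrite Phi_gamma //; exact: Gam_supp.
apply: (Phi_ind _ _ Qx) => // w wm wl; apply/mem_imE.
by have [_ <-] := gamma_vword mn wm wl; eexists.
Qed.

(** Sorting only positions 2 to n keeps the first A and ends at the word of chi_m(z), from which
    ascents lead back to [w]. *)
Lemma vword_im_chi m w : (m < n)%N -> weight w = m -> first_A w -> vword m w \in im (chi m).
Proof.
move=> mn; have [u [uS uo uw up _]] := sort_word (leqnSn 1) (leqnn n) w.
have := up (fun v => weight v = m -> first_A v -> vword m v \in im (chi m)).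
apply=> [v s sn as_ IH vm v1|um u1].
  have sn' : (0 < s < n)%N by lia.
  rewrite -psi_vword //; last lia.
  apply: rpredZ; apply: IH; first by rewrite -vm weight_swp //; lia.
  by move: v1; rewrite /first_A lw_swp ?tr_out //; lia.
have -> : u = cword n m.
  apply: (nodesc_uniq (lo := 2) (hi := n)) => //; first exact: nodesc_cword.
    move=> p pn p1; have -> : p = 1%N by lia.
    by rewrite lw_cword ?(negPf u1) //; lia.
  by rewrite um weight_cword.
apply/mem_imE; exists (z_hook F n kappa m).
apply: (@Phi_inj F e n kappa e_ge3 kappa21 n_gt0 m); first lia.
rewrite -[z_hook F n kappa m]scale1r Phi_chi // hact1l Phi_vword ?weight_cword //; lia.
Qed.

Lemma mem_im_chi m x : (m < n)%N -> (x \in im (chi m)) <-> supp first_A (Phi m x).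
Proof.
move=> mn; split=> [/mem_imE[u <-]|Qx].
  have [h ->] := cycgenP u; rewrite Phi_chi //; apply/supp_first/supp_delta.
  by rewrite /first_A lw_cword //; lia.
by apply: (Phi_ind _ _ Qx); [lia|move=> w; exact: vword_im_chi].
Qed.

Lemma mem_im_phi m x : (m.+1 < n)%N ->
  (x \in im (phi m.+1)) <-> supp (predI first_A last_L) (Phi m.+1 x).
Proof.
move=> mn; have mn' : (m < n)%N by lia.
split=> [/mem_imE[u <-]|Qx].
  rewrite phiE // Phi_gamma // => w /=; rewrite negb_and => /orP[w1|wl]; last exact: Gam_supp.
  have [wn|] := boolP (lw w n); last exact: Gam_supp.
  (* The coefficient of [w] in the image of [Gam] is that of [w] with its last letter replaced by A;
     position 1 is unaffected since n >= 3. *)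
  rewrite -(setlast_id n_gt0 wn) -(setlastK n_gt0 false true) // Gam_coef ?lw_setlast ?eqxx //.
  have Su : supp first_A (Phi m (chi m u)) by apply/mem_im_chi => //; apply/mem_imE; exists u.
  apply: Su; move: w1; rewrite /first_A lw_setlast // ifN //.
  by have := nge3 e_ge3 n_gt0 en; lia.
apply: (Phi_ind _ _ Qx) => // w wm /andP[w1 wl].
have [ws <-] := gamma_vword mn' wm wl.
have : vword m (setlast false w) \in im (chi m).
  apply: vword_im_chi => //; rewrite /first_A lw_setlast // ifN //.
  by have := nge3 e_ge3 n_gt0 en; lia.
by move=> /mem_imE[u <-]; apply/mem_imE; exists u; rewrite phiE.
Qed.

End Homs.

(** * Simplicity of the sections *)

Section Subquotients.
Variables (R : pzRingType) (V : lmodType R).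
Implicit Types N K : submodClosed V.

Lemma pi_subquot_eq0 N K (x : submod N) :
  (pi_quotmod (restr_sub N K) x = 0) <-> val x \in K.
Proof.
rewrite -(linear0 (pi_quotmod (restr_sub N K))).
by split=> [/pi_quotmodP|xK]; [|apply/pi_quotmodP]; rewrite subr0.
Qed.

Section Pullback.
Variables (N K : submodClosed V) (L : submodClosed (subquot N K)).

Definition pull_pred : {pred V} :=
  fun x => `[< exists2 y : submod N, val y = x & pi_quotmod (restr_sub N K) y \in L >].
Lemma pull_pred_closed : GRing.subsemimod_closed pull_pred.
Proof.
split; first split.
- by apply/asboolP; exists 0; rewrite ?linear0 ?rpred0.
- move=> _ _ /asboolP[x <- Lx] /asboolP[y <- Ly]; apply/asboolP.
  by exists (x + y); rewrite ?linearD ?rpredD.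
- move=> a _ /asboolP[x <- Lx]; apply/asboolP; exists (a *: x) => //.
  by rewrite linearZ rpredZ.
Qed.
HB.instance Definition _ := GRing.isSubmodClosed.Build R V pull_pred pull_pred_closed.
Definition pull : submodClosed V := pull_pred.

End Pullback.

(** By the correspondence of submodules it suffices to consider the submodules of [V] between [K]
    and [N], so cosets no longer appear. *)
Lemma simple_subquot N K : {subset K <= N} -> (exists2 x, x \in N & x \notin K) ->
  (forall T : submodClosed V, {subset K <= T} -> {subset T <= N} ->
     (exists2 x, x \in T & x \notin K) -> {subset N <= T}) ->
  simple_module (subquot N K).
Proof.
move=> KN [x Nx Kx] max; split.
  exists (pi_quotmod (restr_sub N K) (Sub x Nx)); apply/eqP => /pi_subquot_eq0.
  by rewrite SubK (negPf Kx).
move=> L; have [L0|] := pselect (forall u, u \in L -> u = 0); first by left.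
move=> /existsNP[u /not_implyP[Lu u0]]; right=> v.
have pullE (y : submod N) : (val y \in pull L) <-> pi_quotmod (restr_sub N K) y \in L.
  split=> [/asboolP[y' /val_inj-> //]|Ly]; by apply/asboolP; exists y.
rewrite -[v]pi_quotmodK; apply/pullE/max; last exact: valP.
- move=> y Ky; apply/asboolP; exists (Sub y (KN _ Ky)) => //.
  by rewrite (proj2 (pi_subquot_eq0 _ _)) ?rpred0 ?SubK.
- by move=> y /asboolP[y' <- _]; exact: valP.
- exists (val (repr u)); first by apply/pullE; rewrite pi_quotmodK.
  by apply/negP => /pi_subquot_eq0; rewrite pi_quotmodK.
Qed.

End Subquotients.

Section Letters.
Variable n : nat.
Implicit Types (w : word n).

Lemma act_psi_P e w r : (3 <= e)%N -> (e %| r)%N -> ~~ lw w r -> lw w r.+2 ->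
  act (psi_op e r.+1) w = Some (~~ lw w r.+1, swp r r.+2 w).
Proof.
move=> e3 er wr wr2; have c : cls e r.+1 = C1 by apply/eqP; rewrite clsP.
by rewrite /act /psi_op c /psi_shift /= !addn0 wr wr2 andbF /= addn0 addn2.
Qed.

Lemma act_psi_M e w r : (3 <= e)%N -> (0 < r)%N -> (e %| r.+1)%N -> ~~ lw w r ->
  lw w r.+2 -> act (psi_op e r) w = Some (~~ lw w r.+1, swp r r.+2 w).
Proof.
move=> e3 r0 er wr wr2; have c : cls e r = Cm1 by apply/eqP; rewrite clsM.
have Er : (r.-1 + 1)%N = r by lia.
by rewrite /act /psi_op c /psi_shift Er /= (negPf wr) wr2 /= addn0 addn2.
Qed.

Lemma act_psi_O e w r : (0 < r)%N -> cls e r = Cgen -> desc w r ->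
  act (psi_op e r) w = Some (false, swp r r.+1 w).
Proof.
move=> r0 c /andP[/negPf wr wr1]; have Er : (r.-1 + 1)%N = r by lia.
by rewrite /act /psi_op c /psi_shift Er /= wr wr1 /= addn0 addn1.
Qed.

Lemma act_y_Z e w r : (0 < r)%N -> (e %| r)%N ->
  act (y_op e r) w = if desc w r then Some (true, swp r r.+1 w) else None.
Proof.
move=> r0 er; have c : cls e r = C0 by apply/eqP; rewrite clsZ.
have Er : (r.-1 + 1)%N = r by lia.
by rewrite /act /y_op c /psi_shift Er /= -/(desc w r); case: ifP => //; rewrite addn0 addn1.
Qed.

(** In this and the next three identities two of the three letters agree, so an exchange at distance
    two and an adjacent one compose to the other adjacent exchange. *)
Lemma swp_outer_l w r : (0 < r)%N -> (r.+2 <= n)%N -> lw w r = lw w r.+1 ->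
  swp r r.+1 (swp r r.+2 w) = swp r.+1 r.+2 w.
Proof.
move=> r0 rn wr; have [b0 [b1 b2]] : (0 < r <= n /\ 0 < r.+1 <= n /\ 0 < r.+2 <= n)%N by lia.
apply: eq_word => p pn; rewrite !lw_swp //; rewrite /tr.
by do !case: eqP => //; move=> *; subst; try lia; congruence.
Qed.

Lemma swp_outer_lr w r : (0 < r)%N -> (r.+2 <= n)%N -> lw w r = lw w r.+2 ->
  swp r r.+2 (swp r r.+1 w) = swp r.+1 r.+2 w.
Proof.
move=> r0 rn wr; have [b0 [b1 b2]] : (0 < r <= n /\ 0 < r.+1 <= n /\ 0 < r.+2 <= n)%N by lia.
apply: eq_word => p pn; rewrite !lw_swp //; rewrite /tr.
by do !case: eqP => //; move=> *; subst; try lia; congruence.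
Qed.

Lemma swp_outer_r w r : (0 < r)%N -> (r.+2 <= n)%N -> lw w r.+1 = lw w r.+2 ->
  swp r.+1 r.+2 (swp r r.+2 w) = swp r r.+1 w.
Proof.
move=> r0 rn wr; have [b0 [b1 b2]] : (0 < r <= n /\ 0 < r.+1 <= n /\ 0 < r.+2 <= n)%N by lia.
apply: eq_word => p pn; rewrite !lw_swp //; rewrite /tr.
by do !case: eqP => //; move=> *; subst; try lia; congruence.
Qed.

Lemma swp_outer_rl w r : (0 < r)%N -> (r.+2 <= n)%N -> lw w r = lw w r.+2 ->
  swp r r.+2 (swp r.+1 r.+2 w) = swp r r.+1 w.
Proof.
move=> r0 rn wr; have [b0 [b1 b2]] : (0 < r <= n /\ 0 < r.+1 <= n /\ 0 < r.+2 <= n)%N by lia.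
apply: eq_word => p pn; rewrite !lw_swp //; rewrite /tr.
by do !case: eqP => //; move=> *; subst; try lia; congruence.
Qed.

End Letters.

(** * Words with prescribed end letters *)

Section Simplicity.
Variables (F : fieldType) (e n : nat) (kappa : 'Z_e * 'Z_e).
Hypotheses (e_ge3 : (3 <= e)%N) (kappa21 : kappa.2 = kappa.1 - 1) (n_gt0 : (0 < n)%N).
Hypothesis en : (e %| n)%N.
Local Notation vec := (vec F n).
Local Notation delta := (@delta F n).
Local Notation hact := (@hact F e n kappa e_ge3 kappa21 n_gt0).
Local Notation psi := (klr_psi F n kappa).
Local Notation y := (klr_y F n kappa).
Local Notation ee := (klr_e F kappa).
Local Notation wres := (@wres e n kappa).
Implicit Types (w u : word n) (f g : vec).

Lemma eM_coef i f u : eM kappa i f u = if wres u == i then f u else 0.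
Proof.
rewrite /eM /lext sum_ffunE (bigD1 u) //= big1 => [|w wu].
  by rewrite addr0; case: ifP => _; rewrite !ffunE ?eqxx ?scaler0 // /GRing.scale /= mulr1.
by case: ifP => _; rewrite !ffunE ?scaler0 // eq_sym (negPf wu) scaler0.
Qed.

Lemma opM_y_coef q f u : (0 < q < n)%N -> (e %| q)%N ->
  opM (y_op e q) f u = if asc u q then - f (swp q q.+1 u) else 0.
Proof.
move=> qn eq; have [q0 qn'] := andP qn.
have [b0 b1] : (0 < q <= n)%N /\ (0 < q.+1 <= n)%N by lia.
rewrite /opM /lext sum_ffunE (bigD1 (swp q q.+1 u)) //= big1 => [|w wu].
  rewrite addr0 act_y_Z //; case: ifP => du.
    have as_ : asc u q by rewrite -(swpK b0 b1 u); exact: asc_swp.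
    by rewrite as_ /= !ffunE swpK // eqxx /GRing.scale /= expr1 mulr1 mulrN1.
  rewrite /= scaler0 ffunE; case: ifP => // as_.
  by rewrite desc_swp in du.
rewrite act_y_Z //; case: ifP => dw; rewrite !ffunE ?scaler0 //.
case: eqP => [E|_]; last by rewrite !scaler0.
by rewrite E swpK // eqxx in wu.
Qed.

(** Take q to be the first position where the words differ. Equal counts of L's before q make the
    residues there differ by q, so e divides q; equal weights give q < n; and equal residues in
    position q + 1 force the letters there to differ the opposite way. *)
Lemma same_residues w1 w2 : wres w1 = wres w2 -> weight w1 = weight w2 -> w1 <> w2 ->
  exists q, [/\ (e %| q)%N, (0 < q < n)%N &
    (desc w1 q && asc w2 q) || (asc w1 q && desc w2 q)].
Proof.
move=> res wt ne.
have [p0 Hp0] : exists p, lw w1 p != lw w2 p.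
  apply: contrapT => E; apply: ne; apply: eq_word => p _.
  by apply/eqP; apply: contraT => ne; case: E; exists p.
have [p Hp pmin] := ex_minnP (ex_intro _ p0 Hp0 : exists p, lw w1 p != lw w2 p).
have p_gt0 : (0 < p)%N by case: (p) Hp.
have p_n : (p <= n)%N by rewrite leqNgt; apply: contra Hp => np; rewrite !lw_out.
have E q : (0 < q < p)%N -> lw w1 q = lw w2 q.
  move=> qp; apply/eqP; apply: contraT => /pmin; lia.
have cE : cnt w1 p = cnt w2 p by exact: eq_cnt.
have rE q : (0 < q <= n)%N -> resid kappa w1 q = resid kappa w2 q.
  by move=> qn; rewrite -!ent_wres // res.
have ep : p%:R = 0 :> 'Z_e.
  have := rE p; rewrite p_gt0 p_n !(residE kappa21) // cE => /(_ isT)/addrI.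
  by move: Hp; case: (lw w1 p); case: (lw w2 p).
have pn : (p < n)%N.
  rewrite ltn_neqAle p_n andbT; apply/eqP => pn; move: wt cE Hp; rewrite pn.
  rewrite /weight !cntS // => wt' cn Hn; move: wt'; rewrite cn => /addnI.
  by move: Hn; case: (lw w1 n); case: (lw w2 n).
exists p; rewrite -natZ_eq0 // ep eqxx p_gt0 pn; split=> //.
have not1 : (1 == 0 :> 'Z_e) = false.
  by rewrite -[1]/(1%:R) natZ_eq0 // gtnNdvd //; lia.
have not2 : (2%:R == 0 :> 'Z_e) = false by rewrite natZ_eq0 // gtnNdvd //; lia.
have := rE p.+1; rewrite pn !(residE kappa21) // !cntS // cE => /(_ isT)/eqP.
rewrite -subr_eq0 -natr1 ep add0r /desc /asc; move: Hp.
case: (lw w1 p); case: (lw w2 p) => // _; case: (lw w1 p.+1); case: (lw w2 p.+1) => //=.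
- rewrite (_ : _ - _ = - 1); last by ring.
  by rewrite oppr_eq0 not1.
- rewrite (_ : _ - _ = - 2%:R); last by ring.
  by rewrite oppr_eq0 not2.
- rewrite (_ : _ - _ = - 1); last by ring.
  by rewrite oppr_eq0 not1.
- rewrite (_ : _ - _ = 1); last by ring.
  by rewrite not1.
- rewrite (_ : _ - _ = 2%:R); last by ring.
  by rewrite not2.
- rewrite (_ : _ - _ = 1); last by ring.
  by rewrite not1.
Qed.

Variables (m : nat) (a b : bool).

Definition with_ends w : bool := [&& lw w 1 == a, lw w n == b & weight w == m].

Variable T : vec -> Prop.
Hypotheses (TZ : forall c f, T f -> T (c *: f)) (Tfact : forall h f, T f -> T (hact h f)).

Lemma ends_swp w i j : (1 < i)%N -> (i < j < n)%N -> with_ends (swp i j w) = with_ends w.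
Proof.
move=> i1 ij; have n3 := nge3 e_ge3 n_gt0 en; rewrite /with_ends weight_swp; try lia.
by rewrite !lw_swp ?tr_out //; lia.
Qed.

Lemma inner_special q : (0 < q < n)%N -> (e %| q)%N -> (1 < q)%N /\ (q < q.+1 < n)%N.
Proof.
move=> qn eq; have [q0 qn'] := andP qn; have := leq_trans e_ge3 (dvdn_leq q0 eq).
have := @dvdn_last e n e_ge3 en q 1; rewrite eq => H1.
have : (q + 1)%N <> n by move=> /H1 /(_ isT).
lia.
Qed.

(* A vector of T with the smallest support is a multiple of a single word: two
   words of its support are separated by some e(i) or by some y_q. *)
Lemma ends_pick f : T f -> supp with_ends f -> f != 0 ->
  exists2 w, with_ends w & T (delta w).
Proof.
have [k] := ubnP #|[set w | f w != 0]|; elim: k f => // k IHk f fk Tf Sf f0.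
have [w1 fw1] : exists w, f w != 0.
  apply: contrapT => E; case/eqP: f0; apply/ffunP => w; rewrite ffunE.
  by apply/eqP; apply: contraT => fw; case: E; exists w.
have sw1 : with_ends w1 by apply: contraT => /Sf /eqP; rewrite (negPf fw1).
have [[w2 [fw2 w21]]|single] := pselect (exists w2, f w2 != 0 /\ w2 <> w1); last first.
  exists w1 => //; have -> : delta w1 = (f w1)^-1 *: f.
    apply/ffunP => u; rewrite !ffunE; case: eqP => [->|uw].
      by rewrite /GRing.scale /= mulVf.
    have -> : f u = 0 by apply/eqP; apply: contraT => fu; case: single; exists u.
    by rewrite scaler0.
  exact: TZ.
have sw2 : with_ends w2 by apply: contraT => /Sf /eqP; rewrite (negPf fw2).
have [res|res] := eqVneq (wres w1) (wres w2); last first.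
  (* The idempotent of the residues of [w1] keeps [w1] and removes [w2]. *)
  apply: (IHk (hact (ee (wres w1)) f)) => //; first last.
  - by apply/eqP => /ffunP/(_ w1)/eqP; rewrite hact_e eM_coef eqxx ffunE (negPf fw1).
  - by move=> u /Sf fu; rewrite hact_e eM_coef fu if_same.
  - exact: Tfact.
  rewrite ltnS in fk; apply: leq_trans fk; apply: proper_card; apply/properP; split.
    by apply/subsetP => u; rewrite !inE hact_e eM_coef; case: ifP; rewrite ?eqxx.
  by exists w2; rewrite !inE ?fw2 // hact_e eM_coef [wres w2 == _]eq_sym (negPf res) eqxx.
have [q [eq qn dq]] : exists q, [/\ (e %| q)%N, (0 < q < n)%N &
    (desc w1 q && asc w2 q) || (asc w1 q && desc w2 q)].
  apply: same_residues => //; last by move=> E; apply: w21.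
  by case/and3P: sw1 => _ _ /eqP->; case/and3P: sw2 => _ _ /eqP->.
have [v1 [v2 [fv1 dv1 fv2 av2]]] : exists v1 v2, [/\ f v1 != 0, desc v1 q, f v2 != 0 & asc v2 q].
  by case/orP: dq => /andP[d1 d2]; [exists w1, w2|exists w2, w1].
have [q1 q2] := inner_special qn eq; have [q0 qn'] := andP qn.
have b0 : (0 < q <= n)%N by rewrite q0 ltnW.
have b1 : (0 < q.+1 <= n)%N by [].
have gE u : hact (y q) f u = if asc u q then - f (swp q q.+1 u) else 0.
  by rewrite hact_y // opM_y_coef.
(* y_q turns descents at q into ascents injectively and kills all other words: [v1] survives and
   [v2] is lost, so the support shrinks but stays nonempty. *)
apply: (IHk (hact (y q) f)) => //; first last.
- apply/eqP => /ffunP/(_ (swp q q.+1 v1))/eqP.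
  by rewrite gE asc_swp // swpK // ffunE oppr_eq0 (negPf fv1).
- move=> u su; rewrite gE; case: ifP => // _; rewrite Sf ?oppr0 //.
  by rewrite ends_swp.
- exact: Tfact.
rewrite ltnS in fk; apply: leq_trans fk.
rewrite -(card_imset _ (inv_inj (swpK b0 b1))); apply: proper_card; apply/properP; split.
  apply/subsetP => _ /imsetP[u + ->]; rewrite !inE gE; case: ifP; rewrite ?eqxx //.
  by rewrite oppr_eq0.
exists v2; rewrite ?inE //; apply/negP => /imsetP[u + v2u]; rewrite inE gE.
case: ifP; rewrite ?eqxx // => au _.
have := desc_swp qn au; rewrite -v2u => /andP[/negPf d1 _].
by case/andP: av2; rewrite d1.
Qed.

Lemma T_psi r w sg u : (0 < r < n)%N -> act (psi_op e r) w = Some (sg, u) ->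
  T (delta w) -> T (delta u).
Proof.
move=> rn E /(Tfact (psi r)); rewrite hact_psi // opM_delta E /= => /(TZ ((-1) ^+ sg)).
by rewrite scalerA -expr2 sqrr_sign scale1r.
Qed.

Lemma T_y r w sg u : (0 < r <= n)%N -> act (y_op e r) w = Some (sg, u) ->
  T (delta w) -> T (delta u).
Proof.
move=> rn E /(Tfact (y r)); rewrite hact_y // opM_delta E /= => /(TZ ((-1) ^+ sg)).
by rewrite scalerA -expr2 sqrr_sign scale1r.
Qed.

Lemma T_asc w r : (0 < r < n)%N -> asc w r -> T (delta w) -> T (delta (swp r r.+1 w)).
Proof. by move=> rn as_; apply: (T_psi rn (sg := false)); rewrite act_psi_asc //; lia. Qed.

(** Reverses an inner ascent. Class C0 uses y_r and class Cgen uses psi_r directly; classes C1 and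
    Cm1 take a detour through the neighbouring third letter. *)
Lemma T_desc w r : (1 < r)%N -> (r.+1 < n)%N -> desc w r -> T (delta w) ->
  T (delta (swp r r.+1 w)).
Proof.
case: r => // r r0 rn dw Tw; have [wr wr1] := andP dw.
have [b0 [b1 [b2 b3]]] :
  (0 < r <= n /\ 0 < r.+1 <= n /\ 0 < r.+2 <= n /\ 0 < r.+3 <= n)%N by lia.
have [c0 [c1 c2]] : (0 < r < n /\ 0 < r.+1 < n /\ 0 < r.+2 < n)%N by lia.
case c: (cls e r.+1).
- have er : (e %| r.+1)%N by rewrite -clsZ c.
  by apply: (T_y b1 (sg := true)) Tw; rewrite act_y_Z // dw.
- have er : (e %| r)%N by rewrite -[r]/(r.+1.-1) -clsP // c.
  case wr0: (lw w r).
    (* In positions r to r + 2: L A L, then A L L, then L L A. *)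
    have T1 : T (delta (swp r r.+1 w)) by apply: T_asc => //; rewrite /asc wr0 wr.
    rewrite -swp_outer_lr ?wr0 ?wr1 //.
    have v0 : ~~ lw (swp r r.+1 w) r by rewrite lw_swp ?tr_l //; lia.
    have v2 : lw (swp r r.+1 w) r.+2 by rewrite lw_swp ?tr_out //; lia.
    exact: (T_psi c1 (act_psi_P e_ge3 er v0 v2) T1).
  (* In positions r to r + 2: A A L, then L A A, then A L A. *)
  have T1 : T (delta (swp r r.+2 w)).
    by apply: (T_psi c1 _ Tw); rewrite act_psi_P ?wr0.
  rewrite -swp_outer_l ?wr0 ?(negPf wr) //; try lia.
  apply: T_asc T1 => //.
  by rewrite /asc !lw_swp // tr_l tr_out ?wr1 //; lia.
- have er : (e %| r.+2)%N by rewrite -clsM // c.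
  case wr3: (lw w r.+3).
    (* In positions r + 1 to r + 3: A L L, then L L A, then L A L. *)
    have T1 : T (delta (swp r.+1 r.+3 w)).
      by apply: (T_psi c1 _ Tw); rewrite act_psi_M ?wr3.
    rewrite -swp_outer_r ?wr1 ?wr3 //; try lia.
    apply: T_asc T1 => //.
    by rewrite /asc !lw_swp // tr_r tr_out ?wr1 ?(negPf wr) //; lia.
  (* In positions r + 1 to r + 3: A L A, then A A L, then L A A. *)
  have T1 : T (delta (swp r.+2 r.+3 w)) by apply: T_asc => //; rewrite /asc wr1 wr3.
  rewrite -swp_outer_rl ?(negPf wr) ?wr3 //; try lia.
  have v1 : ~~ lw (swp r.+2 r.+3 w) r.+1 by rewrite lw_swp ?tr_out //; lia.
  have v3 : lw (swp r.+2 r.+3 w) r.+3 by rewrite lw_swp ?tr_r.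
  exact: (T_psi c1 (act_psi_M e_ge3 (ltn0Sn r) er v1 v3) T1).
- by apply: (T_psi c1 (sg := false)) Tw; rewrite act_psi_O.
Qed.

(** Descents sort the inner letters of [w1] and ascents rebuild [w]; the sorted words coincide
    because the end letters and the weights do. *)
Lemma ends_all w1 w : with_ends w1 -> with_ends w -> T (delta w1) -> T (delta w).
Proof.
move=> s1 s2 T1; have n3 := nge3 e_ge3 n_gt0 en.
have nn : (n.-1 <= n)%N by lia.
have [u1 [uS1 uo1 uw1 _ down1]] := sort_word (leqnSn 1) nn w1.
have [u2 [uS2 uo2 uw2 up2 _]] := sort_word (leqnSn 1) nn w.
case/and3P: s1 => /eqP a1 /eqP b1 /eqP m1; case/and3P: s2 => /eqP a2 /eqP b2 /eqP m2.
have Tu1 : T (delta u1).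
  apply: (down1 (fun v => T (delta v))) => // v s sn dv; apply: T_desc => //; lia.
apply: (up2 (fun v => T (delta v))) => [v s sn as_|]; first by apply: T_asc => //; lia.
rewrite -(nodesc_uniq (lo := 2) (hi := n.-1) _ _ uS1 uS2) //; last by rewrite uw1 uw2 m1.
move=> p pn lp; rewrite -uo1 // -uo2 //.
have [p1|pn1] : p = 1%N \/ p = n by lia.
  by rewrite p1 a1 a2.
by rewrite pn1 b1 b2.
Qed.

End Simplicity.

(** * Composition series *)

Section Isomorphisms.
Variable R : pzRingType.
Implicit Types U V M : lmodType R.

Lemma inj_surj_bij (A B : Type) (f : A -> B) :
  injective f -> (forall y, exists x, f x = y) -> bijective f.
Proof.
move=> fI fS; exists (fun y => projT1 (cid (fS y))) => [x|y]; last by case: cid.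
by apply: fI; case: cid.
Qed.

Lemma isomorphic_sym M M' : isomorphic M M' -> isomorphic M' M.
Proof.
move=> [f [g fg gf]].
have gL : linear g.
  by move=> c x y; apply: (can_inj fg); rewrite linearP !gf.
exists (HB.pack_for {linear M' -> M} g (GRing.isLinear.Build R M' M *:%R g gL)).
by exists f.
Qed.

(** First isomorphism theorem for N / K, with the induced map given on representatives. *)
Lemma isomorphic_subquot V M (N K : submodClosed V) (g : {linear submod N -> M}) :
  (forall y, exists x, g x = y) -> (forall x, g x = 0 <-> val x \in K) ->
  isomorphic (subquot N K) M.
Proof.
move=> gS gK; pose f (u : subquot N K) := g (repr u).
have fpi x : f (pi_quotmod (restr_sub N K) x) = g x.
  apply/eqP; rewrite -subr_eq0 -linearB; apply/eqP/gK.
  have : repr (pi_quotmod (restr_sub N K) x) - x \in restr_sub N K.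
    by apply/pi_quotmodP; rewrite pi_quotmodK.
  exact.
have fL : linear f.
  move=> c u v; rewrite -[u]pi_quotmodK -[v]pi_quotmodK.
  rewrite -(linearP (pi_quotmod (restr_sub N K))) !fpi.
  exact: linearP.
exists (HB.pack_for {linear (subquot N K) -> M} f
  (GRing.isLinear.Build R (subquot N K) M *:%R f fL)).
apply: inj_surj_bij => [u v /= fuv|y]; last first.
  by have [x <-] := gS y; exists (pi_quotmod (restr_sub N K) x); exact: fpi.
move: fuv; rewrite -[u]pi_quotmodK -[v]pi_quotmodK !fpi => /eqP.
rewrite -subr_eq0 -linearB => /eqP/gK uvK; apply/pi_quotmodP; exact: uvK.
Qed.

Section Restriction.
Variables (U V : lmodType R) (f : {linear U -> V}) (N K : submodClosed U).

Section Onto.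
Variable N' : submodClosed V.
Hypothesis fN : forall x, x \in N -> f x \in N'.
Definition restrict (x : submod N) : submod N' := Sub (f (val x)) (fN (valP x)).
Lemma restrict_linear : linear restrict.
Proof. by move=> c x y; apply: val_inj; rewrite /= !linearP. Qed.
HB.instance Definition _ :=
  GRing.isLinear.Build R (submod N) (submod N') *:%R restrict restrict_linear.
End Onto.

Lemma isomorphic_submod (N' : submodClosed V) : (forall x, x \in N -> f x \in N') ->
  (forall y, y \in N' -> exists2 x, x \in N & f x = y) ->
  (forall x, x \in N -> f x = 0 <-> x \in K) -> isomorphic (subquot N K) (submod N').
Proof.
move=> fN fS fK; apply: (@isomorphic_subquot _ _ N K (restrict fN)) => [y|x].
  have [x Nx xy] := fS _ (valP y); exists (Sub x Nx).
  by apply: val_inj; rewrite /= -xy.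
rewrite -(fK _ (valP x)); split=> [/(congr1 val)|E]; first by [].
exact: val_inj.
Qed.

Lemma isomorphic_quot (N' K' : submodClosed V) : (forall x, x \in N -> f x \in N') ->
  (forall y, y \in N' -> exists2 x, x \in N & f x - y \in K') ->
  (forall x, x \in N -> f x \in K' <-> x \in K) -> isomorphic (subquot N K) (subquot N' K').
Proof.
move=> fN fS fK; pose g := pi_quotmod (restr_sub N' K') \o restrict fN.
apply: (@isomorphic_subquot _ _ N K (g : {linear submod N -> subquot N' K'})) => [u|x].
  have [x Nx xy] := fS _ (valP (repr u)); exists (Sub x Nx).
  by rewrite -[u]pi_quotmodK /=; apply/pi_quotmodP.
by rewrite -(fK _ (valP x)); apply: pi_subquot_eq0.
Qed.

Lemma isomorphic_whole : (forall y, exists2 x, x \in N & f x = y) ->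
  (forall x, x \in N -> f x = 0 <-> x \in K) -> isomorphic (subquot N K) V.
Proof.
move=> fS fK; pose g := f \o (val : submod N -> U).
have gL : linear g by move=> c x y; rewrite /g /= linearP.
apply: (@isomorphic_subquot _ _ N K
  (HB.pack_for {linear submod N -> V} g (GRing.isLinear.Build R (submod N) V *:%R g gL))).
  by move=> y; have [x Nx xy] := fS y; exists (Sub x Nx).
by move=> x; exact: fK (valP x).
Qed.

End Restriction.

Lemma isomorphic_refl M : isomorphic M M.
Proof. by exists idfun; exists id. Qed.

Lemma isomorphic_zero V (N : submodClosed V) : isomorphic (subquot N (zero_sub V)) (submod N).
Proof.
apply: (@isomorphic_submod _ _ (idfun : {linear V -> V})) => //= [y Ny|x _].
  by exists y.
by split=> [->|/eqP //]; exact: eqxx.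
Qed.

Lemma isomorphic_im U V (f : {linear U -> V}) (N : submodClosed V) :
  injective f -> (forall y, y \in N <-> exists x, f x = y) ->
  isomorphic (subquot N (zero_sub V)) U.
Proof.
move=> fI fN; have gE (y : submod N) : exists x, f x = val y by apply/fN/valP.
pose g y := projT1 (cid (gE y)); have fg y : f (g y) = val y by rewrite /g; case: cid.
have gL : linear g by move=> c x y; apply: fI; rewrite linearP !fg.
apply: (@isomorphic_subquot _ _ N _
  (HB.pack_for {linear submod N -> U} g (GRing.isLinear.Build R (submod N) U *:%R g gL))).
  move=> x; have Nx : f x \in N by apply/fN; exists x.
  by exists (Sub (f x) Nx); apply: fI; rewrite /= fg SubK.
move=> y; split=> [/= gy0|/eqP y0]; first by apply/eqP; rewrite -fg gy0 linear0.
by apply: fI; rewrite /= fg y0 linear0.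
Qed.

End Isomorphisms.

Section Sections.
Variable n : nat.
Implicit Types w : word n.

Lemma ends_AL m : (m.+1 < n)%N -> exists w : word n, with_ends m.+1 false true w.
Proof.
move=> mn; have n_gt0 : (0 < n)%N by lia.
exists (setlast true (cword n m)); rewrite /with_ends !lw_setlast // eqxx.
have cn : lw (cword n m) n = false by rewrite lw_cword; lia.
have := weight_setlast n_gt0 true (cword n m); rewrite cn weight_cword; try lia.
move=> ws; rewrite ltn_eqF; try lia.
by rewrite lw_cword; lia.
Qed.

Lemma ends_AA m : (m.+1 < n)%N -> exists w : word n, with_ends m false false w.
Proof.
move=> mn; have n_gt0 : (0 < n)%N by lia.
exists (cword n m); rewrite /with_ends weight_cword ?eqxx ?andbT; try lia.
by rewrite !lw_cword; lia.
Qed.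

Lemma ends_LL m : (m.+2 <= n)%N -> exists w : word n, with_ends m.+2 true true w.
Proof.
move=> mn; have n_gt0 : (0 < n)%N by lia.
exists (setlast true (zword n m.+1)); rewrite /with_ends !lw_setlast // eqxx.
have zn : lw (zword n m.+1) n = false by rewrite lw_zword; lia.
have := weight_setlast n_gt0 true (zword n m.+1); rewrite zn weight_zword; try lia.
move=> ws; rewrite ltn_eqF; try lia.
by rewrite lw_zword; lia.
Qed.

Lemma ends_LA m : (m.+1 < n)%N -> exists w : word n, with_ends m.+1 true false w.
Proof.
move=> mn; have n_gt0 : (0 < n)%N by lia.
exists (zword n m.+1); rewrite /with_ends weight_zword ?eqxx ?andbT; try lia.
by rewrite !lw_zword; lia.
Qed.

End Sections.

(** * Submodules spanned by words *)

Section Series.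
Variables (F : fieldType) (e n : nat) (kappa : 'Z_e * 'Z_e).
Hypotheses (e_ge3 : (3 <= e)%N) (kappa21 : kappa.2 = kappa.1 - 1) (n_gt0 : (0 < n)%N).
Hypothesis en : (e %| n)%N.
Local Notation S := (S_bihook F n kappa).
Local Notation Phi := (@Phi F e n kappa e_ge3 kappa21 n_gt0).
Local Notation Psi := (@Psi F e n kappa _).
Local Notation gamma := (gamma F n kappa).
Local Notation chi := (chi F n kappa).
Local Notation phi := (phi F n kappa).
Implicit Types (w u : word n).

(** For m <= n, [N] has as basis the standard vectors of the words of weight m satisfying [Q]; the
    values of [Q] at other weights are immaterial. *)
Definition carried m (N : submodClosed (S m)) (Q : pred (word n)) : Prop :=
  forall x, (x \in N) <-> supp Q (Phi m x).

Lemma carried_vword m N Q w : (m <= n)%N -> @carried m N Q -> weight w = m ->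
  (vword F kappa m w \in N) <-> Q w.
Proof.
move=> mn NQ wm; rewrite NQ Phi_vword //; split=> [Qd|Qw]; last exact: supp_delta.
by apply: contraT => /Qd/eqP; rewrite ffunE eqxx oner_eq0.
Qed.

Lemma carried_sub m N K P Q : (m <= n)%N -> @carried m N P -> @carried m K Q ->
  (forall w, weight w = m -> Q w -> P w) -> {subset K <= N}.
Proof.
move=> mn NP KQ QP x /KQ Qx; apply/NP => w Pw.
have [wm|wm] := eqVneq (weight w) m; last exact: (Phi_weight e_ge3 kappa21 n_gt0 mn).
by apply: Qx; apply: contra Pw; exact: QP.
Qed.

(** Modulo [K], an element of [T] can be stripped of its words in [Q], leaving a nonzero vector on
    words with ends [a], [b]. Then [ends_pick] extracts one such word and [ends_all] reaches all of
    them. *)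
Lemma simple_ends m (N K : submodClosed (S m)) (P Q : pred (word n)) (a b : bool) :
  (m <= n)%N -> carried N P -> carried K Q ->
  (forall w, weight w = m -> P w = Q w || ((lw w 1 == a) && (lw w n == b))) ->
  (forall w, weight w = m -> lw w 1 = a -> lw w n = b -> ~~ Q w) ->
  (exists w, with_ends m a b w) -> {subset K <= N} /\ simple_module (subquot N K).
Proof.
move=> mn NP KQ PQ Qn [w0 s0].
have KN : {subset K <= N} by apply: carried_sub NP KQ _ => // w wm Qw; rewrite PQ ?Qw.
have secP w : with_ends m a b w -> weight w = m /\ P w /\ ~~ Q w.
  case/and3P=> /eqP wa /eqP wb /eqP wm; split=> //.
  by rewrite PQ // wa wb !eqxx orbT; split=> //; exact: Qn.
split=> //; apply: simple_subquot => //.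
  have [wm [Pw Qw]] := secP _ s0; exists (vword F kappa m w0).
    by apply/(carried_vword mn NP wm).
  by apply/negP => /(carried_vword mn KQ wm); rewrite (negPf Qw).
move=> T KT TN [x Tx Kx] y /NP Py.
pose TT (f : vec F n) := (Psi f : S m) \in T.
have T0 : TT 0 by rewrite /TT Psi0 rpred0.
have TD f g : TT f -> TT g -> TT (f + g) by move=> Tf Tg; rewrite /TT PsiD rpredD.
have TZ c f : TT f -> TT (c *: f) by move=> Tf; rewrite /TT PsiZ rpredZ.
have Tfact h f : TT f -> TT (@hact F e n kappa e_ge3 kappa21 n_gt0 h f).
  by move=> Tf; rewrite /TT Psi_hact // rpredZ.
have Tx' : TT (Phi m x) by rewrite /TT PhiK.
have Px : supp P (Phi m x) by apply/NP/TN.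
pose f := \sum_(w | with_ends m a b w) (Phi m x : vec F n) w *: delta F w.
have fE w : f w = if with_ends m a b w then (Phi m x : vec F n) w else 0.
  rewrite /f sum_ffunE; case: ifP => sw.
    rewrite (bigD1 w) //= big1 => [|u /andP[_ uw]]; last first.
      by rewrite !ffunE eq_sym (negPf uw) scaler0.
    by rewrite !ffunE eqxx addr0 /GRing.scale /= mulr1.
  rewrite big1 // => u su; rewrite !ffunE; case: eqP => [E|_]; last by rewrite scaler0.
  by rewrite E su in sw.
pose g := \sum_(w | ~~ with_ends m a b w) (Phi m x : vec F n) w *: delta F w.
have fg : (Phi m x : vec F n) = f + g by rewrite [LHS]vec_sum (bigID (with_ends m a b)).
(* The complement [g] only involves words of [Q], so it comes from [K] and hence from [T]. *)
have Tf : TT f.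
  have -> : f = (Phi m x : vec F n) + (-1) *: g by rewrite fg scaleN1r addrK.
  apply: (TD _ _ Tx'); apply: (TZ); apply: (big_ind TT T0 TD) => w sw.
  have [fw|fw] := eqVneq ((Phi m x : vec F n) w) 0; first by rewrite fw scale0r.
  have wm : weight w = m.
    apply/eqP; apply: contraT => wm.
    by rewrite (Phi_weight e_ge3 kappa21 n_gt0 mn) ?eqxx in fw.
  have Pw : P w by apply: contraT => /Px E; rewrite E eqxx in fw.
  apply: TZ; rewrite /TT Psi_delta; apply/KT/(carried_vword mn KQ wm).
  by move: Pw; rewrite PQ // => /orP[//|ab]; rewrite /with_ends wm eqxx andbT ab in sw.
have Sf : supp (with_ends m a b) f by move=> w sw; rewrite fE (negPf sw).
(* Otherwise the support of [x] would lie in [Q], and [x] would be in [K]. *)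
have f0 : f != 0.
  apply/eqP => f0; case/negP: Kx; apply/KQ => w Qw.
  have [Pw|] := boolP (P w); last exact: Px.
  have [wm|wm] := eqVneq (weight w) m; last exact: (Phi_weight e_ge3 kappa21 n_gt0 mn).
  have := fE w; rewrite f0 ffunE /with_ends wm eqxx andbT.
  by move: Pw; rewrite PQ // (negPf Qw) /= => ->.
have [w1 s1 Tw1] := ends_pick en TZ Tfact Tf Sf f0.
apply: (Phi_ind mn _ Py) => w wm Pw.
have [Qw|Qw] := boolP (Q w); first by apply/KT/(carried_vword mn KQ wm).
have sw : with_ends m a b w.
  by move: Pw; rewrite /with_ends wm eqxx andbT PQ // (negPf Qw).
by have := ends_all en TZ Tfact s1 sw Tw1; rewrite /TT Psi_delta.
Qed.

Lemma carried_eq m N P Q : (m <= n)%N -> @carried m N P ->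
  (forall w, weight w = m -> P w = Q w) -> carried N Q.
Proof.
move=> mn NP PQ x; rewrite NP; split=> Hx w Hw;
  (have [wm|wm] := eqVneq (weight w) m; last exact: (Phi_weight e_ge3 kappa21 n_gt0 mn));
  by apply: Hx; rewrite ?PQ // -?PQ.
Qed.

Lemma carried_zero m : (m <= n)%N -> carried (zero_sub (S m)) pred0.
Proof.
move=> mn x; split=> [/eqP->|x0]; first by rewrite linear0 => w _; rewrite ffunE.
by apply/eqP/(Phi_eq0 e_ge3 kappa21 n_gt0 mn)/ffunP => w; rewrite x0 // ffunE.
Qed.

Lemma carried_full m : carried (full_sub (S m)) predT.
Proof. by []. Qed.

Lemma carried_ker_gamma m : (m < n)%N -> carried (ker (gamma m)) (@last_L n).
Proof. by move=> mn x; exact: mem_ker_gamma. Qed.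

Lemma carried_im_gamma m : (m < n)%N -> carried (im (gamma m)) (@last_L n).
Proof. by move=> mn x; exact: mem_im_gamma. Qed.

Lemma carried_im_chi m : (m < n)%N -> carried (im (chi m)) (@first_A n).
Proof. by move=> mn x; exact: mem_im_chi. Qed.

Lemma carried_im_phi m : (m.+1 < n)%N -> carried (im (phi m.+1)) (predI (@first_A n) (@last_L n)).
Proof. by move=> mn x; exact: mem_im_phi. Qed.

Lemma carried_add m (N K : submodClosed (S m)) P Q : (m <= n)%N ->
  carried N P -> carried K Q -> carried (add_sub N K) (predU P Q).
Proof.
move=> mn NP KQ x; split=> [/mem_addE[y /NP Py [z /KQ Qz ->]] w|PQx].
  rewrite /= negb_or => /andP[Pw Qw]; rewrite linearD ffunE.
  by rewrite (Py _ Pw) (Qz _ Qw) addr0.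
apply: (Phi_ind mn _ PQx) => w wm /orP[Pw|Qw]; apply/mem_addE.
  exists (vword F kappa m w); first by apply/(carried_vword mn NP wm).
  by exists 0; rewrite ?rpred0 ?addr0.
exists 0; rewrite ?rpred0 //; exists (vword F kappa m w); last by rewrite add0r.
by apply/(carried_vword mn KQ wm).
Qed.

Let n_ge3 : (3 <= n)%N := nge3 e_ge3 n_gt0 en.

(** gamma maps im chi onto the next im phi, since phi is gamma after chi; it kills exactly the words
    in im chi that also end with L. *)
Lemma isomorphic_chi m : (m.+2 < n)%N ->
  isomorphic (subquot (im (chi m.+1)) (im (phi m.+1))) (submod (im (phi m.+2))).
Proof.
move=> mn; apply: (@isomorphic_submod _ _ _ (gamma m.+1)).
- by move=> x /mem_imE[u <-]; apply/mem_imE; exists u; exact: (phiE e_ge3 kappa21 n_gt0 en).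
- move=> y /mem_imE[u <-]; exists (chi m.+1 u); first by apply/mem_imE; exists u.
  by rewrite (phiE e_ge3 kappa21 n_gt0 en).
have mn1 : (m.+1 < n)%N by lia.
move=> x /(carried_im_chi mn1) x1; rewrite -mem_kerE (carried_ker_gamma mn1).
rewrite (carried_im_phi mn1); split=> [x2 w|x12 w wl];
  last by apply: x12; rewrite /= negb_and wl orbT.
by rewrite /= negb_and => /orP[/x1|/x2].
Qed.

(** gamma_m maps onto its image, which is ker gamma_(m+1). A word that ends with A goes into im
    phi_(m+1) exactly when it starts with A, and a word that ends with L goes to 0. *)
Lemma isomorphic_top m (K : submodClosed (S m)) : (m.+1 < n)%N ->
  carried K (predU (@first_A n) (@last_L n)) ->
  isomorphic (subquot (full_sub (S m)) K) (subquot (ker (gamma m.+1)) (im (phi m.+1))).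
Proof.
move=> mn Kc; have mn' : (m < n)%N by lia.
apply: (@isomorphic_quot _ _ _ (gamma m)).
- move=> x _; apply/(carried_ker_gamma mn); apply/(carried_im_gamma mn').
  by apply/mem_imE; exists x.
- move=> y /(carried_ker_gamma mn)/(carried_im_gamma mn')/mem_imE[x <-].
  by exists x; rewrite ?subrr ?rpred0.
move=> x _; rewrite Kc (carried_im_phi mn).
have G : (Phi m.+1 (gamma m x) : vec F n) = Gam (Phi m x) by exact: Phi_gamma.
have last1 (w : word n) b : lw (setlast b w) 1 = lw w 1 by rewrite lw_setlast // ltn_eqF; lia.
split=> [Hx w|Hx w].
  rewrite /= negb_or => /andP[w1 wn]; rewrite -Gam_coef //; last exact: negPf.
  by rewrite -G; apply: Hx; rewrite /= negb_and /first_A last1 w1.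
rewrite /= negb_and G => /orP[w1|]; last exact: Gam_supp.
have [wn|] := boolP (lw w n); last exact: Gam_supp.
rewrite -(setlast_id n_gt0 wn) -(setlastK n_gt0 false true) Gam_coef ?lw_setlast ?eqxx //.
by apply: Hx; rewrite /= negb_or /first_A last1 w1 /last_L lw_setlast ?eqxx.
Qed.

End Series.

Section Main.
Variables (F : fieldType) (e n : nat) (kappa : 'Z_e * 'Z_e).
Hypotheses (e_ge3 : (3 <= e)%N) (kappa21 : kappa.2 = kappa.1 - 1) (n_gt0 : (0 < n)%N).
Hypothesis en : (e %| n)%N.
Local Notation S := (S_bihook F n kappa).
Local Notation gamma := (gamma F n kappa).
Local Notation chi := (chi F n kappa).
Local Notation phi := (phi F n kappa).
Local Notation simple_ends := (@simple_ends F e n kappa e_ge3 kappa21 n_gt0 en).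
Local Notation carried := (@carried F e n kappa e_ge3 kappa21 n_gt0).
Local Notation first_A := (@first_A n).
Local Notation last_L := (@last_L n).
Implicit Types (w : word n).

Let n_ge3 : (3 <= n)%N := nge3 e_ge3 n_gt0 en.

Let ends_weight m w a b : weight w = m -> lw w 1 = a -> lw w n = b ->
  (a + b <= m <= n - 2 + a + b)%N.
Proof. by move=> <- <- <-; apply: weight_ends; lia. Qed.

Lemma simple_im_phi m : (m.+1 < n)%N ->
  {subset zero_sub (S m.+1) <= im (phi m.+1)} /\
  simple_module (subquot (im (phi m.+1)) (zero_sub (S m.+1))).
Proof.
move=> mn; have mn' : (m.+1 <= n)%N by lia.
apply: (simple_ends (a := false) (b := true) mn'
  (carried_im_phi e_ge3 kappa21 n_gt0 en mn) (carried_zero e_ge3 kappa21 n_gt0 mn')) => //.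
  by move=> w wm; rewrite /= /first_A /last_L; case: (lw w 1); case: (lw w n).
exact: ends_AL.
Qed.

Lemma simple_im_chi m : (m.+2 < n)%N ->
  {subset im (phi m.+1) <= im (chi m.+1)} /\
  simple_module (subquot (im (chi m.+1)) (im (phi m.+1))).
Proof.
move=> mn; have mn' : (m.+1 <= n)%N by lia.
have mn1 : (m.+1 < n)%N by lia.
apply: (simple_ends (a := false) (b := false) mn'
  (carried_im_chi e_ge3 kappa21 n_gt0 en mn1) (carried_im_phi e_ge3 kappa21 n_gt0 en mn1)) => //.
- by move=> w wm; rewrite /= /first_A /last_L; case: (lw w 1); case: (lw w n).
- by move=> w wm w1 wn; rewrite /= /first_A /last_L w1 wn.
- exact: ends_AA.
Qed.

Lemma simple_top m (K : submodClosed (S m.+1)) : (m.+1 < n)%N ->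
  carried K (predU first_A last_L) ->
  {subset K <= full_sub (S m.+1)} /\ simple_module (subquot (full_sub (S m.+1)) K).
Proof.
move=> mn Kc; have mn' : (m.+1 <= n)%N by lia.
apply: (simple_ends (a := true) (b := false) mn' (@carried_full _ _ _ _ _ _ _ _) Kc) => //.
- by move=> w wm; rewrite /= /first_A /last_L; case: (lw w 1); case: (lw w n).
- by move=> w wm w1 wn; rewrite /= /first_A /last_L w1 wn.
- exact: ends_LA.
Qed.

(** A word with a single L that ends with L must start with A. *)
Lemma carried_im_chi1 : carried (im (chi 1)) (predU first_A last_L).
Proof.
apply: (carried_eq (P := first_A)) => //.
  by apply: carried_im_chi => //; lia.
move=> w wm; rewrite /= /first_A /last_L.
have := ends_weight wm (erefl (lw w 1)) (erefl (lw w n)).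
by case: (lw w 1); case: (lw w n).
Qed.

Lemma series_first : [/\ composition_series (S 1) [:: im (phi 1); im (chi 1); full_sub (S 1)],
  isomorphic (subquot (im (phi 1)) (zero_sub (S 1))) (S 0),
  isomorphic (subquot (im (chi 1)) (im (phi 1))) (submod (im (phi 2))) &
  isomorphic (subquot (full_sub (S 1)) (im (chi 1))) (subquot (ker (gamma 2)) (im (phi 2)))].
Proof.
have n2 : (1 < n)%N by lia.
split.
- have [s1 t1] := simple_im_phi n2; have [s2 t2] := simple_im_chi (m := 0) n_ge3.
  by have [s3 t3] := simple_top n2 carried_im_chi1.
- have c0 := carried_im_gamma (F := F) e_ge3 kappa21 n_gt0 en (m := 0) n_gt0.
  have c1 := carried_im_phi (F := F) e_ge3 kappa21 n_gt0 en (m := 0) n2.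
  (* gamma_0 is injective because the word of weight 0 does not end with L, and its image is im
     phi_1 because the only word of weight 1 ending with L starts with A. *)
  apply: (isomorphic_im (f := gamma 0)) => [x y E|y].
    apply/eqP; rewrite -subr_eq0; apply/eqP/(Phi_eq0 e_ge3 kappa21 n_gt0 (leq0n n)).
    have : x - y \in ker (gamma 0) by apply/mem_kerE; rewrite linearB E subrr.
    move=> /(carried_ker_gamma e_ge3 kappa21 n_gt0 en n_gt0) xy; apply/ffunP => w.
    rewrite [RHS]ffunE; have [wl|] := boolP (lw w n); last exact: xy.
    apply: (Phi_weight e_ge3 kappa21 n_gt0 (leq0n n)).
    by have := ends_weight (erefl (weight w)) (erefl _) wl; lia.
  rewrite -mem_imE c0; apply: iff_sym.
  have c1' : carried (im (phi 1)) last_L.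
    apply: (carried_eq n_gt0 c1) => w wm; rewrite /= /first_A /last_L.
    have := ends_weight wm (erefl (lw w 1)) (erefl (lw w n)).
    by case: (lw w 1); case: (lw w n).
  exact: iff_sym (c1' y).
- exact: isomorphic_chi.
- exact: (isomorphic_top en n_ge3 carried_im_chi1).
Qed.

Lemma series_middle m : (2 <= m <= n - 2)%N ->
  [/\ composition_series (S m)
        [:: im (phi m); im (chi m); add_sub (ker (gamma m)) (im (chi m)); full_sub (S m)],
      isomorphic (subquot (im (phi m)) (zero_sub (S m))) (submod (im (phi m))),
      isomorphic (subquot (im (chi m)) (im (phi m))) (submod (im (phi m.+1))),
      isomorphic (subquot (add_sub (ker (gamma m)) (im (chi m))) (im (chi m)))
                 (subquot (ker (gamma m)) (im (phi m))) &
      isomorphic (subquot (full_sub (S m)) (add_sub (ker (gamma m)) (im (chi m))))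
                 (subquot (ker (gamma m.+1)) (im (phi m.+1)))].
Proof.
case: m => [|[|m]] // mn2; have mn3 : (m.+3 < n)%N by lia.
have mn : (m.+2 < n)%N by lia.
have mn' : (m.+2 <= n)%N by lia.
have cker := carried_ker_gamma (F := F) e_ge3 kappa21 n_gt0 en mn.
have cchi := carried_im_chi (F := F) e_ge3 kappa21 n_gt0 en mn.
have cphi := carried_im_phi (F := F) e_ge3 kappa21 n_gt0 en mn.
have cadd : carried (add_sub (ker (gamma m.+2)) (im (chi m.+2))) (predU first_A last_L).
  apply: (carried_eq mn' (carried_add mn' cker cchi)) => w _.
  by rewrite /= orbC.
split.
- have [s1 t1] := simple_im_phi mn; have [s2 t2] := simple_im_chi mn3.
  have [s4 t4] := simple_top mn cadd.
  have [s3 t3] : {subset im (chi m.+2) <= add_sub (ker (gamma m.+2)) (im (chi m.+2))} /\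
    simple_module (subquot (add_sub (ker (gamma m.+2)) (im (chi m.+2))) (im (chi m.+2))).
    apply: (simple_ends (a := true) (b := true) mn' cadd cchi) => //.
    + by move=> w wm; rewrite /= /first_A /last_L;
        case: (lw w 1); case: (lw w n).
    + by move=> w wm w1 wn; rewrite /= /first_A w1.
    + exact: ends_LL.
  by [].
- exact: isomorphic_zero.
- exact: isomorphic_chi.
(* Second isomorphism theorem: the identity induces the map, since the intersection of ker gamma and
   im chi is im phi. *)
- apply: isomorphic_sym.
  apply: (@isomorphic_quot _ _ _ (idfun : {linear S m.+2 -> S m.+2})) => /= [x xk|y|x xk].
  + by apply/mem_addE; exists x => //; exists 0; rewrite ?rpred0 ?addr0.
  + move=> /mem_addE[x xk [z zc ->]]; exists x; first exact xk.
    by rewrite opprD addrA subrr add0r -scaleN1r; apply: rpredZ.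
  + rewrite cchi cphi; split=> [xc w|xp w wA].
      by rewrite /= negb_and => /orP[/xc //|]; exact: (cker x).1.
    by apply: xp; rewrite /= negb_and wA.
- exact: (isomorphic_top en mn3 cadd).
Qed.

End Main.

(** With a single A, a word starting with A ends with L, so im chi coincides with im phi and the
    series has one term less. Writing n as p + 2 makes n - 1 and n - 2 the plain indices p + 1 and
    p. *)
Lemma series_last (F : fieldType) (e p : nat) (kappa : 'Z_e * 'Z_e) :
  (3 <= e)%N -> kappa.2 = kappa.1 - 1 -> (e %| p.+2)%N ->
  let S := S_bihook F p.+2 kappa in
  let gamma := gamma F p.+2 kappa in
  let phi := phi F p.+2 kappa in
  [/\ composition_series (S p.+1) [:: im (phi p.+1); im (gamma p); full_sub (S p.+1)],
      isomorphic (subquot (im (phi p.+1)) (zero_sub (S p.+1))) (submod (im (phi p.+1))),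
      isomorphic (subquot (im (gamma p)) (im (phi p.+1)))
                 (subquot (im (gamma p)) (im (phi p.+1))) &
      isomorphic (subquot (full_sub (S p.+1)) (im (gamma p))) (S p.+2)].
Proof.
move=> e_ge3 kappa21 en S gamma phi; set n := p.+2.
have n_gt0 : (0 < n)%N by [].
have pn : (p.+1 < n)%N by [].
have pn' : (p < n)%N by exact: ltnW.
have n_ge3 := nge3 e_ge3 n_gt0 en.
have cphi := carried_im_phi (F := F) e_ge3 kappa21 n_gt0 en pn.
have cgam := carried_im_gamma (F := F) e_ge3 kappa21 n_gt0 en pn'.
split.
- have [s1 t1] := simple_im_phi F e_ge3 kappa21 n_gt0 en pn.
  have [s2 t2] : {subset im (phi p.+1) <= im (gamma p)} /\
      simple_module (subquot (im (gamma p)) (im (phi p.+1))).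
    apply: (simple_ends (a := true) (b := true) en _ cgam cphi) => //.
    + by move=> w wm; rewrite /= /first_A /last_L; case: (lw w 1); case: (lw w n).
    + by move=> w wm w1 wn; rewrite /= /first_A w1.
    (* This is [n_ge3] up to conversion. *)
    + have p0 : (0 < p)%N by [].
      by have := @ends_LL n p.-1; rewrite (prednK p0); apply.
  have [s3 t3] : {subset im (gamma p) <= full_sub (S p.+1)} /\
      simple_module (subquot (full_sub (S p.+1)) (im (gamma p))).
    apply: (simple_ends (a := true) (b := false) en _ (@carried_full _ _ _ _ _ _ _ _) cgam) => //.
    (* In weight n - 1 a word ending with A starts with L, by [weight_ends]. *)
    + move=> w wm; rewrite /= /last_L.
      have := @weight_ends n w isT; rewrite wm.
      by case: (lw w 1); case: (lw w n) => //=; lia.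
    + by move=> w wm w1 wn; rewrite /last_L wn.
    + exact: ends_LA.
  by [].
- exact: isomorphic_zero.
- exact: isomorphic_refl.
(* Every word of weight n ends with L, so gamma_(n-1) is onto; its kernel is im gamma_(n-2). *)
- apply: (@isomorphic_whole _ _ _ (gamma p.+1)) => [y|x _].
    have : y \in im (gamma p.+1).
      apply/(carried_im_gamma e_ge3 kappa21 n_gt0 en pn) => w wl.
      apply: (Phi_weight e_ge3 kappa21 n_gt0 (leqnn n)); apply/eqP => wm.
      have := @weight_ends n w isT; rewrite wm; move: wl; rewrite /last_L.
      by case: (lw w n) => //; case: (lw w 1); lia.
    by move=> /mem_imE[x <-]; exists x.
  by rewrite -mem_kerE (carried_ker_gamma e_ge3 kappa21 n_gt0 en pn) cgam.
Qed.

Theorem theorem6p16 (F : fieldType) (e n : nat) (kappa : 'Z_e * 'Z_e)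
    (he : (3 <= e)%N) (hn : (1 <= n)%N)
    (hkappa : kappa.2 = kappa.1 - 1) (hen : (e %| n)%N) :
  let S m := S_bihook F n kappa m in
  let gamma m := gamma F n kappa m in
  let chi m := chi F n kappa m in
  let phi m := phi F n kappa m in
  [/\ [/\ composition_series (S 1%N) [:: im (phi 1%N); im (chi 1%N); full_sub (S 1%N)],
          isomorphic (subquot (im (phi 1%N)) (zero_sub (S 1%N))) (S 0%N),
          isomorphic (subquot (im (chi 1%N)) (im (phi 1%N))) (submod (im (phi 2%N))) &
          isomorphic (subquot (full_sub (S 1%N)) (im (chi 1%N)))
                     (subquot (ker (gamma 2%N)) (im (phi 2%N)))],
      (forall m : nat, (2 <= m <= n - 2)%N ->
        [/\ composition_series (S m)
              [:: im (phi m); im (chi m); add_sub (ker (gamma m)) (im (chi m));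
                  full_sub (S m)],
            isomorphic (subquot (im (phi m)) (zero_sub (S m))) (submod (im (phi m))),
            isomorphic (subquot (im (chi m)) (im (phi m))) (submod (im (phi m.+1))),
            isomorphic (subquot (add_sub (ker (gamma m)) (im (chi m))) (im (chi m)))
                       (subquot (ker (gamma m)) (im (phi m))) &
            isomorphic (subquot (full_sub (S m)) (add_sub (ker (gamma m)) (im (chi m))))
                       (subquot (ker (gamma m.+1)) (im (phi m.+1)))]) &
      (* p.+1 is n - 1 *)
      let p := (n - 2)%N in
      [/\ composition_series (S p.+1) [:: im (phi p.+1); im (gamma p); full_sub (S p.+1)],
          isomorphic (subquot (im (phi p.+1)) (zero_sub (S p.+1)))
                     (submod (im (phi p.+1))),
          isomorphic (subquot (im (gamma p)) (im (phi p.+1)))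
                     (subquot (im (gamma p)) (im (phi p.+1))) &
          isomorphic (subquot (full_sub (S p.+1)) (im (gamma p))) (S n)]].
Proof.
have [p np] : exists p, n = p.+2.
  by exists (n - 2)%N; have := nge3 he hn hen; lia.
split; first exact: series_first.
  by move=> m; exact: series_middle.
subst n; rewrite subn2 /=; exact: series_last.
Qed.
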